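(* In both the discrete-time and the continuous-time setting of the context, let $p^*$, $d^*$ be the optimal values of the infinite-dimensional primal and dual linear programs, and for $k\ge k_0$ let $p_k^*$, $d_k^*$ be the optimal values of the primal (moment) and dual (sum-of-squares) semidefinite programs of order $k$, as defined in the context. Then for all $k\ge k_0$ $$d^*\le d_{k+1}^*\le d_k^*\quad\text{and}\quad \lim_{k\to\infty}d_k^*=d^*,$$ and $$p^*\le p_{k+1}^*\le p_k^*\quad\text{and}\quad \lim_{k\to\infty}p_k^*=p^*.$$
   Context: Data. $f:\mathbb{R}^n\times\mathbb{R}^m\to\mathbb{R}^n$ has polynomial entries; $X=\{x\in\mathbb{R}^n: g_{X_i}(x)\ge 0,\ i=1,\dots,n_X\}$ and $U=\{u\in\mathbb{R}^m: g_{U_i}(u)\ge0,\ i=1,\dots,n_U\}$ are compact with polynomial $g_{X_i},g_{U_i}$. Standing assumption: one of the $g_{X_i}$ equals $R_X^2-\|x\|_2^2$ and one of the $g_{U_i}$ equals $R_U^2-\|u\|_2^2$, with $R_X,R_U$ sufficiently large constants. $\lambda$ is the $n$-dimensional Lebesgue measure. Two settings, treated in parallel. For a function $v$ of $x$ put - discrete time (system $x_{t+1}=f(x_t,u_t)$, discount $\alpha\in(0,1)$): $(Lv)(x,u)=v(x)-\alpha v(f(x,u))$, with $\mathcal{V}=C(\mathbb{R}^n)$; - continuous time (system $\dot x\in\mathrm{conv}\,f(x,U)$, discount $\beta>0$): $(Lv)(x,u)=\beta v(x)-\mathrm{grad}\,v(x)\cdot f(x,u)$, with $\mathcal{V}=C^1(\mathbb{R}^n)$.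 Infinite-dimensional LPs. Primal: $p^*=\sup\mu_0(X)$ over nonnegative finite Borel measures $\mu$ on $X\times U$ and $\mu_0,\hat\mu_0$ on $X$ such that $\int Lv\,d\mu=\int v\,d\mu_0$ for all $v\in\mathcal{V}$ and $\int w\,d\mu_0+\int w\,d\hat\mu_0=\int_X w\,d\lambda$ for all $w\in C(X)$. Dual: $d^*=\inf\int_X w\,d\lambda$ over $(v,w)\in\mathcal{V}\times C(X)$ such that $Lv\ge0$ on $X\times U$, $w\ge v+1$ on $X$ and $w\ge 0$ on $X$. Finite-dimensional SDPs. $\mathbb{R}_r[\cdot]$ denotes real polynomials of total degree at most $r$. Let $d_{X_i}=\lceil\deg g_{X_i}/2\rceil$, $d_{U_i}=\lceil\deg g_{U_i}/2\rceil$, and let $k_0\ge1$ be the maximum of all these integers; $k\ge k_0$ is the relaxation order. For a real vector $y$ indexed by the monomials of degree at most $2k$ in variables $z$, let $\ell_y$ be the linear functional on $\mathbb{R}_{2k}[z]$ sending each monomial to the corresponding entry of $y$. The moment matrix $M_k(y)$ is the symmetric matrix (in the monomial basis) of the quadratic form $p\mapsto\ell_y(p^2)$ on $\mathbb{R}_k[z]$; the localizing matrix $M_{k-d}(g,y)$, $d=\lceil \deg g/2\rceil$, is that of $p\mapsto\ell_y(g\,p^2)$ on $\mathbb{R}_{k-d}[z]$. Let $V_k=\{v\in\mathbb{R}_{2k}[x]: Lv\in\mathbb{R}_{2k}[x,u]\}$. Primal of order $k$: $p_k^*$ is the maximum of $(y_0)_0=\ell_{y_0}(1)$ over vectors $y$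 (in variables $(x,u)$), $y_0$, $\hat y_0$ (in variables $x$) of moments up to degree $2k$ such that $\ell_y(Lv)=\ell_{y_0}(v)$ for all $v\in V_k$; $\ell_{y_0}(w)+\ell_{\hat y_0}(w)=\int_X w\,d\lambda$ for all $w\in\mathbb{R}_{2k}[x]$; the matrices $M_k(y)$, $M_k(y_0)$, $M_k(\hat y_0)$, $M_{k-d_{X_i}}(g_{X_i},y)$, $M_{k-d_{X_i}}(g_{X_i},y_0)$, $M_{k-d_{X_i}}(g_{X_i},\hat y_0)$ ($i=1,\dots,n_X$) and $M_{k-d_{U_i}}(g_{U_i},y)$ ($i=1,\dots,n_U$) are positive semidefinite. Dual of order $k$: $d_k^*$ is the infimum of $\int_X w\,d\lambda$ over $v,w\in\mathbb{R}_{2k}[x]$ such that, as polynomial identities, $$Lv=q_0+\sum_{i=1}^{n_X}q_i\,g_{X_i}+\sum_{i=1}^{n_U}r_i\,g_{U_i},\qquad w-v-1=p_0+\sum_{i=1}^{n_X}p_i\,g_{X_i},\qquad w=s_0+\sum_{i=1}^{n_X}s_i\,g_{X_i},$$ where $q_0,q_i,r_i$ are sums of squares of polynomials in $(x,u)$ and $p_0,p_i,s_0,s_i$ sums of squares of polynomials in $x$; the squared polynomials have degree at most $k$ for index $0$, at most $k-d_{X_i}$ for $q_i,p_i,s_i$, and at most $k-d_{U_i}$ for $r_i$. *)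

(* Defs.v *)
From HB Require Import structures.
From mathcomp Require Import all_boot all_order all_algebra.
(* mpoly is imported without its notations, which clash with those of           *)
(* mathcomp-analysis, and first, as it has another isMeasure.                   *)
From mathcomp.multinomials Require mpoly.
Import -(notations) mpoly.
From mathcomp Require Import all_classical all_reals all_analysis.

Set Implicit Arguments.
Unset Strict Implicit.
Unset Printing Implicit Defensive.
Import Order.TTheory GRing.Theory Num.Theory.
Import numFieldNormedType.Exports.

Local Open Scope classical_set_scope.
Local Open Scope ring_scope.

Notation borel T := (g_sigma_algebraType (@open T)).

(* n-dimensional Lebesgue measure on the Borel sets of R^n: the iterated        *)
(* product of the one-dimensional one, transported along                        *)
(* R * R^n ~ R^(n+1). lebesgue_rV_box below gives the volume of boxes.          *)
Section lebesgue_step.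
Context {R : realType} (n : nat).
Local Notation T := (borel 'rV[R]_n).
Local Notation T' := (borel 'rV[R]_n.+1).

Definition consr (z : measurableTypeR R * T) : T' :=
  \row_i (if unlift ord0 i is Some j then (z.2 : 'rV[R]_n) ord0 j else z.1).

Lemma consr0 z : (consr z : 'rV[R]_n.+1) ord0 ord0 = z.1.
Proof. by rewrite mxE unlift_none. Qed.

Lemma consrS z i :
  (consr z : 'rV[R]_n.+1) ord0 (lift ord0 i) = (z.2 : 'rV[R]_n) ord0 i.
Proof. by rewrite mxE liftK. Qed.

Definition unconsr (x : T') : measurableTypeR R * T :=
  ((x : 'rV[R]_n.+1) ord0 ord0, \row_i (x : 'rV[R]_n.+1) ord0 (lift ord0 i)).

Lemma consrK : cancel consr unconsr.
Proof.
move=> [a v]; rewrite /unconsr consr0/=; congr pair.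
by apply/rowP => i; rewrite mxE consrS.
Qed.

Lemma unconsrK : cancel unconsr consr.
Proof.
move=> x; apply/rowP => i; have [->|] := eqVneq i ord0; first by rewrite consr0.
by rewrite eq_sym => /unlift_some[j -> _]; rewrite consrS mxE.
Qed.


Lemma continuous_behead : continuous
  (fun x : 'rV[R]_n.+1 => (\row_i x ord0 (lift ord0 i)) : 'rV[R]_n).
Proof.
move=> x A [P Px PA].
exists (fun _ j => if unlift ord0 j is Some l then P ord0 l else setT).
  move=> i j /=; rewrite !ord1; case: unliftP => [l ->|_]; last exact: filterT.
  by have := Px ord0 l; rewrite mxE.
move=> y Hy /=; apply: PA => i j; rewrite !ord1 mxE.
by have := Hy ord0 (lift ord0 j); rewrite liftK.
Qed.

Lemma measurable_unconsr : measurable_fun [set: T'] unconsr.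
Proof.
apply/measurable_fun_pairP; split.
- apply: (measurability _ (measurable_realfun.RGenOpens.measurableE R)).
  move=> _ [_ [a [b ->] <-]]; rewrite setTI; apply: sub_sigma_algebra => /=.
  apply: (@open_comp _ _ (fun x : 'rV[R]_n.+1 => x ord0 ord0)).
    by move=> x _; exact: coord_continuous.
  exact: interval_open.
- apply: (@measurability _ _ T' T _ _ (@open 'rV[R]_n)) => // _ [A oA <-]; rewrite setTI.
  apply: sub_sigma_algebra; move: oA; apply: open_comp => x _.
  exact: continuous_behead.
Qed.

Lemma open_rat_ball k (A : set 'rV[R]_k) : open A ->
  A = \bigcup_(q in [set q : 'rV[rat]_k * nat |
        ball (map_mx ratr q.1 : 'rV[R]_k) q.2.+1%:R^-1 `<=` A])
      ball (map_mx ratr q.1 : 'rV[R]_k) q.2.+1%:R^-1.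
Proof.
move=> oA; apply/seteqP; split=> [x Ax|x [q /= qA]]; last exact: qA.
have /nbhs_ballP[e /= e0 eA] : nbhs x A by exact: open_nbhs_nbhs.
have [N Ne] : exists N : nat, N.+1%:R^-1 < e / 2 :> R.
  have [N _ H] := near_infty_natSinv_lt (PosNum (divr_gt0 e0 (ltr0n _ 2))).
  by exists N; apply: (H N) => /=.
have N0 : 0 < N.+1%:R^-1 :> R by rewrite invr_gt0.
have /choice[q xq] : forall i : 'I_k, exists q : rat,
    ball (x ord0 i) N.+1%:R^-1 (ratr q : R).
  move=> i; have [y [xy [q _ qy]]] := @dense_rat R (ball (x ord0 i) N.+1%:R^-1)
    (ex_intro _ _ (ballxx _ N0)) (ball_open _ _).
  by exists q; rewrite qy.
exists (\row_i q i, N) => /=.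
  move=> y qy; apply: eA; apply: (@le_ball _ _ _ (N.+1%:R^-1 + N.+1%:R^-1)).
    by rewrite [leRHS]splitr lerD// ltW.
  apply: ball_triangle qy; split=> // i j.
  by rewrite !ord1 !mxE; exact: xq.
by apply: ball_sym; split=> // i j; rewrite !ord1 !mxE; exact: xq.
Qed.

Lemma measurable_consr : measurable_fun [set: measurableTypeR R * T] consr.
Proof.
apply: (@measurability _ _ _ T' _ _ (@open 'rV[R]_n.+1)) => // _ [A oA <-]; rewrite setTI.
rewrite (open_rat_ball oA) preimage_bigcup bigcup_mkcond.
apply: countable_bigcupT_measurable; first exact: countableP.
move=> q; case: ifPn => // _; set c := map_mx _ _; set e := _^-1.
have e0 : 0 < e by rewrite invr_gt0.
clearbody c e.
rewrite (_ : _ @^-1` _ =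
  ball (c ord0 ord0) e `*` ball (\row_(i < n) c ord0 (lift ord0 i)) e).
  apply: measurableX; first exact: measurable_realfun.measurable_ball.
  by apply: sub_sigma_algebra; exact: ball_open.
apply/seteqP; split=> [[a v] /= [_ H]|[a v] /= [Ha [_ Hv]]].
  split => /=; first by have := H ord0 ord0; rewrite consr0.
  by split=> // i j; rewrite mxE (ord1 i); have := H ord0 (lift ord0 j); rewrite consrS.
split=> // i j; rewrite (ord1 i); have [->|] := eqVneq j ord0.
  by rewrite consr0.
rewrite eq_sym => /unlift_some[l -> _]; rewrite consrS.
by have := Hv ord0 l; rewrite [X in ball X]mxE.
Qed.

Section step.
Variable mu : {sigma_finite_measure set T -> \bar R}.
Local Open Scope ereal_scope.

Definition lebesgue_cons : set T' -> \bar R :=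
  pushforward (@lebesgue_measure R \x mu) consr.

Let lc0 : lebesgue_cons set0 = 0.
Proof. by rewrite /lebesgue_cons /pushforward preimage_set0 measure0. Qed.

Let lc_ge0 A : 0 <= lebesgue_cons A.
Proof. by rewrite /lebesgue_cons /pushforward; exact: measure_ge0. Qed.

Let lc_sigma_additive : semi_sigma_additive lebesgue_cons.
Proof.
exact: (@measure_semi_sigma_additive _ _ _
  (measure_function_pushforward__canonical__measure_function_Measure
    (lebesgue_measure \x mu) measurable_consr)).
Qed.

HB.instance Definition _ := isMeasure.Build _ _ _ lebesgue_cons
  lc0 lc_ge0 lc_sigma_additive.

Let lc_sigma_finite : sigma_finite setT lebesgue_cons.
Proof.
have /sigma_finiteP[F [TF ndF Foo]] := sigma_finiteT (@lebesgue_measure R).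
have /sigma_finiteP[G [TG ndG Goo]] := sigma_finiteT mu.
exists (fun k => unconsr @^-1` (F k `*` G k)).
  apply/seteqP; split=> // x _.
  have [i _ Fi] : (\bigcup_i F i) (unconsr x).1 by rewrite -TF.
  have [j _ Gj] : (\bigcup_i G i) (unconsr x).2 by rewrite -TG.
  exists (maxn i j) => //; split.
  - by move: Fi; apply/subsetPset/ndF/leq_maxl.
  - by move: Gj; apply/subsetPset/ndG/leq_maxr.
move=> k; have [mF Fk] := Foo k; have [mG Gk] := Goo k.
have mFG : measurable (F k `*` G k) by exact: measurableX.
split.
  by rewrite -[X in measurable X]setTI; exact: measurable_unconsr.
rewrite /lebesgue_cons /pushforward -comp_preimage.
rewrite (_ : unconsr \o consr = id); last first.
  by apply/funext => z /=; rewrite consrK.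
rewrite preimage_id product_measure1E//.
by rewrite lte_mul_pinfty// ge0_fin_numE.
Qed.

HB.instance Definition _ := Measure_isSigmaFinite.Build _ _ _ lebesgue_cons
  lc_sigma_finite.

End step.

End lebesgue_step.


Fixpoint lebesgue_rV (R : realType) (n : nat) :
    {sigma_finite_measure set (borel 'rV[R]_n) -> \bar R} :=
  match n with
  | 0 => @dirac _ (borel 'rV[R]_0) (0 : 'rV[R]_0) R
  | n'.+1 => lebesgue_cons (lebesgue_rV R n')
  end.

Definition box (R : realType) n (a b : 'rV[R]_n) : set 'rV[R]_n :=
  [set x | forall i, a ord0 i <= x ord0 i <= b ord0 i].

Lemma boxS (R : realType) n (a b : 'rV[R]_n.+1) :
  box a b = @unconsr R n @^-1` (`[a ord0 ord0, b ord0 ord0]%classic `*`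
    box (unconsr a).2 (unconsr b).2).
Proof.
apply/seteqP; split=> [x abx|x [/= ab0 abS] i].
  split=> /=; first by rewrite in_itv/=; exact: abx.
  by move=> i; rewrite !mxE; exact: abx.
have [->|] := eqVneq i ord0; first by rewrite in_itv in ab0.
by rewrite eq_sym => /unlift_some[j -> _]; have := abS j; rewrite !mxE.
Qed.

Lemma measurable_box (R : realType) n (a b : 'rV[R]_n) :
  measurable (box a b : set (borel 'rV[R]_n)).
Proof.
elim: n a b => [|n IH] a b.
  by rewrite (_ : box a b = setT)//; apply/seteqP; split => // x _ [].
rewrite boxS -[X in measurable X]setTI; apply: measurable_unconsr => //.
by apply: measurableX => //; exact: measurable_itv.
Qed.

Lemma lebesgue_rV_box (R : realType) n (a b : 'rV[R]_n) :
  (forall i, a ord0 i <= b ord0 i) ->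
  lebesgue_rV R n (box a b) = (\prod_(i < n) (b ord0 i - a ord0 i))%:E.
Proof.
elim: n a b => [|n IH] a b ab /=.
  by rewrite big_ord0 diracE mem_set//= => -[].
rewrite boxS /lebesgue_cons /pushforward -comp_preimage.
rewrite (_ : _ \o _ = id); last by apply/funext => z /=; rewrite consrK.
rewrite preimage_id product_measure1E//; last exact: measurable_box.
rewrite IH; last by move=> i; rewrite !mxE.
rewrite big_ord_recl EFinM.
congr (_ * _)%E; last by congr EFin; apply: eq_bigr => i _; rewrite !mxE.
rewrite [LHS]lebesgue_measure_itv/= lte_fin.
have := ab ord0; rewrite le_eqVlt => /orP[/eqP->|->//].
by rewrite ltxx subrr.
Qed.

Section polynomials.
Context {R : realType}.

Definition peval k (p : mpoly k R) (x : 'rV[R]_k) : R :=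
  meval (fun i => x ord0 i) p.

Definition deg_le k (p : mpoly k R) (r : nat) : bool := (msize p <= r.+1)%N.

(* ceil (deg g / 2); msize g is deg g + 1, and 0 for g = 0 *)
Definition half_deg k (g : mpoly k R) : nat := uphalf (msize g).-1.

Definition semialg k N (g : 'I_N -> mpoly k R) : set 'rV[R]_k :=
  [set x | forall i, 0 <= peval (g i) x].

(* r^2 - ||x||_2^2 *)
Definition ball_poly k (r : R) : mpoly k R :=
  mpolyC k (r ^+ 2) - \sum_(i < k) mpolyX R (mnm1 i) ^+ 2.

Definition is_sos k (r : nat) (q : mpoly k R) : Prop :=
  exists2 s : seq (mpoly k R),
    all (fun p => deg_le p r) s & q = \sum_(p <- s) p ^+ 2.

(* real vectors indexed by the monomials of degree at most 2 * k *)
Definition moments (N k : nat) := {ffun bmultinom N (2 * k).+1 -> R}.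

Definition riesz N k (y : moments N k) (p : mpoly N R) : R :=
  \sum_(a : bmultinom N (2 * k).+1) mcoeff a p * y a.

Definition basis_mono N r (i : 'I_#|{: bmultinom N r.+1}|) : mpoly N R :=
  mpolyX R (bmnm (enum_val i)).

Definition moment_mx N k (y : moments N k) (r : nat) :
    'M[R]_#|{: bmultinom N r.+1}| :=
  \matrix_(i, j) riesz y (basis_mono i * basis_mono j).

Definition localizing_mx N k (g : mpoly N R) (y : moments N k) (r : nat) :
    'M[R]_#|{: bmultinom N r.+1}| :=
  \matrix_(i, j) riesz y (g * (basis_mono i * basis_mono j)).

Definition psd N (A : 'M[R]_N) : Prop :=
  A^T = A /\ forall c : 'rV[R]_N, 0 <= (c *m A *m c^T) ord0 ord0.

End polynomials.

Section settings.
Context {R : realType} {n m : nat}.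
Implicit Types (v : 'rV[R]_n -> R) (x : 'rV[R]_n) (u : 'rV[R]_m).
Implicit Types (p : mpoly n R) (f : n.-tuple (mpoly (n + m) R)).

(* Polynomials in (x, u) are polynomials in n + m variables, the first n of     *)
(* which are those of x; lift_x and lift_u embed R[x] and R[u] in R[x, u].      *)
Definition lift_x p : mpoly (n + m) R :=
  comp_mpoly [tuple mpolyX R (mnm1 (lshift m i)) | i < n] p.

Definition lift_u (p : mpoly m R) : mpoly (n + m) R :=
  comp_mpoly [tuple mpolyX R (mnm1 (rshift n i)) | i < m] p.

Definition vfield f x u : 'rV[R]_n := \row_i peval (tnth f i) (row_mx x u).

Definition grad v x : 'rV[R]_n := \row_i 'D_(delta_mx ord0 i) v x.

Definition C1 : set ('rV[R]_n -> R) :=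
  [set v | (forall x, differentiable v x) /\ continuous (grad v)].

(* The space of functions v, the operator L on functions, and the same          *)
(* operator from R[x] to R[x, u] (see Lpoly_discrete and Lpoly_continuous).     *)
Record setting := Setting {
  Vspace : set ('rV[R]_n -> R) ;
  Lop : ('rV[R]_n -> R) -> 'rV[R]_n -> 'rV[R]_m -> R ;
  Lpoly : mpoly n R -> mpoly (n + m) R }.

Definition discrete_setting (alpha : R) f : setting := {|
  Vspace := [set v | continuous v] ;
  Lop := fun v x u => v x - alpha * v (vfield f x u) ;
  Lpoly := fun p => lift_x p - alpha *: comp_mpoly f p |}.

Definition continuous_setting (beta : R) f : setting := {|
  Vspace := C1 ;
  Lop := fun v x u => beta * v x -
    \sum_(i < n) grad v x ord0 i * vfield f x u ord0 i ;
  Lpoly := fun p => beta *: lift_x p -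
    \sum_(i < n) lift_x (mderiv i p) * tnth f i |}.

End settings.
Arguments setting : clear implicits.

Section settings_facts.
Context {R : realType} {n m : nat}.
Implicit Types (f : n.-tuple (mpoly (n + m) R)) (p : mpoly n R).

Lemma peval_lift_x p (x : 'rV[R]_n) (u : 'rV[R]_m) :
  peval (lift_x p) (row_mx x u) = peval p x.
Proof.
rewrite /peval /lift_x comp_mpoly_meval; apply: meval_eq => i.
by rewrite tnth_mktuple mevalXU row_mxEl.
Qed.

Lemma peval_lift_u (p : mpoly m R) (x : 'rV[R]_n) (u : 'rV[R]_m) :
  peval (lift_u p) (row_mx x u) = peval p u.
Proof.
rewrite /peval /lift_u comp_mpoly_meval; apply: meval_eq => i.
by rewrite tnth_mktuple mevalXU row_mxEr.
Qed.

Lemma Lpoly_discrete (alpha : R) f p (x : 'rV[R]_n) (u : 'rV[R]_m) :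
  peval (Lpoly (discrete_setting alpha f) p) (row_mx x u) =
  Lop (discrete_setting alpha f) (peval p) x u.
Proof.
rewrite /= {1}/peval mevalB mevalZ -!/(peval _ _) peval_lift_x; congr (_ - _ * _).
by rewrite /peval comp_mpoly_meval; apply: meval_eq => i; rewrite mxE.
Qed.

Lemma diff_peval p (x : 'rV[R]_n) : differentiable (peval p) x /\
  forall i, is_derive x (delta_mx ord0 i) (peval p) (peval (mderiv i p) x).
Proof.
pose P (q : mpoly n R) := differentiable (peval q) x /\
  forall i, is_derive x (delta_mx ord0 i) (peval q) (peval (mderiv i q) x).
rewrite -/(P p).
have PC c : P (mpolyC n c).
  rewrite /P (_ : peval _ = cst c); last first.
    by apply/funext => y; rewrite /peval mevalC.
  by split=> // i; rewrite mderivC /peval meval0; exact: is_derive_cst.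
have PD p1 p2 : P p1 -> P p2 -> P (p1 + p2).
  move=> [d1 D1] [d2 D2].
  rewrite /P (_ : peval (p1 + p2) = peval p1 + peval p2); last first.
    by apply/funext => y; rewrite /peval mevalD.
  split=> [|i]; first exact: differentiableD.
  have := D1 i; have := D2 i => {}D2 {}D1.
  by apply: is_derive_eq; rewrite mderivD /peval mevalD.
have PM p1 p2 : P p1 -> P p2 -> P (p1 * p2).
  move=> [d1 D1] [d2 D2].
  rewrite /P (_ : peval (p1 * p2) = peval p1 * peval p2); last first.
    by apply/funext => y; rewrite /peval mevalM.
  split=> [|i]; first exact: differentiableM.
  have := D1 i; have := D2 i => {}D2 {}D1.
  apply: is_derive_eq; rewrite mderivM /peval mevalD !mevalM -!/(peval _ _).
  by rewrite addrC; congr (_ + _); rewrite -[LHS]/(_ * _) mulrC.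
have PX j : P (mpolyX R (mnm1 j)).
  rewrite /P (_ : peval _ = (fun y => y ord0 j)); last first.
    by apply/funext => y; rewrite /peval mevalXU.
  have dj : differentiable (fun y : 'rV[R]_n => y ord0 j) x.
    exact: differentiable_coord.
  split=> // i; apply: DeriveDef; first exact: diff_derivable.
  rewrite deriveE//.
  have @h : {linear 'rV[R]_n -> R}.
    by exists (fun N : 'rV[R]_n => N ord0 j); do 2![eexists];
      do ?[constructor]; rewrite ?mxE// => ? *; rewrite ?mxE//;
      move=> ?; rewrite !mxE.
  rewrite (_ : (fun _ => _) = h)// diff_lin; last exact: coord_continuous.
  rewrite /= mxE eqxx/= mderivX mnm1E /peval mevalZ eq_sym.
  by case: eqVneq => [->|_]; rewrite ?mul0r// mul1r -{1}[mnm1 _]add0m addmK mpolyX0 meval1.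
elim/mpolyind: p => [|c q p _ _ Pp]; first by rewrite -mpolyC0; exact: PC.
apply: PD Pp; rewrite -mul_mpolyC; apply: (PM); first exact: PC.
rewrite mpolyXE_id; apply: (big_ind P); [by rewrite -mpolyC1|exact: PM|].
move=> i _; elim: (q i) => [|k IH]; first by rewrite expr0 -mpolyC1.
by rewrite exprS; apply: (PM).
Qed.

Lemma Lpoly_continuous (beta : R) f p (x : 'rV[R]_n) (u : 'rV[R]_m) :
  peval (Lpoly (continuous_setting beta f) p) (row_mx x u) =
  Lop (continuous_setting beta f) (peval p) x u.
Proof.
rewrite /= {1}/peval mevalB mevalZ -!/(peval _ _) peval_lift_x; congr (_ - _).
rewrite {1}/peval raddf_sum; apply: eq_bigr => i _; rewrite [LHS]mevalM -!/(peval _ _).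
by rewrite peval_lift_x !mxE; have /@derive_val -> := (diff_peval p x).2 i.
Qed.
End settings_facts.

Section programs.
Context {R : realType} {n m nX nU : nat}.
Variables (S : setting R n m).
Variables (gX : 'I_nX -> mpoly n R) (gU : 'I_nU -> mpoly m R).

Local Notation X := (semialg gX).
Local Notation U := (semialg gU).
Local Notation lambda := (lebesgue_rV R n).

(* Finite Borel measures on X (resp. X * U) are the finite Borel measures on    *)
(* R^n (resp. R^n * R^m) that vanish outside of X (resp. X * U).                *)
Definition primal_feasible
    (mu : {finite_measure set (borel ('rV[R]_n * 'rV[R]_m)%type) -> \bar R})
    (mu0 muh0 : {finite_measure set (borel 'rV[R]_n) -> \bar R}) : Prop :=
  [/\ mu (~` (X `*` U)) = 0%E, mu0 (~` X) = 0%E, muh0 (~` X) = 0%E,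
    (forall v, Vspace S v ->
      \int[mu]_(z in X `*` U) (Lop S v z.1 z.2)%:E =
      \int[mu0]_(x in X) (v x)%:E)%E &
    (forall w : 'rV[R]_n -> R, {within X, continuous w} ->
      \int[mu0]_(x in X) (w x)%:E + \int[muh0]_(x in X) (w x)%:E =
      \int[lambda]_(x in X) (w x)%:E)%E].

Definition primal_value : \bar R :=
  ereal_sup [set z | exists mu mu0 muh0,
    primal_feasible mu mu0 muh0 /\ z = mu0 X].

Definition dual_feasible (v w : 'rV[R]_n -> R) : Prop :=
  [/\ Vspace S v, {within X, continuous w},
    (forall x u, X x -> U u -> 0 <= Lop S v x u),
    (forall x, X x -> v x + 1 <= w x) &
    (forall x, X x -> 0 <= w x)].

Definition dual_value : \bar R :=
  ereal_inf [set z | exists v w,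
    dual_feasible v w /\ z = (\int[lambda]_(x in X) (w x)%:E)%E].

Definition min_order : nat :=
  maxn (\max_(i < nX) half_deg (gX i)) (\max_(i < nU) half_deg (gU i)).

Definition sdp_primal_feasible (k : nat)
    (y : moments (n + m) k) (y0 yh0 : moments n k) : Prop :=
  [/\ (forall v, deg_le v (2 * k) -> deg_le (Lpoly S v) (2 * k) ->
        riesz y (Lpoly S v) = riesz y0 v),
    (forall w, deg_le w (2 * k) ->
      (riesz y0 w + riesz yh0 w)%:E =
      (\int[lambda]_(x in X) (peval w x)%:E)%E),
    [/\ psd (moment_mx y k), psd (moment_mx y0 k) & psd (moment_mx yh0 k)],
    (forall i, let r := (k - half_deg (gX i))%N in
      [/\ psd (localizing_mx (lift_x (gX i)) y r),
          psd (localizing_mx (gX i) y0 r) &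
          psd (localizing_mx (gX i) yh0 r)]) &
    (forall i,
      psd (localizing_mx (lift_u (gU i)) y (k - half_deg (gU i))))].

Definition sdp_primal_value (k : nat) : \bar R :=
  ereal_sup [set z | exists y y0 yh0,
    @sdp_primal_feasible k y y0 yh0 /\ z = (riesz y0 1)%:E].

Definition sos_cert_x (k : nat) (p : mpoly n R) : Prop :=
  exists (p0 : mpoly n R) (pX : 'I_nX -> mpoly n R),
    [/\ is_sos k p0,
      (forall i, is_sos (k - half_deg (gX i)) (pX i)) &
      p = p0 + \sum_(i < nX) pX i * gX i].

Definition sos_cert_xu (k : nat) (q : mpoly (n + m) R) : Prop :=
  exists (q0 : mpoly (n + m) R) (qX : 'I_nX -> mpoly (n + m) R)
         (rU : 'I_nU -> mpoly (n + m) R),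
    [/\ is_sos k q0,
      (forall i, is_sos (k - half_deg (gX i)) (qX i)),
      (forall i, is_sos (k - half_deg (gU i)) (rU i)) &
      q = q0 + \sum_(i < nX) qX i * lift_x (gX i)
             + \sum_(i < nU) rU i * lift_u (gU i)].

Definition sdp_dual_feasible (k : nat) (v w : mpoly n R) : Prop :=
  [/\ deg_le v (2 * k) && deg_le w (2 * k), sos_cert_xu k (Lpoly S v),
    sos_cert_x k (w - v - 1) & sos_cert_x k w].

Definition sdp_dual_value (k : nat) : \bar R :=
  ereal_inf [set z | exists v w,
    sdp_dual_feasible k v w /\ z = (\int[lambda]_(x in X) (peval w x)%:E)%E].

End programs.

(* Main.v *)
(* Monotonicity and the bounds [d* <= d_k*], [p* <= p_k*] come from restricting
   certificates and moments to lower degrees, from evaluating certificates at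
   points, and from taking moments of measures. The two limits rest on Putinar's
   theorem: a polynomial positive on the compact set is a weighted sum of squares.

   Putinar's theorem is obtained without functional analysis. On a box
   [-c, c]^n, a positive polynomial has nonnegative coefficients in a Bernstein
   basis of high degree, and the factors [c + x_i] and [c - x_i] of that basis lie
   in the quadratic module of the single polynomial [c^2 - |x|^2], which is closed
   under products. A polynomial that is positive only where all [g_i >= 0] becomes
   positive on the whole box after subtracting [l * sum_i g_i (1 - g_i / C)^(2 j)],
   an element of the quadratic module.

   Dual limit: Bernstein polynomials approximate [v] in C^0 or C^1 and [w]
   uniformly; adding small constants makes all constraints strict, so that
   Putinar's theorem provides certificates of some finite order.

   Primal limit: were the limit larger than [p*], feasible moment vectors of value
   at least [c > p*] would exist for all orders. By Putinar's theorem they are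
   bounded on every fixed polynomial, and their limit along an ultrafilter is a
   functional that is nonnegative on polynomials nonnegative on the compact set.
   By the Riesz representation theorem it is given by measures, which form a
   feasible point of value at least [c]. *)
Require Import Defs.
From HB Require Import structures.
From mathcomp Require Import all_boot all_order all_algebra.
From mathcomp.multinomials Require mpoly.
Import -(notations) mpoly.
From mathcomp Require Import all_classical all_reals all_analysis.
From mathcomp Require Import ring lra zify.
Import Order.TTheory GRing.Theory Num.Theory.
Import numFieldNormedType.Exports.
Local Open Scope classical_set_scope.
Local Open Scope ring_scope.

Set Implicit Arguments.
Unset Strict Implicit.
Unset Printing Implicit Defensive.

(** The decisive common feature of the two settings is that [L] sends the constant 1 to a positive
    constant [kappa], equal to [1 - alpha] or [beta]. On the dual side it supplies the room for
    strictness: adding [a] to [v] raises [L v] by [kappa * a], and the same [a] added to [w]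
    restores [w >= v + 1], so that approximation errors of size [d] cost a multiple of [d] in the
    value. On the primal side it bounds the masses: testing with [v = 1] gives [kappa] times the
    mass of [y] equal to the mass of [y0], and [y0 + yh0] has the mass of Lebesgue measure on [X]. A
    bound on the mass becomes a bound on each moment because [C + 1 - p] and [C + 1 + p] have
    certificates as soon as [|p| <= C] on the compact set. Their order depends on [p], so each
    moment is bounded only for [k] large enough; along an ultrafilter all these sequences converge
    at once, without successive extraction of subsequences, and linearity passes to the limit. The
    two limits are obtained separately, with no passage through duality between the programs. *)

Section continuous_real_functions.
Context {R : realType} {T : topologicalType}.
Implicit Types f g : T -> R.

Lemma continuous_fctD f g : continuous f -> continuous g ->
  continuous (fun x => f x + g x).
Proof. by move=> cf cg x; apply: cvgD; [exact: cf|exact: cg]. Qed.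

Lemma continuous_fctN f : continuous f -> continuous (fun x => - f x).
Proof. by move=> cf x; apply: cvgN; exact: cf. Qed.

Lemma continuous_fctB f g : continuous f -> continuous g ->
  continuous (fun x => f x - g x).
Proof. by move=> cf cg x; apply: cvgB; [exact: cf|exact: cg]. Qed.

Lemma continuous_fctM f g : continuous f -> continuous g ->
  continuous (fun x => f x * g x).
Proof. by move=> cf cg x; apply: cvgM; [exact: cf|exact: cg]. Qed.

Lemma continuous_fct_max f g : continuous f -> continuous g ->
  continuous (fun x => Num.max (f x) (g x)).
Proof.
move=> cf cg x; have := @continuous_max R T f g x.
by rewrite /continuous_at; apply; [exact: cf|exact: cg].
Qed.

Lemma continuous_fct_min f g : continuous f -> continuous g ->
  continuous (fun x => Num.min (f x) (g x)).
Proof.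
move=> cf cg x; have := @continuous_min R T f g x.
by rewrite /continuous_at; apply; [exact: cf|exact: cg].
Qed.

Lemma continuous_fct_cst (c : R) : continuous (fun _ : T => c).
Proof. by move=> x; exact: cvg_cst. Qed.

Lemma continuous_fct_norm f : continuous f -> continuous (fun x => `|f x|).
Proof. by move=> cf x; apply: cvg_norm; exact: cf. Qed.

Lemma continuous_fct_sum I (r : seq I) (P : pred I) (F : I -> T -> R) :
  (forall i, continuous (F i)) -> continuous (fun x => \sum_(i <- r | P i) F i x).
Proof.
move=> cF; elim: r => [|i r IH].
  rewrite (_ : (fun x => _) = fun=> 0); first exact: continuous_fct_cst.
  by apply/funext => x; rewrite big_nil.
rewrite (_ : (fun x => _) = fun x => (if P i then F i x else 0) + \sum_(j <- r | P j) F
  j x); last first.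
  by apply/funext => x; rewrite big_cons; case: (P i); rewrite ?add0r.
apply: continuous_fctD => //; case: (P i); [exact: cF|exact: continuous_fct_cst].
Qed.

Lemma compact_fct_bounded (K : set T) f : compact K -> continuous f ->
  exists2 C, 0 < C & forall x, K x -> `|f x| <= C.
Proof.
move=> cK cf; have [->|/set0P K0] := eqVneq K set0; first by exists 1.
have [x _ xm] : exists2 x, x \in K & forall t, t \in K -> `|f t| <= `|f x|.
  by apply: compact_EVT_max => //; exact/continuous_subspaceT/continuous_fct_norm.
exists (`|f x| + 1) => [|t Kt]; first by rewrite ltr_wpDl.
by rewrite (le_trans (xm t _)) ?inE// lerDl.
Qed.

End continuous_real_functions.

(** * Bernstein polynomials *)

Section bernstein_basis.
Variable A : comPzRingType.
Implicit Type t : A.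

(** The ring is arbitrary because the argument is sometimes a real number and sometimes a
    polynomial. *)
Definition bern (N k : nat) t : A :=
  'C(N, k)%:R * (t ^+ k * (1 - t) ^+ (N - k)).

Lemma bern_sum N t : \sum_(k < N.+1) bern N k t = 1.
Proof.
rewrite -[RHS](expr1n _ N) -(subrK t 1) exprDn.
by apply: eq_bigr => k _; rewrite /bern mulr_natl [_ * t ^+ k]mulrC.
Qed.

(** These are the factorial moments of the binomial law; each induction step trades [k * 'C(N, k)]
    for [N * 'C(N.-1, k.-1)]. *)
Lemma bern_ffact_sum N a t :
  \sum_(k < N.+1) (k ^_ a)%:R * bern N k t = (N ^_ a)%:R * t ^+ a.
Proof.
elim: a N => [|a IH] N.
  by rewrite ffactn0 mul1r; under eq_bigr do rewrite ffactn0 mul1r; exact: bern_sum.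
case: N => [|N].
  by rewrite big_ord_recl big_ord0 !ffact0n /= !mul0r addr0.
rewrite big_ord_recl ffact0n mul0r add0r ffactSS exprS natrM mulrACA -IH mulr_sumr.
apply: eq_bigr => k _; rewrite /bern lift0 ffactSS subSS exprS.
transitivity (((k.+1 * 'C(N.+1, k.+1))%N)%:R * ((k ^_ a)%:R * (t * t ^+ k * (1 - t) ^+
  (N - k)))).
  by rewrite !natrM; ring.
by rewrite -mul_bin_diag /= natrM; ring.
Qed.

End bernstein_basis.

Section ffact_ratio.
Variable R : realType.

(** The coefficient of index [k] of the monomial [t ^+ a] in the Bernstein basis of degree [N], for
    [a <= N]. *)
Definition fratio (N k a : nat) : R := (k ^_ a)%:R / (N ^_ a)%:R.

Lemma bern_fratio_sum (A : comAlgType R) N a (t : A) : (a <= N)%N ->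
  \sum_(k < N.+1) fratio N k a *: bern N k t = t ^+ a.
Proof.
move=> aN; have Na0 : (N ^_ a)%:R != 0 :> R by rewrite pnatr_eq0 -lt0n ffact_gt0.
apply: (can_inj (scalerK Na0));
  rewrite scaler_sumr [RHS]scaler_nat -[RHS]mulr_natl -bern_ffact_sum.
apply: eq_bigr => k _; rewrite scalerA /fratio mulrCA mulfV// mulr1.
by rewrite scaler_nat mulr_natl.
Qed.

Lemma fratioS N k a : (a < N)%N ->
  fratio N k a.+1 = fratio N k a * ((k - a)%:R / (N - a)%:R).
Proof.
by move=> aN; rewrite /fratio !ffactnSr !natrM invfM mulrACA.
Qed.

Lemma fratio_itv N k a : (k <= N)%N -> (a <= N)%N -> 0 <= fratio N k a <= 1.
Proof.
move=> kN; elim: a => [|a IH] aN; first by rewrite /fratio !ffactn0 divff// ler01 lexx.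
have {IH}/andP[h0 h1] := IH (ltnW aN).
rewrite fratioS//; have Na : 0 < (N - a)%:R :> R by rewrite ltr0n subn_gt0.
apply/andP; split; first by rewrite mulr_ge0// divr_ge0.
by rewrite mulr_ile1// ?divr_ge0// ler_pdivrMr// mul1r ler_nat leq_sub2r.
Qed.

(** The Bernstein coefficients of [t ^+ a] approach its values on the grid at rate [1 / N]. Each new
    factor [(k - a) / (N - a)] differs from [k / N] by at most [a / (N - a)], and
    [a + a ^ 2 <= a.+1 ^ 2] closes the induction. *)
Lemma fratio_approx N k a : (k <= N)%N -> (a < N)%N ->
  `|fratio N k a - (k%:R / N%:R) ^+ a| <= (a ^ 2)%:R / (N - a)%:R.
Proof.
move=> kN; elim: a => [|a IH] aN.
  by rewrite /fratio !ffactn0 divff// expr0 subrr normr0 divr_ge0.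
have aN' := ltnW aN.
have Na1 : 0 < (N - a.+1)%:R :> R by rewrite ltr0n subn_gt0.
have Na : 0 < (N - a)%:R :> R by rewrite ltr0n subn_gt0.
have N0 : 0 < N%:R :> R by rewrite ltr0n; lia.
have /andP[f0 f1] := fratio_itv kN (ltnW aN').
have /andP[x0 x1] : 0 <= (k%:R / N%:R : R) <= 1.
  by rewrite divr_ge0//= ler_pdivrMr// mul1r ler_nat.
rewrite fratioS// exprSr.
set x := k%:R / N%:R in x0 x1 IH *; set y := (k - a)%:R / _.
have step : `|y - x| <= a%:R / (N - a)%:R.
  have yE : y <= x.
    rewrite /y /x ler_pdivrMr// mulrAC ler_pdivlMr// -!natrM ler_nat; nia.
  rewrite distrC ger0_norm ?subr_ge0// lerBlDr -mulrDl -natrD.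
  rewrite /x ler_pdivrMr// mulrAC ler_pdivlMr// -!natrM ler_nat; nia.
rewrite (_ : _ - _ = fratio N k a * (y - x) + (fratio N k a - x ^+ a) * x); last by ring.
rewrite (le_trans (ler_normD _ _))// (normrM (fratio N k a)) (normrM (_ - _)).
rewrite (ger0_norm f0) (ger0_norm x0).
apply: (@le_trans _ _ (a%:R / (N - a)%:R + (a ^ 2)%:R / (N - a)%:R)).
  apply: lerD.
    by rewrite -[leRHS]mul1r ler_pM.
  by rewrite -[leRHS]mulr1 ler_pM// IH.
rewrite -mulrDl -natrD; apply: ler_pM; rewrite ?ler0n ?invr_ge0//.
  by rewrite ler_nat; nia.
by rewrite lef_pV2 ?posrE// ler_nat; lia.
Qed.

End ffact_ratio.

Lemma dist_prod_le (R : realDomainType) (I : Type) (s : seq I) (x y : I -> R) :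
  (forall i, 0 <= x i <= 1) -> (forall i, 0 <= y i <= 1) ->
  `|\prod_(i <- s) x i - \prod_(i <- s) y i| <= \sum_(i <- s) `|x i - y i|.
Proof.
move=> hx hy; elim: s => [|i s IH]; first by rewrite !big_nil subrr normr0.
rewrite !big_cons.
have /andP[p0 p1] : 0 <= \prod_(j <- s) y j <= 1.
  elim/big_ind: _ => [|a b /andP[? ?] /andP[? ?]|j _]; rewrite ?ler01 ?lexx//.
  by rewrite mulr_ge0//= mulr_ile1.
rewrite (_ : _ - _ = x i * (\prod_(j <- s) x j - \prod_(j <- s) y j) +
   (x i - y i) * \prod_(j <- s) y j); last by ring.
rewrite (le_trans (ler_normD _ _))// addrC (normrM (x i)) (normrM (x i - y i));
  have /andP[x0 x1] := hx i.
rewrite (ger0_norm p0) (ger0_norm x0); apply: lerD.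
  by rewrite ler_piMr.
by rewrite (le_trans _ IH)// ler_piMl.
Qed.

Section box_positivity.
Context {R : realType}.

Lemma continuous_peval n (p : mpoly n R) : continuous (peval p).
Proof. by move=> x; apply: differentiable_continuous; exact: (diff_peval p x).1. Qed.

Lemma compact_box n (a b : 'rV[R]_n) : compact (box a b).
Proof.
rewrite (_ : box a b = [set x | forall i, `[a ord0 i, b ord0 i]%classic (x ord0 i)]).
  by apply: (@rV_compact _ _ (fun i => `[a ord0 i, b ord0 i]%classic)) => i;
     exact: segment_compact.
by apply/seteqP; split => x /= H i; have := H i; rewrite in_itv.
Qed.

Local Notation cube n := (box (const_mx 0) (const_mx 1) : set 'rV[R]_n).

Definition bern_mono n N (k : {ffun 'I_n -> 'I_N.+1}) : mpoly n R :=
  \prod_(i < n) bern N (k i) (mpolyX R (mnm1 i)).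

(** Every power of a variable is expanded separately, and the product of these sums is distributed
    over the multi-indices. *)
Lemma mpoly_bern_sum n N (p : mpoly n R) : (msize p <= N)%N ->
  p = \sum_(k : {ffun 'I_n -> 'I_N.+1})
    (\sum_(a <- msupp p) mcoeff a p * \prod_(i < n) fratio R N (k i) (a i)) *:
      bern_mono k.
Proof.
move=> pN; rewrite {1}[p]mpolyE.
under [RHS]eq_bigr do rewrite scaler_suml.
rewrite exchange_big/=; apply: eq_big_seq => a ap.
under [RHS]eq_bigr do rewrite -scalerA.
rewrite -scaler_sumr; congr (_ *: _); rewrite mpolyXE_id.
under [RHS]eq_bigr do rewrite -scaler_prod.
rewrite -(bigA_distr_bigA (fun i (j : 'I_N.+1) => fratio R N j (a i) *: bern N j
  (mpolyX R (mnm1 i)))).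
apply: eq_bigr => i _; rewrite bern_fratio_sum//.
apply: leq_trans pN; apply: ltnW; apply: leq_ltn_trans (msize_mdeg_lt ap).
by rewrite mdegE (bigD1 i)//= leq_addr.
Qed.

Lemma peval_sum n (p : mpoly n R) x :
  peval p x = \sum_(a <- msupp p) mcoeff a p * \prod_i x ord0 i ^+ a i.
Proof. exact: mevalE. Qed.

(** In high degree the coefficient of index [k] is within [d] of the value of [p] at the grid point
    [k / N], where [d] is the minimum of [p] on the cube. *)
Lemma cube_bernstein n (p : mpoly n R) :
  (forall x, cube n x -> 0 < peval p x) ->
  exists N (c : {ffun 'I_n -> 'I_N.+1} -> R), (forall k, 0 <= c k) /\
    p = \sum_k c k *: bern_mono k.
Proof.
move=> p0.
have [x0 + x0min] : exists2 c, c \in cube n & forall t, t \in cube n -> peval p c <=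
  peval p t.
  apply: EVT_min_rV; last exact/continuous_subspaceT/continuous_peval.
    by exists (const_mx 0) => i; rewrite !mxE lexx ler01.
  exact: compact_box.
rewrite inE => /p0; set d := peval p x0 => d0.
(* [D] exceeds every exponent occurring in [p], so with [N = D + K] all denominators [N - a i] are
   at least [K]. The total error is then at most [C * n * D ^ 2 / K], which is below [d] once [K]
   exceeds [B]. *)
pose C : R := \sum_(a <- msupp p) `|mcoeff a p|; pose D := msize p.
pose B : R := C * (n * D ^ 2)%:R / d.
have [K K0 BK] : exists2 K : nat, (0 < K)%N & B < K%:R.
  have C0 : 0 <= C by apply: sumr_ge0 => a _; exact: normr_ge0.
  exists (Num.bound B).+1 => //; rewrite (lt_trans (archi_boundP _)) ?ltr_nat//.
  by rewrite /B divr_ge0 ?(ltW d0)// mulr_ge0.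
have [N NE] : exists N, N = (D + K)%N by eexists.
exists N; eexists; split; last by apply: mpoly_bern_sum; rewrite NE leq_addr.
move=> k.
have kN i : 0 <= ((k i)%:R / N%:R : R) <= 1.
  rewrite divr_ge0//= ler_pdivrMr ?mul1r ?ler_nat ?leq_ord//.
  by rewrite ltr0n NE addn_gt0 K0 orbT.
pose x : 'rV[R]_n := \row_i ((k i)%:R / N%:R).
have xcube : x \in cube n by rewrite inE => i; rewrite !mxE kN.
have := x0min _ xcube; rewrite -/d => dx.
rewrite -subr_ge0 -(subrK (peval p x) (_ - _)) subr0.
set s := \sum_(a <- _) _ .
have : `|s - peval p x| <= d.
  rewrite /s peval_sum -sumrB.
  apply: (@le_trans _ _ (\sum_(a <- msupp p) `|mcoeff a p| * ((n * D ^ 2)%:R / K%:R))).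
    rewrite (le_trans (ler_norm_sum _ _ _))//; rewrite !big_seq; apply: ler_sum => a ap.
    rewrite -mulrBr normrM ler_wpM2l//.
    have aD i : (a i < D)%N.
      by apply: leq_ltn_trans (msize_mdeg_lt ap); rewrite mdegE (bigD1 i)//= leq_addr.
    apply: (le_trans (@dist_prod_le _ _ _ _ _ _ _)).
    - by move=> i; apply: fratio_itv;
      rewrite ?leq_ord// NE (leq_trans (ltnW (aD i)))// leq_addr.
    - by move=> i; rewrite mxE; have /andP[? ?] := kN i; rewrite exprn_ge0//= exprn_ile1.
    rewrite [leRHS](_ : _ = \sum_(i < n) ((D ^ 2)%:R / K%:R)); last first.
      by rewrite sumr_const card_ord natrM -mulrA -[RHS]mulr_natl.
    apply: ler_sum => i _; rewrite mxE.
    apply: (le_trans (fratio_approx _ _ _)); rewrite ?leq_ord//.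
      by rewrite NE (leq_trans (aD i))// leq_addr.
    apply: ler_pM; rewrite ?invr_ge0//.
      by rewrite ler_nat leq_sqr ltnW.
    rewrite lef_pV2 ?posrE ?ltr0n ?ler_nat// NE ?subn_gt0; have := aD i; move: K0;
      clear; lia.
  rewrite -mulr_suml -/C mulrA ler_pdivrMr ?ltr0n// [d * _]mulrC -ler_pdivrMr//.
  exact: ltW.
by rewrite ler_norml => /andP[]; lra.
Qed.

End box_positivity.

(** * Putinar's theorem *)

Section peval_morphism.
Context {R : realType} {n : nat}.
Implicit Types (p q : mpoly n R) (x : 'rV[R]_n).

Lemma pevalD p q x : peval (p + q) x = peval p x + peval q x.
Proof. exact: mevalD. Qed.
Lemma pevalB p q x : peval (p - q) x = peval p x - peval q x.
Proof. exact: mevalB. Qed.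
Lemma pevalN p x : peval (- p) x = - peval p x.
Proof. exact: mevalN. Qed.
Lemma pevalM p q x : peval (p * q) x = peval p x * peval q x.
Proof. exact: mevalM. Qed.
Lemma pevalZ (a : R) p x : peval (a *: p) x = a * peval p x.
Proof. exact: mevalZ. Qed.
Lemma pevalC (a : R) x : peval (mpolyC n a) x = a.
Proof. exact: mevalC. Qed.
Lemma peval1 x : peval 1 x = 1.
Proof. exact: meval1. Qed.
Lemma peval0 x : peval 0 x = 0.
Proof. exact: meval0. Qed.
Lemma pevalX i x : peval (mpolyX R (mnm1 i)) x = x ord0 i.
Proof. exact: mevalXU. Qed.
Lemma pevalXn p k x : peval (p ^+ k) x = peval p x ^+ k.
Proof. by rewrite /peval rmorphXn. Qed.
Lemma peval_bigsum I (r : seq I) (P : pred I) (F : I -> mpoly n R) x :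
  peval (\sum_(i <- r | P i) F i) x = \sum_(i <- r | P i) peval (F i) x.
Proof. by rewrite /peval raddf_sum. Qed.

End peval_morphism.

Lemma comp_mpoly_comp (R : comNzRingType) n k l (p : mpoly n R)
    (f : n.-tuple (mpoly k R)) (g : k.-tuple (mpoly l R)) :
  comp_mpoly g (comp_mpoly f p) = comp_mpoly [tuple comp_mpoly g (tnth f i) | i < n] p.
Proof.
elim/mpolyind: p => [|c m p _ _ IH]; first by rewrite !raddf0.
rewrite !raddfD/= IH; congr (_ + _); rewrite !comp_mpolyZ !comp_mpolyX rmorph_prod.
by congr (_ *: _); apply: eq_bigr => i _; rewrite rmorphXn tnth_mktuple.
Qed.

Section putinar.
Context {R : realType} {n : nat}.
Implicit Types (p q g : mpoly n R) (M : mpoly n R -> Prop).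

Definition quadratic_module M : Prop :=
  [/\ M 1, (forall p q, M p -> M q -> M (p + q)) &
    (forall p q, M q -> M (p ^+ 2 * q))].

(** [is_sos] without degree bound: in Putinar's theorem the order of the certificate is left
    existential. *)
Definition sos q : Prop := exists s : seq (mpoly n R), q = \sum_(p <- s) p ^+ 2.

Lemma sosX2 p : sos (p ^+ 2).
Proof. by exists [:: p]; rewrite big_seq1. Qed.

Lemma sos0 : sos 0.
Proof. by exists [::]; rewrite big_nil. Qed.

Lemma sosD p q : sos p -> sos q -> sos (p + q).
Proof. by move=> [s ->] [t ->]; exists (s ++ t); rewrite big_cat. Qed.

Lemma sos_sum I (r : seq I) (P : pred I) (F : I -> mpoly n R) :
  (forall i, P i -> sos (F i)) -> sos (\sum_(i <- r | P i) F i).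
Proof. by move=> H; elim/big_ind: _ => //; [exact: sos0|exact: sosD]. Qed.

Lemma sosM p q : sos p -> sos q -> sos (p * q).
Proof.
move=> [s ->] [t ->]; rewrite mulr_suml; apply: sos_sum => a _.
by rewrite mulr_sumr; apply: sos_sum => b _; rewrite -exprMn; exact: sosX2.
Qed.

Lemma sosC (a : R) : 0 <= a -> sos (mpolyC n a).
Proof. by move=> a0; rewrite -(sqr_sqrtr a0) rmorphXn; exact: sosX2. Qed.

Lemma quadratic_module_sos M p q : quadratic_module M -> sos p -> M q -> M (p * q).
Proof.
move=> [M1 MD MX] [s ->] Mq; rewrite mulr_suml; elim/big_ind: _ => //.
- by have := MX 0 1 M1; rewrite expr0n mul0r.
- by move=> a _; exact: MX.
Qed.

(* A quadratic module with a single generator is closed under products. *)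
Definition preorder1 g q : Prop :=
  exists s t, [/\ sos s, sos t & q = s + t * g].

Lemma preorder1_sos g s : sos s -> preorder1 g s.
Proof. by move=> ss; exists s, 0; split; [|exact: sos0|rewrite mul0r addr0]. Qed.

Lemma preorder1D g p q : preorder1 g p -> preorder1 g q -> preorder1 g (p + q).
Proof.
move=> [s [t [ss st ->]]] [s' [t' [ss' st' ->]]].
by exists (s + s'), (t + t'); split; [exact: sosD|exact: sosD|ring].
Qed.

(** The only term outside the obvious shape is [t * t' * g ^+ 2], where [g] occurs squared; two
    distinct generators would leave a mixed product. *)
Lemma preorder1M g p q : preorder1 g p -> preorder1 g q -> preorder1 g (p * q).
Proof.
move=> [s [t [ss st ->]]] [s' [t' [ss' st' ->]]].
exists (s * s' + (t * t') * g ^+ 2), (s * t' + s' * t).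
split; last by ring.
- by apply: sosD; [exact: sosM|apply: sosM; [exact: sosM|exact: sosX2]].
- by apply: sosD; exact: sosM.
Qed.

Lemma preorder1_sub M g q : quadratic_module M -> M g -> preorder1 g q -> M q.
Proof.
move=> QM Mg [s [t [ss st ->]]]; have [M1 MD _] := QM.
by apply: MD; [rewrite -[s]mulr1|]; exact: quadratic_module_sos.
Qed.

(** From the identity [2 c (c + e x_i) = (c + e x_i)^2 + sum_(j != i) x_j^2 + (c^2 - |x|^2)], with
    [e] a sign. *)
Lemma ball_poly_coord (c : R) i (e : R) : 0 < c -> e ^+ 2 = 1 ->
  preorder1 (ball_poly n c) (mpolyC n c + mpolyC n e * mpolyX R (mnm1 i)).
Proof.
move=> c0 e1.
set X := fun j => mpolyX R (mnm1 j) : mpoly n R.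
pose q : mpoly n R := (mpolyC n c + mpolyC n e * X i) ^+ 2 + \sum_(j < n | j != i) X j
  ^+ 2.
have sq : sos q by apply: sosD; [exact: sosX2|apply: sos_sum => j _; exact: sosX2].
pose k : mpoly n R := mpolyC n (c *+ 2)^-1.
have sk : sos k by apply: sosC; rewrite invr_ge0 mulrn_wge0// ltW.
exists (k * q), k; split => //; first exact: sosM.
rewrite -mulrDr /q /ball_poly [X in _ - X](bigD1 i)//= -/(X i).
set S := \sum_(j < n | j != i) _.
have kc : k * (mpolyC n c *+ 2) = 1.
  rewrite /k -raddfMn -rmorphM mulVf ?mpolyC1//.
  by rewrite mulrn_eq0/= gt_eqF.
have ee : mpolyC n e ^+ 2 = 1 by rewrite -rmorphXn e1 /= mpolyC1.
rewrite rmorphXn/=.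
rewrite -[LHS]mul1r -kc -mulrA; congr (_ * _).
rewrite (_ : (mpolyC n c + mpolyC n e * X i) ^+ 2 =
  mpolyC n c ^+ 2 + mpolyC n c *+ 2 * (mpolyC n e * X i) + mpolyC n e ^+ 2 * X i ^+ 2);
    last by ring.
by rewrite ee; ring.
Qed.

Lemma preorder1_ball_positive (c : R) p : 0 < c ->
  (forall x, box (const_mx (- c)) (const_mx c) x -> 0 < peval p x) ->
  preorder1 (ball_poly n c) p.
Proof.
move=> c0 p0; set T := preorder1 _.
(* [f] maps the unit cube onto the box and [h] is its inverse, so that substituting [h] turns the
   Bernstein factors [t] and [1 - t] into [(c + x_i) / (2 c)] and [(c - x_i) / (2 c)]. *)
pose f := [tuple mpolyC n (c *+ 2) * mpolyX R (mnm1 i) - mpolyC n c | i < n].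
pose h := [tuple mpolyC n (c *+ 2)^-1 * (mpolyC n c + mpolyX R (mnm1 i)) | i < n].
have c20 : 0 < c *+ 2 by rewrite mulrn_wgt0.
have [x|N [b [b0 pE]]] := @cube_bernstein _ _ (comp_mpoly f p).
  move=> x01; rewrite /peval comp_mpoly_meval.
  rewrite [ltRHS](_ : _ = peval p (\row_i (x ord0 i * (c *+ 2) - c))).
    apply: p0 => i; have := x01 i; rewrite !mxE => /andP[? ?].
    by rewrite -mulr_natr; apply/andP; split; nra.
  apply: meval_eq => i; rewrite tnth_mktuple mxE.
  by rewrite mevalB mevalM !mevalC mevalXU mulrC.
have hf : comp_mpoly h (comp_mpoly f p) = p.
  rewrite comp_mpoly_comp -[RHS]comp_mpoly_id; congr (comp_mpoly _ p).
  apply: eq_mktuple => i; rewrite tnth_mktuple raddfB/= rmorphM/= !comp_mpolyC.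
  rewrite comp_mpolyX (bigD1 i)//= big1 => [|j /negPf ji]; last first.
    by rewrite mnm1E eq_sym ji expr0.
  rewrite mnm1E eqxx expr1 mulr1 tnth_mktuple mulrA -rmorphM/= divff ?gt_eqF//.
  by rewrite mpolyC1 mul1r addrAC subrr add0r.
rewrite -hf pE raddf_sum.
have T0 q : sos q -> T q by exact: preorder1_sos.
elim/big_ind: _ => [|q r|k _]; [exact/T0/sos0|exact: preorder1D|].
rewrite /= comp_mpolyZ -mul_mpolyC; apply: preorder1M; first exact/T0/sosC.
rewrite /bern_mono rmorph_prod; elim/big_ind: _ => [|q r|i _].
- by apply/T0; rewrite -(expr1n _ 2); exact: sosX2.
- exact: preorder1M.
have Tt : T (tnth h i).
  rewrite tnth_mktuple; apply: preorder1M; first by apply/T0/sosC; rewrite invr_ge0 ltW.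
  have := @ball_poly_coord c i 1 c0 (expr1n _ _).
  by rewrite mpolyC1 mul1r.
have Tt1 : T (1 - tnth h i).
  rewrite tnth_mktuple (_ : 1 - _ = mpolyC n (c *+ 2)^-1 * (mpolyC n c + mpolyC n (-1)
    * mpolyX R (mnm1 i))).
    apply: preorder1M; first by apply/T0/sosC; rewrite invr_ge0 ltW.
    by apply: (@ball_poly_coord c i (-1)) => //; rewrite sqrrN expr1n.
  rewrite rmorphN/= mpolyC1 mulN1r.
  rewrite -{1}mpolyC1 -{1}(@mulVf _ (c *+ 2)) ?gt_eqF// rmorphM/= -mulrBr; congr (_ * _).
  by rewrite raddfMn/=; ring.
have TX q k' : T q -> T (q ^+ k').
  move=> Tq; elim: k' => [|k' IH]; last by rewrite exprS; exact: preorder1M.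
  by rewrite expr0; apply/T0; rewrite -(expr1n _ 2); exact: sosX2.
rewrite /= /bern rmorphM/= rmorph_nat rmorphM/= !rmorphXn/= rmorphB/= rmorph1.
rewrite comp_mpolyX (bigD1 i)//= big1 => [|j /negPf ji]; last first.
  by rewrite mnm1E eq_sym ji expr0.
rewrite mnm1E eqxx expr1 mulr1; apply: preorder1M.
  by apply/T0; rewrite -mpolyC_nat; apply: sosC.
by apply: preorder1M; exact: TX.
Qed.

(** [k.+1 * y * (1 - y) ^+ k] is one of the nonnegative terms of the binomial expansion of
    [1 = (y + (1 - y)) ^+ k.+1]. *)
Lemma mulX1B_le (y : R) k : 0 <= y <= 1 -> y * (1 - y) ^+ k <= k.+1%:R^-1.
Proof.
move=> /andP[y0 y1]; rewrite -[leRHS]mul1r ler_pdivlMr// mulrC.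
rewrite -[leRHS](bern_sum k.+1 y) (bigD1 (inord 1))//= /bern inordK//.
rewrite bin1 expr1 subSS subn0 lerDl; apply: sumr_ge0 => i _.
by rewrite mulr_ge0// mulr_ge0// exprn_ge0// subr_ge0.
Qed.

(* On the box, [p - l * sum_i g_i (1 - g_i / C)^(2 j)] is positive for large
   [l] and [j]: where [g_i >= 0] the subtracted term is at most [l C / (2 j + 1)],
   and where [g_i <= - d] it is at most [- l d]. *)
Lemma putinar (I : finType) (g : I -> mpoly n R) M (c : R) p :
  quadratic_module M -> 0 < c -> M (ball_poly n c) -> (forall i, M (g i)) ->
  (forall x, box (const_mx (- c)) (const_mx c) x ->
    (forall i, 0 <= peval (g i) x) -> 0 < peval p x) ->
  M p.
Proof.
move=> QM c0 Mball Mg p0; set B := box _ _ in p0.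
have B0 : B !=set0 by exists 0 => i; rewrite !mxE oppr_le0 ltW.
have cB : compact B by exact: compact_box.
have bnd q : exists2 C, 0 < C & forall x, B x -> `|peval q x| <= C.
  by apply: compact_fct_bounded => //; exact: continuous_peval.
have [P P0 pP] := bnd p.
have /choice[Cf Cf2] : forall i, exists C, 0 < C /\ forall x, B x -> `|peval (g i) x|
  <= C.
  by move=> i; have [C] := bnd (g i); exists C.
pose C := 1 + \sum_i Cf i.
have CfC i : Cf i <= C.
  rewrite /C (bigD1 i)//= addrCA lerDl addr_ge0// sumr_ge0// => j _.
  by rewrite ltW// (Cf2 j).1.
have C0 : 0 < C by rewrite ltr_pwDl// sumr_ge0// => j _; rewrite ltW// (Cf2 j).1.
have gC i x : B x -> `|peval (g i) x| <= C.
  by move=> Bx; apply: le_trans (CfC i); exact: (Cf2 i).2.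
(* [h] is positive on the box: either [p > 0], or some [g i] is negative. Its minimum [eta]
   quantifies this alternative. *)
pose h x := Num.max (peval p x) 0 + \sum_i Num.max (- peval (g i) x) 0.
have ch : continuous h.
  apply: continuous_fctD; last apply: continuous_fct_sum => i.
    by apply: continuous_fct_max; [exact: continuous_peval|exact: continuous_fct_cst].
  apply: continuous_fct_max; last exact: continuous_fct_cst.
  by apply: continuous_fctN; exact: continuous_peval.
have [x1 Bx1 x1m] := @EVT_min_rV _ _ h B B0 cB (continuous_subspaceT ch).
have h0 x : B x -> 0 < h x.
  move=> Bx; rewrite /h.
  have s0 : 0 <= \sum_i Num.max (- peval (g i) x) 0.
    by apply: sumr_ge0 => i _; rewrite le_max lexx orbT.
  have [px|px] := ltP 0 (peval p x).
    by rewrite ltr_pwDl// lt_max px.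
  have m0 : 0 <= Num.max (peval p x) 0 by rewrite le_max lexx orbT.
  rewrite ltr_wpDl// lt_neqAle s0 andbT; apply/eqP => /esym sE.
  suff : 0 < peval p x by rewrite ltNge px.
  apply: p0 => // i.
  have /psumr_eq0P : forall i : I, true -> 0 <= Num.max (- peval (g i) x) 0.
    by move=> j _; rewrite le_max lexx orbT.
  move=> /(_ sE i isT)/eqP; rewrite eq_le => /andP[+ _].
  by rewrite ge_max oppr_le0 => /andP[].
have eta0 : 0 < h x1 by apply: h0; rewrite inE in Bx1.
set eta := h x1 in eta0 x1m.
(* If all [g i >= - d], the negative parts add up to at most [eta / 2], which leaves
   [p >= eta / 2]. *)
pose d := eta / 2 / (#|I|.+1)%:R.
have d0 : 0 < d by rewrite !divr_gt0.
have pe x : B x -> (forall i, - d <= peval (g i) x) -> eta / 2 <= peval p x.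
  move=> Bx gd; have := x1m x; rewrite inE => /(_ Bx); rewrite -/eta => etah.
  have sd : \sum_i Num.max (- peval (g i) x) 0 <= eta / 2.
    apply: (@le_trans _ _ (\sum_(i : I) d)).
      by apply: ler_sum => i _; rewrite ge_max (ltW d0) andbT lerNl.
    rewrite sumr_const -[leLHS]mulr_natl /d mulrCA ger_pMr ?divr_gt0//.
    by rewrite ler_pdivrMr// mul1r ler_nat.
  have : eta / 2 <= Num.max (peval p x) 0 by rewrite /h in etah; lra.
  by rewrite le_max => /orP[//|]; rewrite leNgt divr_gt0.
(* A single [g i < - d] then contributes at most [- (P + 1)], while [p >= - P]. *)
pose l := (P + 1) / d.
have l0 : 0 < l by rewrite divr_gt0// addr_gt0.
(* [e] bounds the sum of all upper estimates of the terms: [eta / 2] is the margin where all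
   [g i >= - d], and 1 the margin elsewhere. *)
pose e := Num.min (eta / 2) 1.
have e0 : 0 < e by rewrite lt_min divr_gt0//=.
have [j je] : exists j : nat, #|I|%:R * l * C / (2 * j).+1%:R < e.
  have [j jb] : exists j : nat, #|I|%:R * l * C / e < j%:R.
    eexists; apply: archi_boundP; apply: divr_ge0; last exact: ltW.
    by apply: mulr_ge0; [apply: mulr_ge0|]; rewrite ?ler0n// ltW.
  exists j; rewrite ltr_pdivrMr// [e * _]mulrC -ltr_pdivrMr// (lt_trans jb)// ltr_nat.
  by rewrite ltnS mul2n -addnn leq_addr.
pose u i := 1 - C^-1 *: g i.
pose q := \sum_i (mpolyC n (Num.sqrt l) * u i ^+ j) ^+ 2 * g i.
have [M1 MD MX] := QM.
have Mq : M q.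
  rewrite /q; elim/big_ind: _ => // [|i _]; last exact: MX.
  by have := MX 0 1 M1; rewrite expr0n mul0r.
rewrite -(subrK q p); apply: MD => //.
apply: (preorder1_sub QM Mball); apply: preorder1_ball_positive => // x Bx.
rewrite pevalB subr_gt0 /q peval_bigsum.
pose t i := l * ((1 - peval (g i) x / C) ^+ (2 * j) * peval (g i) x).
rewrite (eq_bigr t) => [|i _]; last first.
  rewrite pevalM pevalXn pevalM pevalC pevalXn exprMn sqr_sqrtr ?ltW// /t -mulrA.
  by rewrite -exprM mulnC /u pevalB peval1 pevalZ [C^-1 * _]mulrC.
pose b := l * C / (2 * j).+1%:R.
have bE : #|I|%:R * b = #|I|%:R * l * C / (2 * j).+1%:R by rewrite /b mulrA mulrA.
have b0 : 0 <= b by rewrite divr_ge0// mulr_ge0// ltW.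
have tle i : t i <= b.
  rewrite /t /b -mulrA ler_pM2l//.
  have [gi|gi] := leP 0 (peval (g i) x); last first.
    rewrite (@le_trans _ _ 0) ?divr_ge0// ?(ltW C0)//.
    by rewrite nmulr_lle0// exprM exprn_ge0// sqr_ge0.
  rewrite mulrC -ler_pdivrMl// mulrA [C^-1 * _]mulrC; apply: mulX1B_le.
  by rewrite divr_ge0 ?(ltW C0)//= ler_pdivrMr// mul1r (le_trans (ler_norm _))// gC.
have [/existsP[i gi]|] := boolP [exists i, peval (g i) x < - d].
  have ti : t i <= - (P + 1).
    have -> : - (P + 1) = l * (- d) by rewrite /l mulrN divfK ?gt_eqF.
    rewrite /t ler_pM2l//.
    have gi0 : peval (g i) x < 0 by rewrite (lt_trans gi)// oppr_lt0.
    (* Where [g i < 0] the base [1 - g i / C] is at least 1, so the power only amplifies the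
       negative value. *)
    apply: le_trans (ltW gi); rewrite ger_nMl// exprn_ege1//.
    by rewrite lerDl oppr_ge0 pmulr_lle0 ?invr_gt0// ltW.
  rewrite (bigD1 i)//=.
  have : \sum_(k | k != i) t k <= #|I|%:R * b.
    apply: (@le_trans _ _ (\sum_(k | k != i) b)); first by apply: ler_sum.
    by rewrite sumr_const -[leLHS]mulr_natl ler_wpM2r// ler_nat max_card.
  have : #|I|%:R * b < 1.
    rewrite bE (lt_le_trans je)//.
    by rewrite /e ge_min lexx orbT.
  have := pP x Bx; rewrite ler_norml => /andP[+ _].
  lra.
rewrite negb_exists => /forallP gd.
apply: (@le_lt_trans _ _ (#|I|%:R * b)).
  by rewrite [leRHS]mulr_natl -sumr_const; apply: ler_sum.
rewrite bE (lt_le_trans je)// (@le_trans _ _ (eta / 2))//.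
  by rewrite /e ge_min lexx.
by apply: pe => // i; rewrite leNgt gd.
Qed.

End putinar.

(** * Weierstrass approximation *)

(** Heine-Cantor through [near_covering], applied to the radius as parameter; only [x] is confined
    to [K], [y] may lie outside. *)
Lemma compact_unif_continuous (R : realType) (T : pseudoMetricType R) (K : set T)
    (G : T -> R) (e : R) : compact K -> continuous G -> 0 < e ->
  exists2 d, 0 < d & forall x y, K x -> ball x d y -> `|G x - G y| <= e.
Proof.
move=> cK cG e0; have e20 : 0 < e / 2 by rewrite divr_gt0.
have NC : near_covering K by apply/compact_near_coveringP.
have HN : \forall r \near (0:R)^'+, K `<=` (fun x => forall y, ball x r y -> `|G x - G
  y| <= e).
  apply: NC.
  move=> x Kx.
  have /cvgrPdist_le/(_ _ e20) := cG x; rewrite near_simpl => /nbhs_ballP[d /= d0 dG].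
  exists (ball x (d / 2), [set r | 0 < r < d / 2]).
    split=> /=; first by apply: nbhsx_ballx; rewrite divr_gt0.
    near=> r; apply/andP; split; near: r; first exact: nbhs_right_gt.
    by apply: nbhs_right_lt; rewrite divr_gt0.
  move=> [x' r] /= [xx' /andP[r0 rd]] y x'y.
  have xy : ball x d y.
    rewrite (splitr d); apply: ball_triangle xx' _.
    by apply: le_ball x'y; exact: ltW.
  have xx'' : ball x d x' by apply: le_ball xx'; rewrite ler_pdivrMr// ler_pMr// ler1n.
  rewrite (_ : G x' - G y = (G x - G y) - (G x - G x')); last by ring.
  by rewrite (le_trans (ler_normB _ _))// [leRHS]splitr lerD//; exact: dG.
have : \forall r \near (0:R)^'+, 0 < r /\ K `<=` (fun x => forall y, ball x r y -> `|G
  x - G y| <= e).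
  by near=> r; split; near: r; [exact: nbhs_right_gt|exact: HN].
move=> /filter_ex[r [r0 H]]; exists r => // x y Kx; exact: H.
Unshelve. all: by end_near. Qed.

Section bernstein_weights.
Variable A : comPzRingType.

Lemma bern_small m k (t : A) : (m < k)%N -> bern m k t = 0.
Proof. by move=> mk; rewrite /bern bin_small// mul0r. Qed.

(** A partial derivative lowers the degree in one variable only; the vanishing terms let variables
    of different degrees [m] share one index type. *)
Lemma bern_sum_widen m N (F : nat -> A) t : (m <= N)%N ->
  \sum_(k < N.+1) F k * bern m k t = \sum_(k < m.+1) F k * bern m k t.
Proof.
move=> mN; rewrite [RHS](big_ord_widen N.+1 (fun k => F k * bern m k t))//
  [RHS]big_mkcond/=.
by apply: eq_bigr => k _; rewrite ltnS; case: leqP => // /bern_small ->; rewrite mulr0.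
Qed.

Lemma bern_sum_le m N (t : A) : (m <= N)%N -> \sum_(k < N.+1) bern m k t = 1.
Proof.
move=> mN; rewrite -[RHS](bern_sum m t).
have := @bern_sum_widen m N (fun=> 1) t mN.
rewrite (eq_bigr (fun k : 'I_N.+1 => bern m k t)) => [->|k _]; last by rewrite mul1r.
by apply: eq_bigr => k _; rewrite mul1r.
Qed.

(** The variance of the binomial law, from its factorial moments by [(k - m t)^2 = k (k - 1) + (1 -
    2 m t) k + (m t)^2]. *)
Lemma bern_variance m (t : A) :
  \sum_(k < m.+1) (k%:R - m%:R * t) ^+ 2 * bern m k t = m%:R * t * (1 - t).
Proof.
have f2 k : (k ^_ 2)%:R = k%:R ^+ 2 - k%:R :> A.
  by case: k => [|k]; rewrite ?subr0 ?expr0n// ffactSS ffactn1 natrM -natr1; ring.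
transitivity (\sum_(k < m.+1) ((k ^_ 2)%:R * bern m k t +
    ((1 - (m%:R * t) *+ 2) * ((k ^_ 1)%:R * bern m k t) +
     (m%:R * t) ^+ 2 * bern m k t))).
  by apply: eq_bigr => k _; rewrite f2 ffactn1; ring.
rewrite !big_split/= -!mulr_sumr !bern_ffact_sum bern_sum f2 ffactn1; ring.
Qed.

(** For real [t i] in the unit interval, the probability of [k] under independent binomial laws with
    parameters [m i] and [t i]. *)
Definition bern_weight n N (m : 'I_n -> nat) (t : 'I_n -> A)
    (k : {ffun 'I_n -> 'I_N.+1}) : A :=
  \prod_(i < n) bern (m i) (k i) (t i).

Lemma bern_weight_sum n N m t : (forall i, m i <= N)%N ->
  \sum_k @bern_weight n N m t k = 1.
Proof.
move=> mN; rewrite -(bigA_distr_bigA (fun i (j : 'I_N.+1) => bern (m i) j (t i))).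
by rewrite big1// => i _; exact: bern_sum_le.
Qed.

Lemma bern_weight_variance n N m t j : (forall i, m i <= N)%N ->
  \sum_(k : {ffun 'I_n -> 'I_N.+1}) ((k j)%:R - (m j)%:R * t j) ^+ 2 * @bern_weight n N
    m t k =
  (m j)%:R * t j * (1 - t j).
Proof.
move=> mN.
pose F i (l : 'I_N.+1) := (if i == j then (l%:R - (m j)%:R * t j) ^+ 2 else 1) * bern
  (m i) l (t i).
transitivity (\sum_(k : {ffun 'I_n -> 'I_N.+1}) \prod_i F i (k i)).
  apply: eq_bigr => k _; rewrite /F big_split/=; congr (_ * _).
  by rewrite (bigD1 j)//= eqxx big1 ?mulr1// => i /negPf ->.
rewrite -(bigA_distr_bigA F) (bigD1 j)//= [X in _ * X]big1 ?mulr1 => [|i /negPf ij].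
  rewrite -bern_variance -(@bern_sum_widen (m j) N (fun l => (l%:R - (m j)%:R * t j) ^+
    2))//.
  by apply: eq_bigr => l _; rewrite /F eqxx.
rewrite -[RHS](bern_sum_le (t i) (mN i)).
by apply: eq_bigr => l _; rewrite /F ij mul1r.
Qed.

End bernstein_weights.

Lemma bern_ge0 (R : realDomainType) m k (t : R) : 0 <= t <= 1 -> 0 <= bern m k t.
Proof.
by move=> /andP[t0 t1]; rewrite mulr_ge0// mulr_ge0// exprn_ge0// subr_ge0.
Qed.

Section bernstein_approximation.
Context {R : realType} {n : nat}.
Variables (c : R).
Hypothesis c0 : 0 < c.
Local Notation B := (box (const_mx (- c)) (const_mx c) : set 'rV[R]_n).

Let unit_coord (x : 'rV[R]_n) (i : 'I_n) : R := (x ord0 i + c) / (c *+ 2).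

(* The nodes [xi k] need only be close to the grid points; this freedom is what
   lets the same estimate handle the derivatives of Bernstein polynomials. *)
Lemma bernstein_approx (G : 'rV[R]_n -> R) (e : R) : continuous G -> 0 < e ->
  exists N0, forall N, (N0 <= N)%N -> forall (m : 'I_n -> nat),
  (forall i, N <= m i <= N.+1)%N ->
  forall xi : {ffun 'I_n -> 'I_N.+2} -> 'rV[R]_n,
  (forall k : {ffun 'I_n -> 'I_N.+2}, (forall i, k i <= m i)%N -> B (xi k) /\
    forall i, `|xi k ord0 i - ((c *+ 2) * ((k i)%:R / (m i)%:R) - c)| <= c *+ 2 / N%:R) ->
  forall x, B x ->
    `|\sum_k G (xi k) * bern_weight m (unit_coord x) k - G x| <= e.
Proof.
move=> cG e0.
have cB : compact B by exact: compact_box.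
have e20 : 0 < e / 2 by rewrite divr_gt0.
have [d d0 dG] := compact_unif_continuous cB cG e20.
have [C C0 GC] := compact_fct_bounded cB cG.
have c20 : 0 < c *+ 2 by rewrite mulrn_wgt0.
(* If a coordinate of the grid point is at least [d / 2] away from [x], then
   [(4 c / d)^2 * q k i >= 1], so that [K * q k i] dominates the crude bound [2 C] for the
   oscillation of [G]. *)
pose K := C *+ 2 * (c *+ 4 / d) ^+ 2.
have K0 : 0 <= K by rewrite mulr_ge0 ?sqr_ge0// mulrn_wge0// ltW.
have p1 : 0 <= c *+ 4 / d by rewrite divr_ge0 ?mulrn_wge0// ltW.
have p2 : 0 <= K * n%:R / (e / 2) by exact: (divr_ge0 (mulr_ge0 K0 (ler0n _ _)) (ltW
  e20)).
(* The first summand keeps the displacement [2 c / N] of the nodes below [d / 2]; the second makes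
   the variance term [K * n / N] at most [e / 2]. *)
have [N0 N00 N0b] : exists2 N0 : nat, (0 < N0)%N & c *+ 4 / d + K * n%:R / (e / 2) <
  N0%:R.
  exists (Num.bound (c *+ 4 / d + K * n%:R / (e / 2))).+1 => //.
  by rewrite (lt_trans (archi_boundP (addr_ge0 p1 p2)))// ltr_nat.
exists N0 => N N0N m mN xi xiP x Bx.
have N_gt0 : 0 < N%:R :> R by rewrite ltr0n (leq_trans N00).
have Nb : c *+ 4 / d + K * n%:R / (e / 2) < N%:R by rewrite (lt_le_trans N0b)// ler_nat.
have cNd : c *+ 2 / N%:R < d / 2.
  have : c *+ 4 / d < N%:R by lra.
  rewrite ltr_pdivrMr// => h; rewrite ltr_pdivrMr// -[c *+ 4]mulr_natr in h *.
  by rewrite -[c *+ 2]mulr_natr; nra.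
have KN : K * n%:R / N%:R <= e / 2.
  have : K * n%:R / (e / 2) < N%:R by lra.
  by rewrite ltr_pdivrMr// => h; rewrite ler_pdivrMr// ltW// [ltRHS]mulrC.
set t := unit_coord x.
have t01 i : 0 <= t i <= 1.
  have := Bx i; rewrite !mxE => /andP[? ?]; rewrite /t /unit_coord.
  apply/andP; split; first by apply: divr_ge0; [lra|exact: ltW].
  by rewrite ler_pdivrMr// -[c *+ 2]mulr_natr; lra.
have xt i : x ord0 i = (c *+ 2) * t i - c.
  by rewrite /t /unit_coord mulrC divfK ?gt_eqF// addrK.
pose w := bern_weight m t : {ffun 'I_n -> 'I_N.+2} -> R.
have w0 k : 0 <= w k by apply: prodr_ge0 => i _; exact: bern_ge0.
have mN1 i : (m i <= N.+1)%N by have /andP[] := mN i.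
have m0 i : 0 < (m i)%:R :> R.
  by rewrite ltr0n; have /andP[+ _] := mN i; apply: leq_trans; rewrite (leq_trans N00).
have w1 : \sum_k w k = 1 by exact: bern_weight_sum.
rewrite -[G x]mul1r -w1 mulr_suml -sumrB.
apply: le_trans (ler_norm_sum _ _ _) _.
pose q (k : {ffun 'I_n -> 'I_N.+2}) i : R := ((k i)%:R / (m i)%:R - t i) ^+ 2.
have q0 k i : 0 <= q k i by exact: sqr_ge0.
(* Chebyshev's argument: near nodes are controlled by uniform continuity, far nodes by the variance,
   and indices with some [k i > m i] have weight 0. *)
have term k : `|G (xi k) * w k - w k * G x| <= (e / 2 + K * \sum_i q k i) * w k.
  rewrite [w k * _]mulrC -mulrBl normrM (ger0_norm (w0 k)).
  have [/forallP km|] := boolP [forall i, k i <= m i]%N; last first.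
    rewrite negb_forall => /existsP[i]; rewrite -ltnNge => mk.
    by rewrite /w /bern_weight (bigD1 i)//= bern_small// mul0r !mulr0.
  rewrite ler_wpM2r//; have [Bxi xik] := xiP k km.
  have [/forallP close|] := boolP [forall i, `|(c *+ 2) * ((k i)%:R / (m i)%:R - t i)|
    < d / 2].
    rewrite distrC (@le_trans _ _ (e / 2))//.
      apply: dG => //; split=> // a i; rewrite (ord1 a) -ball_normE /= distrC.
      have := xik i; have := close i; rewrite xt.
      set u := c *+ 2 * ((k i)%:R / (m i)%:R).
      rewrite mulrBr -/u => h1 h2.
      rewrite (_ : _ - _ = (xi k ord0 i - (u - c)) + (u - c *+ 2 * t i)); last by ring.
      rewrite (le_lt_trans (ler_normD _ _))// (splitr d); lra.
    by rewrite lerDl mulr_ge0// sumr_ge0.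
  rewrite negb_forall => /existsP[i]; rewrite -leNgt => far.
  have q1 : 1 <= (c *+ 4 / d) ^+ 2 * q k i.
    have : (d / 2) ^+ 2 <= (c *+ 2 * ((k i)%:R / (m i)%:R - t i)) ^+ 2.
      by rewrite -[leRHS]real_normK ?num_real// ler_sqr ?nnegrE// divr_ge0// ltW.
    rewrite /q; set z := _ / _ - _.
    rewrite (_ : (c *+ 4 / d) ^+ 2 * z ^+ 2 = (c *+ 2 * z) ^+ 2 * 4 / d ^+ 2).
      by rewrite ler_pdivlMr ?exprn_gt0// mul1r => h; lra.
    by field; rewrite gt_eqF.
  apply: (@le_trans _ _ (C *+ 2)).
    by rewrite (le_trans (ler_normB _ _))// mulr2n lerD// GC.
  rewrite (bigD1 i)//=.
  have : C *+ 2 <= K * q k i.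
    by rewrite /K -mulrA ler_peMr// mulrn_wge0// ltW.
  have : 0 <= K * \sum_(j | j != i) q k j by rewrite mulr_ge0// sumr_ge0.
  rewrite mulrDr; lra.
apply: (@le_trans _ _ (\sum_k (e / 2 + K * \sum_i q k i) * w k));
  first by apply: ler_sum => k _; exact: term.
have var i : \sum_k q k i * w k <= N%:R^-1.
  rewrite (eq_bigr (fun k : {ffun 'I_n -> 'I_N.+2} => (m i)%:R^-2 * (((k i)%:R - (m
    i)%:R * t i) ^+ 2 * w k))).
    rewrite -mulr_sumr (bern_weight_variance t i mN1).
    have /andP[? ?] := t01 i.
    rewrite (_ : _ * (_ * _) = (m i)%:R^-1 * (t i * (1 - t i))); last first.
      by field; rewrite gt_eqF.
    apply: (@le_trans _ _ ((m i)%:R^-1)); first by rewrite ler_piMr ?invr_ge0//; nra.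
    by rewrite lef_pV2 ?posrE// ler_nat; have /andP[] := mN i.
  move=> k _; rewrite mulrA /q; congr (_ * _).
  rewrite -exprVn -exprMn; congr (_ ^+ 2).
  by rewrite mulrBr mulrA mulVf ?gt_eqF// mul1r mulrC.
rewrite (eq_bigr (fun k => e / 2 * w k + K * \sum_i q k i * w k)) => [|k _]; last first.
  by rewrite mulrDl -[K * _ * _]mulrA mulr_suml.
rewrite big_split/= -mulr_sumr w1 mulr1 [leRHS]splitr lerD2l.
rewrite -mulr_sumr exchange_big/= (le_trans _ KN)// -mulrA ler_wpM2l//.
apply: (@le_trans _ _ (\sum_(i < n) N%:R^-1)); first by apply: ler_sum => i _; exact: var.
by rewrite sumr_const card_ord -[leLHS]mulr_natl.
Qed.

End bernstein_approximation.

Lemma rmorph_bern (A B : comPzRingType) (f : {rmorphism A -> B}) m k t :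
  f (bern m k t) = bern m k (f t).
Proof. by rewrite /bern !rmorphM/= rmorph_nat !rmorphXn/= rmorphB/= rmorph1. Qed.

Section mderiv_bern.
Context {R : comNzRingType} {n : nat}.
Implicit Types (p : mpoly n R) (i : 'I_n).

Lemma mderivXn i p k : mderiv i (p ^+ k) = k%:R * p ^+ k.-1 * mderiv i p.
Proof.
elim: k => [|k IH]; first by rewrite expr0 -mpolyC1 mderivC !mul0r.
rewrite exprS mderivM IH /=; case: k {IH} => [|k] /=; first by rewrite !expr0; ring.
by rewrite exprS -(natr1 k.+1); ring.
Qed.

(** The index [k - 1] must give 0 at [k = 0], whereas [k.-1] would give [bern N 0]. *)
Definition bern_pred N k p : mpoly n R := if k is k'.+1 then bern N k' p else 0.

(** Both pieces of the product rule carry [N.+1] times a binomial coefficient of degree [N], by the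
    two absorption identities. *)
Lemma mderiv_bern i p N k : mderiv i (bern N.+1 k p) =
  N.+1%:R * (bern_pred N k p - bern N k p) * mderiv i p.
Proof.
have d1 : mderiv i (1 - p) = - mderiv i p.
  by rewrite mderivB -mpolyC1 mderivC sub0r.
have dn l : mderiv i (l%:R : mpoly n R) = 0 by rewrite -mpolyC_nat mderivC.
rewrite {1}/bern mderivM dn mul0r add0r mderivM !mderivXn d1.
case: k => [|k] /=.
  by rewrite /bern !bin0 !subn0 /= !expr0; ring.
rewrite /bern subSS -subnS.
have h1 : (k.+1 * 'C(N.+1, k.+1))%:R = (N.+1 * 'C(N, k))%:R :> mpoly n R by rewrite
  -mul_bin_diag.
have h2 : ((N - k) * 'C(N.+1, k.+1))%:R = (N.+1 * 'C(N, k.+1))%:R :> mpoly n R.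
  by rewrite -[N in RHS]/(N.+1.-1) mul_bin_down subSS.
rewrite !natrM in h1 h2.
transitivity ((k.+1%:R * 'C(N.+1, k.+1)%:R) * p ^+ k * (1 - p) ^+ (N - k) * mderiv i p -
  ((N - k)%:R * 'C(N.+1, k.+1)%:R) * p ^+ k.+1 * (1 - p) ^+ (N - k.+1) * mderiv i p);
    first by ring.
by rewrite h1 h2; ring.
Qed.

Lemma mderiv_prod1 i (F : 'I_n -> mpoly n R) :
  (forall j, j != i -> mderiv i (F j) = 0) ->
  mderiv i (\prod_j F j) = mderiv i (F i) * \prod_(j | j != i) F j.
Proof.
move=> F0; rewrite (bigD1 i)//= mderivM [X in _ + _ * X](_ : _ = 0) ?mulr0 ?addr0//.
elim/big_ind: _ => [|p q p0 q0|j]; [by rewrite -mpolyC1 mderivC| |exact: F0].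
by rewrite mderivM p0 q0 mul0r mulr0 addr0.
Qed.

End mderiv_bern.

Section weierstrass.
Context {R : realType} {n : nat}.
Variable (c : R).
Hypothesis c0 : 0 < c.
Local Notation B := (box (const_mx (- c)) (const_mx c) : set 'rV[R]_n).
Implicit Types v : 'rV[R]_n -> R.

Let unit_var (i : 'I_n) : mpoly n R :=
  mpolyC n (c *+ 2)^-1 * (mpolyX R (mnm1 i) + mpolyC n c).

Let unit_coord (x : 'rV[R]_n) (i : 'I_n) : R := (x ord0 i + c) / (c *+ 2).

(** The grid and the degree are [N.+1], so that partial derivatives have degree [N] in the variable
    concerned. *)
Let node N (k : {ffun 'I_n -> 'I_N.+2}) : 'rV[R]_n :=
  \row_i (c *+ 2 * ((k i)%:R / N.+1%:R) - c).

Let bpoly N v : mpoly n R :=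
  \sum_(k : {ffun 'I_n -> 'I_N.+2})
    v (node k) *: \prod_i bern N.+1 (k i) (unit_var i).

Let c20 : 0 < c *+ 2. Proof. by rewrite mulrn_wgt0. Qed.

Let peval_unit_var i x : peval (unit_var i) x = unit_coord x i.
Proof. by rewrite pevalM pevalC pevalD pevalX pevalC mulrC. Qed.

Let peval_bern m k (p : mpoly n R) x : peval (bern m k p) x = bern m k (peval p x).
Proof. by rewrite /peval -rmorph_bern. Qed.

Let peval_prod (P : pred 'I_n) (F : 'I_n -> mpoly n R) x :
  peval (\prod_(i | P i) F i) x = \prod_(i | P i) peval (F i) x.
Proof. by rewrite /peval rmorph_prod. Qed.

Let node_box N (k : {ffun 'I_n -> 'I_N.+2}) : B (node k).
Proof.
move=> i; rewrite !mxE.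
have h0 : 0 <= ((k i)%:R / N.+1%:R : R) <= 1.
  by rewrite divr_ge0//= ler_pdivrMr// mul1r ler_nat leq_ord.
by move/andP: h0 => [h0 h1]; move: h0 h1 c0; set q := _ / _; clearbody q => h0 h1 c0';
  rewrite -[c *+ 2]mulr_natr; apply/andP; split; nra.
Qed.

Let peval_bpoly N v x :
  peval (bpoly N v) x = \sum_(k : {ffun 'I_n -> 'I_N.+2}) v (node k) * bern_weight
    (fun=> N.+1) (unit_coord x) k.
Proof.
rewrite /bpoly peval_bigsum; apply: eq_bigr => k _; rewrite pevalZ peval_prod.
by congr (_ * _); apply: eq_bigr => i _; rewrite peval_bern peval_unit_var.
Qed.

Let bpoly_approx v (e : R) : continuous v -> 0 < e ->
  exists N0, forall N, (N0 <= N)%N -> forall x, B x -> `|peval (bpoly N v) x - v x| <= e.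
Proof.
move=> cv e0; have [N0 H] := bernstein_approx c0 cv e0.
exists N0 => N N0N x Bx; rewrite peval_bpoly; apply: H => // [i|k _].
  by rewrite leqnSn leqnn.
by split; [exact: node_box|move=> i; rewrite mxE subrr normr0 divr_ge0// ltW].
Qed.

Let mderiv_unit_var i j : mderiv i (unit_var j) = mpolyC n ((i == j)%:R / (c *+ 2)).
Proof.
rewrite mderiv_mulC mderivD mderivC addr0 mderivX mnm1E [j == i]eq_sym.
have [->|] := eqVneq i j; last by rewrite mul0r scale0r mulr0 mpolyC0.
by rewrite -{1}[mnm1 _]add0m addmK mpolyX0 scale1r mulr1 div1r.
Qed.

(** The successor is cyclic so that the shift is a bijection of the indices; the index that wraps
    around has weight [bern N N.+1 = 0]. *)
Let shift_at N i (k : {ffun 'I_n -> 'I_N.+2}) : {ffun 'I_n -> 'I_N.+2} :=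
  [ffun j => if j == i then ordS (k j) else k j].

Let shift_at_inj N i : injective (@shift_at N i).
Proof.
move=> k l /ffunP kl; apply/ffunP => j; have := kl j; rewrite !ffunE.
by case: eqP => // _; apply: (bij_inj (ordS_bij _)).
Qed.

(** Summation by parts moves the difference from the basis to the values of [v]: the derivative is
    again a Bernstein sum, of difference quotients with step [2 c / N.+1]. *)
Let peval_mderiv_bpoly N v i x : peval (mderiv i (bpoly N v)) x =
  \sum_(k : {ffun 'I_n -> 'I_N.+2}) (N.+1%:R / (c *+ 2) * (v (node (shift_at i k)) - v
    (node k))) *
     bern_weight (fun j => if j == i then N else N.+1) (unit_coord x) k.
Proof.
set t := unit_coord x.
pose Q (k : {ffun 'I_n -> 'I_N.+2}) := \prod_(j | j != i) bern N.+1 (k j) (t j).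
pose bp (k : nat) : R := if k is k'.+1 then bern N k' (t i) else 0.
have wE (k : {ffun 'I_n -> 'I_N.+2}) :
    bern_weight (fun j => if j == i then N else N.+1) t k = bern N (k i) (t i) * Q k.
  rewrite /bern_weight (bigD1 i)//= eqxx; congr (_ * _).
  by apply: eq_bigr => j /negPf ->.
have lhsE : peval (mderiv i (bpoly N v)) x =
    \sum_(k : {ffun 'I_n -> 'I_N.+2})
      v (node k) * (N.+1%:R / (c *+ 2) * (bp (k i) - bern N (k i) (t i)) * Q k).
  rewrite /bpoly raddf_sum peval_bigsum; apply: eq_bigr => k _ /=.
  rewrite mderivZ pevalZ; congr (_ * _).
  rewrite mderiv_prod1 => [|j ji]; last first.
    by rewrite mderiv_bern mderiv_unit_var eq_sym (negPf ji) mul0r mpolyC0 mulr0.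
  rewrite pevalM peval_prod; congr (_ * _); last first.
    by apply: eq_bigr => j _; rewrite peval_bern peval_unit_var.
  rewrite mderiv_bern mderiv_unit_var eqxx pevalM pevalC pevalM pevalB -mpolyC_nat pevalC.
  rewrite peval_bern peval_unit_var -/(t i) mulrAC mulrA mulr1; congr (_ * _).
  by rewrite /bp /bern_pred; case: (nat_of_ord (k i)) => [|k'];
    rewrite ?peval0// peval_bern peval_unit_var.
rewrite lhsE.
under eq_bigr do rewrite mulrBr mulrBl mulrBr.
rewrite sumrB (reindex_inj (@shift_at_inj N i)) -sumrB.
apply: eq_bigr => k _; rewrite wE.
have -> : Q (shift_at i k) = Q k.
  by apply: eq_bigr => j /negPf ji; rewrite ffunE ji.
have -> : bp (shift_at i k i) = bern N (k i) (t i).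
  rewrite ffunE eqxx /=; have [kN|kN] := ltnP (k i) N.+1.
    by rewrite modn_small//= ltnS.
  have -> : nat_of_ord (k i) = N.+1 by apply/eqP; rewrite eqn_leq leq_ord.
  by rewrite modnn /= bern_small.
ring.
Qed.

Lemma weierstrass v (e : R) : continuous v -> 0 < e ->
  exists p, forall x, B x -> `|peval p x - v x| <= e.
Proof. by move=> cv e0; have [N0 H] := bpoly_approx cv e0; exists (bpoly N0 v);
  exact: H. Qed.

Let is_derive_line v (D : 'I_n -> 'rV[R]_n -> R) i (x0 : 'rV[R]_n) (s : R) :
  (forall x, is_derive x (delta_mx ord0 i) v (D i x)) ->
  is_derive s 1 (fun s => v (x0 + s *: delta_mx ord0 i)) (D i (x0 + s *: delta_mx ord0
    i)).
Proof.
move=> vD; have [dv vE] := vD (x0 + s *: delta_mx ord0 i).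
have fE : (fun h : R => h^-1 *: ((v \o shift (x0 + s *: delta_mx ord0 i)) (h *:
  delta_mx ord0 i)
     - v (x0 + s *: delta_mx ord0 i))) =
   (fun h : R => h^-1 *: (((fun s => v (x0 + s *: delta_mx ord0 i)) \o shift s) (h *: 1)
     - v (x0 + s *: delta_mx ord0 i))).
  apply/funext => h /=; congr (_ *: (v _ - _)).
  by rewrite scalerDl [h%:A]mulr1 addrCA.
by apply: DeriveDef; [rewrite /derivable -fE|rewrite -vE /derive -fE].
Qed.

(** The mean value theorem turns the difference quotient into a value of [D i] between two
    neighbouring nodes, close enough to the grid of degree [N] to serve as a displaced node in
    [bernstein_approx]. *)
Let shift_node v (D : 'I_n -> 'rV[R]_n -> R) N i (k : {ffun 'I_n -> 'I_N.+2}) :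
  (0 < N)%N -> continuous v -> (forall x, is_derive x (delta_mx ord0 i) v (D i x)) ->
  (k i <= N)%N ->
  exists xi, [/\ N.+1%:R / (c *+ 2) * (v (node (shift_at i k)) - v (node k)) = D i xi,
    B xi & forall j, `|xi ord0 j - (c *+ 2 * ((k j)%:R / (if j == i then N else
      N.+1)%:R) - c)|
       <= c *+ 2 / N%:R].
Proof.
move=> N0 cv vD kN; pose h : R := c *+ 2 / N.+1%:R.
have h0 : 0 < h by rewrite divr_gt0.
have nodeS : node (shift_at i k) = node k + h *: delta_mx ord0 i.
  apply/rowP => j; rewrite !mxE ffunE eqxx /=.
  case: eqP => [->|_]; last by rewrite mulr0 addr0.
  rewrite /= modn_small ?ltnS// mulr1 addrAC; congr (_ - _).
  by rewrite /h -[(k i).+1%:R]natr1; ring.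
pose phi s := v (node k + s *: delta_mx ord0 i).
have [||s] := @MVT_segment _ phi (fun s => D i (node k + s *: delta_mx ord0 i)) 0 h
  (ltW h0).
- by move=> s _; exact: is_derive_line.
- apply: continuous_subspaceT => s;
  apply: (@continuous_comp _ _ _ (fun s : R => node k + s *: delta_mx ord0 i) v).
    by apply: cvgD; [exact: cvg_cst|apply: cvgZr_tmp; exact: cvg_id].
  exact: cv.
rewrite in_itv/= => /andP[s0 sh] sE.
exists (node k + s *: delta_mx ord0 i); split.
- rewrite nodeS; have := sE; rewrite /phi scale0r addr0 subr0 => ->.
  by rewrite mulrCA [_ * h](_ : _ = 1) ?mulr1// /h mulrA divfK ?gt_eqF// mulfV ?gt_eqF.
- move=> j; rewrite !mxE eqxx /=; have := node_box k j; rewrite !mxE => /andP[b1 b2].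
  have [ji|_] := eqVneq j i; last by rewrite mulr0 addr0 b1 b2.
  rewrite mulr1; apply/andP; split; first by rewrite (le_trans b1)// lerDl.
  have := node_box (shift_at i k) i; rewrite nodeS !mxE !eqxx/= mulr1 => /andP[_].
  by rewrite ji; apply: le_trans; rewrite lerD2l.
- move=> j; rewrite !mxE eqxx /=.
  have hN : h <= c *+ 2 / N%:R by rewrite /h ler_pM2l// lef_pV2 ?posrE ?ltr0n// ler_nat.
  have [ji|_] := eqVneq j i; last by rewrite mulr0 addr0 subrr normr0 divr_ge0// ltW.
  rewrite mulr1 ji (le_trans _ hN)//.
  have N1 : 0 < N.+1%:R :> R by rewrite ltr0n.
  have NR : 0 < N%:R :> R by rewrite ltr0n.
  (* The grids of degrees [N] and [N.+1] differ at index [k i] by [h * k i / N]; this and [s] both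
     lie in [[0, h]]. *)
  rewrite (_ : _ - _ = s - h * ((k i)%:R / N%:R)); last first.
    by rewrite /h -natr1; field; rewrite natr1 !gt_eqF.
  have : 0 <= ((k i)%:R / N%:R : R) <= 1.
    by rewrite divr_ge0//= ler_pdivrMr// mul1r ler_nat.
  by move=> /andP[q0 q1]; rewrite ler_norml; apply/andP; split; nra.
Qed.

Lemma weierstrass_C1 v (D : 'I_n -> 'rV[R]_n -> R) (e : R) :
  continuous v -> (forall i, continuous (D i)) ->
  (forall i x, is_derive x (delta_mx ord0 i) v (D i x)) -> 0 < e ->
  exists p, forall x, B x -> `|peval p x - v x| <= e /\
    forall i, `|peval (mderiv i p) x - D i x| <= e.
Proof.
move=> cv cD vD e0.
have [N0 N0P] := bpoly_approx cv e0.
have /choice[N1 N1P] := fun i => bernstein_approx c0 (cD i) e0.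
pose N := maxn 1 (maxn N0 (\max_i N1 i)).
have N_gt0 : (0 < N)%N by rewrite /N leq_max.
have N0N : (N0 <= N)%N by rewrite /N !leq_max leqnn !orbT.
have N1N i : (N1 i <= N)%N.
  by rewrite /N (leq_trans (leq_bigmax i))// !leq_max leqnn !orbT.
exists (bpoly N v) => x Bx; split; first exact: N0P.
move=> i; rewrite peval_mderiv_bpoly.
(* For [k i = N.+1] the node is an arbitrary default, since the weight of degree [N] vanishes
   there. *)
have /choice[xi xiP] : forall k : {ffun 'I_n -> 'I_N.+2}, exists xi, (k i <= N)%N ->
    [/\ N.+1%:R / (c *+ 2) * (v (node (shift_at i k)) - v (node k)) = D i xi,
    B xi & forall j, `|xi ord0 j - (c *+ 2 * ((k j)%:R / (if j == i then N else
      N.+1)%:R) - c)|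
       <= c *+ 2 / N%:R].
  move=> k; have [kN|kN] := leqP (k i) N; last by exists 0.
  by have [xi H] := @shift_node v D N i k N_gt0 cv (vD i) kN; exists xi.
rewrite (eq_bigr (fun k => D i (xi k) *
    bern_weight (fun j => if j == i then N else N.+1) (unit_coord x) k)).
  apply: N1P => //.
  - by move=> j; case: ifP; rewrite ?leqnn ?leqnSn.
  - by move=> k /(_ i); rewrite eqxx => /xiP[].
move=> k _; have [kN|kN] := leqP (k i) N; first by have [-> _ _] := xiP k kN.
by rewrite /bern_weight (bigD1 i)//= eqxx bern_small// mul0r !mulr0.
Qed.

End weierstrass.

(** * Riesz representation *)

Section distance_to_complement.
Context {R : realType} {T : normedModType R}.
Implicit Types (V : set T) (x y : T).

(* The extra value 1 makes the infimum meaningful when [V] is the whole space. *)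
Definition codist V x : R := inf ([set `|x - y| | y in ~` V] `|` [set 1]).

Let codist_nonempty V x : [set `|x - y| | y in ~` V] `|` [set 1] !=set0.
Proof. by exists 1; right. Qed.

Let codist_lbound V x : has_lbound ([set `|x - y| | y in ~` V] `|` [set 1]).
Proof. by exists 0 => _ [[y _ <-]|->]. Qed.

Lemma codist_ge0 V x : 0 <= codist V x.
Proof. by apply: lb_le_inf => // _ [[y _ <-]|->]. Qed.

Lemma codist_eq0 V x : ~ V x -> codist V x = 0.
Proof.
move=> nVx; apply/eqP; rewrite eq_le codist_ge0 andbT.
by apply: ge_inf => //; left; exists x => //; rewrite subrr normr0.
Qed.

Lemma codist_gt0 V x : open V -> V x -> 0 < codist V x.
Proof.
move=> oV Vx; have /nbhs_normP[e /= e0 eV] : nbhs x V by exact: open_nbhs_nbhs.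
apply: (@lt_le_trans _ _ (Num.min e 1)); first by rewrite lt_min e0 ltr01.
apply: lb_le_inf => // _ [[y nVy <-]|->]; last by rewrite ge_min lexx orbT.
rewrite ge_min leNgt; apply/orP; left; apply/negP => xy; apply: nVy.
exact: eV.
Qed.

Let codist_lip V x y : codist V x <= `|x - y| + codist V y.
Proof.
rewrite addrC -lerBlDr; apply: lb_le_inf => // _ [[z nVz <-]|->]; rewrite lerBlDr.
  apply: (@le_trans _ _ `|x - z|); first by apply: ge_inf => //; left; exists z.
  have -> : x - z = (x - y) + (y - z) by rewrite addrA subrK.
  by rewrite [leRHS]addrC; exact: ler_normD.
by rewrite (@le_trans _ _ 1) ?lerDl//; apply: ge_inf => //; right.
Qed.

Lemma continuous_codist V : continuous (codist V).
Proof.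
move=> x; apply/cvgrPdist_le => e e0; near=> y.
have xy : `|x - y| <= e by near: y; exact: cvgr_dist_le.
rewrite ler_norml; apply/andP; split.
  have := codist_lip V y x; rewrite distrC; lra.
have := codist_lip V x y; lra.
Unshelve. all: by end_near. Qed.

End distance_to_complement.

Lemma continuous_measurable_borel (R : realType) (T : ptopologicalType) (f : T -> R) :
  continuous f -> measurable_fun [set: borel T] (f : borel T -> R).
Proof.
move=> cf; apply: (measurability _ (measurable_realfun.RGenOpens.measurableE R)).
move=> _ [_ [a [b ->] <-]]; rewrite setTI; apply: sub_sigma_algebra => /=.
by apply: open_comp => [x _|]; [exact: cf|exact: interval_open].
Qed.

Lemma open_measurable_borel (T : ptopologicalType) (V : set T) :
  open V -> measurable (V : set (borel T)).
Proof. by move=> oV; exact: sub_sigma_algebra. Qed.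

Lemma closed_measurable_borel (T : ptopologicalType) (V : set T) :
  closed V -> measurable (V : set (borel T)).
Proof.
move=> cV; rewrite -[V]setCK; apply: measurableC.
by apply: open_measurable_borel; exact: closed_openC.
Qed.

Lemma compact_measurable_borel (R : realType) (T : normedModType R) (K : set T) :
  compact K -> measurable (K : set (borel T)).
Proof.
move=> cK; apply: closed_measurable_borel; apply: compact_closed => //.
Qed.

Lemma compact_integrable (R : realType) (T : normedModType R)
    (mu : {measure set (borel T) -> \bar R}) (K : set T) (f : T -> R) :
  compact K -> (mu K < +oo)%E -> continuous f -> mu.-integrable K (EFin \o f).
Proof.
move=> cK muK cf; apply: measurable_bounded_integrable => //.
- exact: compact_measurable_borel.
- by apply: measurable_funTS; exact: continuous_measurable_borel.
- have [C C0 fC] := compact_fct_bounded cK cf.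
  exists C; split; first exact: num_real.
  by move=> M CM x Kx /=; rewrite (le_trans (fC x Kx))// ltW.
Qed.

Lemma functional_sum (R : realType) (T : topologicalType) (L : (T -> R) -> R) :
  (forall f g : T -> R, continuous f -> continuous g ->
    L (fun x => f x + g x) = L f + L g) ->
  (forall (a : R) (f : T -> R), continuous f -> L (fun x => a * f x) = a * L f) ->
  forall I (r : seq I) (F : I -> T -> R), (forall i, continuous (F i)) ->
  L (fun x => \sum_(i <- r) F i x) = \sum_(i <- r) L (F i).
Proof.
move=> LD LZ I r F cF; elim: r => [|i r IH].
  rewrite big_nil (_ : (fun x => _) = fun x => 0 * (fun=> 0) x).
    by rewrite LZ ?mul0r//; exact: continuous_fct_cst.
  by apply/funext => x; rewrite big_nil mul0r.
rewrite big_cons -IH -LD//; last exact: continuous_fct_sum.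
by congr L; apply/funext => x; rewrite big_cons.
Qed.

Section clamp.
Context {R : realDomainType}.
Definition clamp (y : R) : R := Num.min 1 (Num.max 0 y).

Lemma clamp_itv y : 0 <= clamp y <= 1.
Proof. by rewrite /clamp le_min ler01 le_max lexx ge_min lexx. Qed.

Lemma clamp_id y : 0 <= y <= 1 -> clamp y = y.
Proof. by move=> /andP[y0 y1]; rewrite /clamp max_r// min_r. Qed.

Lemma clamp0 y : y <= 0 -> clamp y = 0.
Proof. by move=> y0; rewrite /clamp max_l// min_r. Qed.

Lemma clamp1 y : 1 <= y -> clamp y = 1.
Proof. by move=> y1; rewrite /clamp max_r ?min_l// (le_trans _ y1). Qed.

(** Cutting [y] into unit slices: full slices give 1, at most one is partial, and the others give
    0. *)
Lemma clamp_sum y N : 0 <= y <= N%:R -> \sum_(j < N) clamp (y - j%:R) = y.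
Proof.
elim: N y => [|N IH] y; first by rewrite big_ord0 => /andP[? ?]; apply/eqP;
  rewrite eq_le; apply/andP.
move=> /andP[y0 yN]; rewrite big_ord_recr/=.
have [yN'|Ny] := leP y N%:R.
  by rewrite IH ?y0// clamp0 ?addr0// subr_le0.
rewrite clamp_id; last by rewrite subr_ge0 ltW//= lerBlDr addrC natr1.
rewrite (eq_bigr (fun=> 1)) => [|j _].
  by rewrite sumr_const card_ord addrC subrK.
rewrite clamp1// lerBrDr (le_trans _ (ltW Ny))// addrC natr1 ler_nat.
exact: ltn_ord.
Qed.
End clamp.

(** * Construction of the representing measure of a positive functional *)

Section riesz_representation.
Context {R : realType} {T : normedModType R}.
Variables (K : set T) (L : (T -> R) -> R).
Hypothesis cK : compact K.
Hypothesis LD : forall f g : T -> R, continuous f -> continuous g ->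
  L (fun x => f x + g x) = L f + L g.
Hypothesis LZ : forall (a : R) (f : T -> R), continuous f -> L (fun x => a * f x) = a *
  L f.
Hypothesis L_ge0 : forall f : T -> R, continuous f -> (forall x, K x -> 0 <= f x) -> 0
  <= L f.
Implicit Types (f g : T -> R) (V W : set T).

Let ccst (a : R) : continuous (fun _ : T => a).
Proof. exact: continuous_fct_cst. Qed.

Let LN f : continuous f -> L (fun x => - f x) = - L f.
Proof.
move=> cf; rewrite -mulN1r -LZ//; congr L.
by apply/funext => x; rewrite mulN1r.
Qed.

Let L_le f g : continuous f -> continuous g -> (forall x, K x -> f x <= g x) ->
  L f <= L g.
Proof.
move=> cf cg fg; rewrite -subr_ge0 -LN// -LD//; last exact: continuous_fctN.
apply: L_ge0 => [|x Kx]; last by rewrite subr_ge0 fg.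
by apply: continuous_fctD => //; exact: continuous_fctN.
Qed.

Let L_eq f g : continuous f -> continuous g -> (forall x, K x -> f x = g x) ->
  L f = L g.
Proof.
by move=> cf cg fg; apply/eqP; rewrite eq_le !L_le// => x /fg ->.
Qed.

Let L_sum I (r : seq I) (F : I -> T -> R) : (forall i, continuous (F i)) ->
  L (fun x => \sum_(i <- r) F i x) = \sum_(i <- r) L (F i).
Proof. exact: functional_sum. Qed.

Let L1 := L (fun=> 1).
Let L1_ge0 : 0 <= L1. Proof. exact: L_ge0. Qed.

Let L_cst a : L (fun=> a) = a * L1.
Proof. by rewrite -LZ//; congr L; apply/funext => x; rewrite mulr1. Qed.

(** The functions subordinate to [V]: vanishing off [V] is enough, their closed support may reach
    beyond [V]. *)
Let adm V : set (T -> R) :=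
  [set f : T -> R | [/\ continuous f, (forall x, 0 <= f x <= 1) & (forall x, ~ V x -> f
    x = 0)]].

Let adm0 V : adm V (fun=> 0).
Proof. by split=> // x; rewrite lexx ler01. Qed.

Let admS V W f : V `<=` W -> adm V f -> adm W f.
Proof. by move=> VW [cf f01 f0]; split=> // x nWx; apply: f0 => /VW. Qed.

(** The measure of an open set, approached from inside by functions; [oute] extends it to all sets
    from outside by open sets. *)
Let mo V : R := sup [set L f | f in adm V].

Let mo_set0 V : [set L f | f in adm V] !=set0.
Proof. by eexists; exists (fun=> 0). Qed.

Let mo_ubound V : has_ubound [set L f | f in adm V].
Proof.
exists L1 => _ [f [cf f01 _] <-]; apply: L_le => // x _.
by have /andP[] := f01 x.
Qed.

Let mo_ge V f : adm V f -> L f <= mo V.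
Proof. by move=> af; apply: ub_le_sup => //; exists f. Qed.

Let mo_le V a : (forall f, adm V f -> L f <= a) -> mo V <= a.
Proof. by move=> H; apply: ge_sup => // _ [f /H ? <-]. Qed.

Let mo_ge0 V : 0 <= mo V.
Proof. by apply: le_trans (mo_ge (adm0 V)); apply: L_ge0. Qed.

Let mo_le1 V : mo V <= L1.
Proof.
by apply: mo_le => f [cf f01 _]; apply: L_le => // x _; have /andP[] := f01 x.
Qed.

Let mo_mono V W : V `<=` W -> mo V <= mo W.
Proof. by move=> VW; apply: mo_le => f /(admS VW); exact: mo_ge. Qed.

Let oute (A : set T) : R := inf [set mo V | V in [set V | open V /\ A `<=` V]].

Let oute_set0 A : [set mo V | V in [set V | open V /\ A `<=` V]] !=set0.
Proof. by exists (mo setT); exists setT => //; split => //; exact: openT. Qed.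

Let oute_lbound A : has_lbound [set mo V | V in [set V | open V /\ A `<=` V]].
Proof. by exists 0 => _ [V _ <-]. Qed.

Let oute_le A V : open V -> A `<=` V -> oute A <= mo V.
Proof. by move=> oV AV; apply: ge_inf => //; exists V. Qed.

Let oute_ge A a : (forall V, open V -> A `<=` V -> a <= mo V) -> a <= oute A.
Proof. by move=> H; apply: lb_le_inf => // _ [V [oV AV] <-]; exact: H. Qed.

Let oute_open V : open V -> oute V = mo V.
Proof.
move=> oV; apply/eqP; rewrite eq_le oute_le//=.
by apply: oute_ge => W oW; exact: mo_mono.
Qed.

Let oute_ge0 A : 0 <= oute A. Proof. exact: oute_ge. Qed.

Let oute_mono A B : A `<=` B -> oute A <= oute B.
Proof.
by move=> AB; apply: oute_ge => V oV BV; apply: oute_le => //; exact: subset_trans BV.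
Qed.

Let bump V N x : R := Num.min 1 (N%:R * codist V x).

Let adm_bump V N : adm V (bump V N).
Proof.
split.
- apply: continuous_fct_min => //; apply: continuous_fctM => //; exact: continuous_codist.
- move=> x; rewrite /bump le_min ler01 ge_min lexx/= andbT.
  by rewrite mulr_ge0// codist_ge0.
- by move=> x nVx; rewrite /bump codist_eq0// mulr0 min_r.
Qed.

(* Compactness of [K `&` [set f >= e]] extracts finitely many of the [V i]. *)
Let bump_cover (V : (set T)^nat) f (e : R) : (forall i, open (V i)) -> 0 < e ->
  adm (\bigcup_i V i) f ->
  exists N, forall x, K x -> f x <= e + \sum_(i < N) bump (V i) N x.
Proof.
move=> oV e0 [cf f01 f0].
have cK' : compact (K `&` f @^-1` [set y | e <= y]).
  apply: compact_closedI => //; apply: closed_comp => [x _|]; first exact: cf.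
  exact: closed_ge.
have NC : near_covering (K `&` f @^-1` [set y | e <= y]).
  by apply/compact_near_coveringP.
have HN : \forall N \near \oo, K `&` f @^-1` [set y | e <= y] `<=`
    (fun x => 1 <= \sum_(i < N) bump (V i) N x).
  apply: NC => x [Kx /= efx].
  have [i _ Vix] : (\bigcup_i V i) x.
    by apply: contrapT => /f0 fx0; move: efx; rewrite fx0 leNgt e0.
  have d0 := codist_gt0 (oV i) Vix; set d := codist (V i) x in d0.
  (* For [N >= N0] the bump of [V i] equals 1 wherever [codist (V i)] exceeds [d / 2], hence on a
     neighbourhood of [x]. *)
  have [N0 N0d] : exists N0 : nat, 2 / d < N0%:R.
    by exists (Num.bound (2 / d)); apply: archi_boundP; rewrite divr_ge0// ltW.
  exists ([set x' | d / 2 < codist (V i) x'], [set N | (maxn N0 i.+1 <= N)%N]).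
    split=> /=; last by exists (maxn N0 i.+1).
    have /cvgrPdist_lt/(_ (d / 2)) := @continuous_codist _ _ (V i) x.
    move=> /(_ (divr_gt0 d0 (ltr0n _ 2))); apply: filterS => x' /=.
    by rewrite ltr_norml => /andP[_]; rewrite -/d; lra.
  move=> [x' N] /= [dx']; rewrite geq_max => /andP[N0N iN].
  rewrite (bigD1 (Ordinal iN))//= (@le_trans _ _ (bump (V i) N x'))//.
    rewrite /bump le_min lexx/=.
    have : 2 / d < N%:R by rewrite (lt_le_trans N0d)// ler_nat.
    rewrite ltr_pdivrMr// => h.
    have N00 : 0 <= N%:R :> R by [].
    by nra.
  rewrite lerDl sumr_ge0// => j _.
  by have [_ /(_ x')/andP[]] := adm_bump (V j) N.
have /filter_ex[N NP] := HN; exists N => x Kx.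
have s0 : 0 <= \sum_(i < N) bump (V i) N x.
  by apply: sumr_ge0 => j _; have [_ /(_ x)/andP[]] := adm_bump (V j) N.
have [fe|ef] := leP (f x) e; first by rewrite (le_trans fe)// lerDl.
have /andP[_ f1] := f01 x.
rewrite (le_trans f1)// (le_trans (NP x _))// ?lerDr ?ltW//.
by split=> //=; exact: ltW.
Qed.

(** On [K] and up to a constant [d], a function subordinate to the union lies below a finite sum of
    bumps of the single [V i]. An upper bound suffices, so the bumps take the place of a partition
    of unity. *)
Let mo_sigma_subadditive (V : (set T)^nat) : (forall i, open (V i)) ->
  ((mo (\bigcup_i V i))%:E <= \sum_(0 <= i <oo) (mo (V i))%:E)%E.
Proof.
move=> oV; apply/lee_addgt0Pr => e e0.
have [d d0 dL] : exists2 d, 0 < d & d * L1 <= e.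
  exists (e / (L1 + 1)); first by rewrite divr_gt0// ltr_wpDl.
  rewrite mulrAC ler_pdivrMr ?ltr_wpDl// ler_pM2l//; lra.
have s0 : (0 <= \sum_(0 <= i <oo) (mo (V i))%:E)%E.
  by apply: nneseries_ge0 => i _ _; rewrite lee_fin.
set S := (\sum_(0 <= i <oo) (mo (V i))%:E)%E in s0 *.
have [Sfin|] := boolP (S \is a fin_num); last first.
  by rewrite ge0_fin_numE// -leNgt leye_eq => /eqP ->; rewrite leey.
rewrite -(fineK Sfin) -EFinD lee_fin; apply: mo_le => f af.
have [N fN] := bump_cover oV d0 af.
have cb i : continuous (bump (V i) N) by have [] := adm_bump (V i) N.
have csum : continuous (fun x => \sum_(i < N) bump (V i) N x).
  exact: continuous_fct_sum.
have [cf _ _] := af.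
apply: (@le_trans _ _ (L (fun x => d + \sum_(i < N) bump (V i) N x))).
  by apply: L_le => //; exact: continuous_fctD.
rewrite LD// L_cst addrC lerD// L_sum//.
apply: (@le_trans _ _ (\sum_(i < N) mo (V i))).
  by apply: ler_sum => i _; apply: mo_ge; exact: adm_bump.
rewrite -lee_fin fineK// -sumEFin /S.
rewrite -(big_mkord xpredT (fun i => (mo (V i))%:E)).
by apply: nneseries_lim_ge => i _ _; rewrite lee_fin.
Qed.

Let mu (A : set T) : \bar R := (oute A)%:E.

Let mu0 : mu set0 = 0%E.
Proof.
rewrite /mu oute_open//; last exact: open0.
congr EFin; apply/eqP; rewrite eq_le mo_ge0 andbT; apply: mo_le => f [cf _ f0].
rewrite -[leRHS](mul0r L1) -L_cst; apply: L_le => // x _.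
by rewrite f0.
Qed.

Let mu_ge0 A : (0 <= mu A)%E. Proof. by rewrite lee_fin. Qed.

Let mu_mono : {homo mu : A B / A `<=` B >-> (A <= B)%E}.
Proof. by move=> A B AB; rewrite lee_fin; exact: oute_mono. Qed.

Let mu_sigma_subadditive : sigma_subadditive mu.
Proof.
move=> F; apply/lee_addgt0Pr => e e0.
have /choice[V VP] : forall i, exists V, [/\ open V, F i `<=` V &
    mo V <= oute (F i) + e / (2 ^ i.+1)%:R].
  move=> i; have ei0 : 0 < e / (2 ^ i.+1)%:R by rewrite divr_gt0// ltr0n expn_gt0.
  have [_ [V [oV FV] <-] Ve] := inf_adherent ei0 (conj (oute_set0 (F i)) (oute_lbound
    (F i))).
  by exists V; split=> //; exact: ltW.
apply: (le_trans _ (@epsilon_trick _ (mu \o F) e xpredT (fun i => mu_ge0 (F i)) (ltW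
  e0))).
have oV i : open (V i) by have [] := VP i.
apply: (@le_trans _ _ (mo (\bigcup_i V i))%:E).
  rewrite lee_fin; apply: oute_le; first exact: bigcup_open.
  by move=> x [i _ Fx]; exists i => //; have [_ + _] := VP i; apply.
apply: (le_trans (mo_sigma_subadditive oV)); apply: lee_nneseries => [i _ _|i _].
  by rewrite lee_fin.
by rewrite /= /mu -EFinD lee_fin; have [] := VP i.
Qed.

HB.instance Definition _ := isOuterMeasure.Build R T mu mu0 mu_ge0 mu_mono
  mu_sigma_subadditive.

(** For [f] subordinate to [W] and [V], the open set of points of [W] with [f < d] contains [W]
    minus [V]. If [g] is subordinate to that set, [max (f - d) 0 + g] is subordinate to [W], because
    the two terms are never both nonzero; cutting [f] costs at most [d * L1]. *)
Let mo_split V W : open V -> open W -> mo (W `&` V) + oute (W `&` ~` V) <= mo W.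
Proof.
move=> oV oW; rewrite -lerBrDr; apply: mo_le => f af; rewrite lerBrDr.
have [cf f01 f0] := af.
apply/ler_addgt0Pr => e e0.
have [d d0 dL] : exists2 d, 0 < d & d * L1 <= e.
  exists (e / (L1 + 1)); first by rewrite divr_gt0// ltr_wpDl.
  rewrite mulrAC ler_pdivrMr ?ltr_wpDl// ler_pM2l//; lra.
pose W' := W `&` f @^-1` [set y | y < d].
have oW' : open W'.
  by apply: openI => //; apply: open_comp => [x _|]; [exact: cf|exact: open_lt].
have WW' : oute (W `&` ~` V) <= mo W'.
  by apply: oute_le => // x [Wx nVx]; split => //=; rewrite f0// => -[].
rewrite (le_trans (lerD (lexx _) WW'))// -lerBrDl; apply: mo_le => g [cg g01 g0].
rewrite lerBrDl.
pose h x := Num.max (f x - d) 0 + g x.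
have cfd : continuous (fun x => Num.max (f x - d) 0).
  by apply: continuous_fct_max => //; apply: continuous_fctB.
have ah : adm W h.
  split; first exact: continuous_fctD.
  - move=> x; have /andP[? ?] := f01 x; have /andP[? ?] := g01 x; rewrite /h.
    have [fd|fd] := leP (f x) d.
      by rewrite max_r ?subr_le0// add0r; exact: g01.
    rewrite g0 ?addr0; last by move=> [_ /=]; rewrite ltNge (ltW fd).
    rewrite max_l ?subr_ge0 ?(ltW fd)//; lra.
  - move=> x nWx; rewrite /h f0 ?g0; [|by move=> []|by move=> []].
    by rewrite addr0 max_r// subr_le0 ltW.
have := mo_ge ah; rewrite /h LD// => hW.
suff : L f <= L (fun x => Num.max (f x - d) 0) + d * L1 by lra.
rewrite -L_cst -LD//; apply: L_le => //; first exact: continuous_fctD.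
by move=> x _; rewrite -lerBlDr le_max lexx.
Qed.

Let open_caratheodory V : open V -> mu.-caratheodory V.
Proof.
move=> oV; apply: le_caratheodory_measurable => A.
rewrite -EFinD lee_fin; apply: oute_ge => W oW AW.
apply: le_trans (mo_split oV oW); apply: lerD.
  by apply: oute_le; [exact: openI|exact: setSI].
by apply: oute_mono; exact: setSI.
Qed.

Let borel_caratheodory (A : set (borel T)) : measurable A -> mu.-caratheodory A.
Proof.
apply: smallest_sub; last by move=> V oV; exact: open_caratheodory.
split; first exact: caratheodory_measurable_set0.
- by move=> B cB; rewrite setTD; exact: caratheodory_measurable_setC.
- by move=> F cF; exact: caratheodory_measurable_bigcup.
Qed.

Definition riesz_measure (A : set (borel T)) : \bar R := mu A.

Let rm0 : riesz_measure set0 = 0%E. Proof. exact: mu0. Qed.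
Let rm_ge0 A : (0 <= riesz_measure A)%E. Proof. exact: mu_ge0. Qed.
Let rm_sigma_additive : semi_sigma_additive riesz_measure.
Proof.
move=> F mF tF mUF.
apply: (@caratheodory_measure_sigma_additive R T mu F) => //.
  by move=> i; exact: borel_caratheodory.
exact: borel_caratheodory.
Qed.

HB.instance Definition _ := isMeasure.Build _ _ _ riesz_measure
  rm0 rm_ge0 rm_sigma_additive.

Let rm_fin : fin_num_fun riesz_measure.
Proof. by move=> A _. Qed.

HB.instance Definition _ := Measure_isFinite.Build _ _ _ riesz_measure rm_fin.

Let mK : measurable (K : set (borel T)). Proof. exact: compact_measurable_borel. Qed.

Let riesz_measure_setC : riesz_measure (~` K) = 0%E.
Proof.
rewrite /riesz_measure /mu oute_open; last first.
  by apply: closed_openC; apply: compact_closed => //; exact: norm_hausdorff.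
congr EFin; apply/eqP; rewrite eq_le mo_ge0 andbT; apply: mo_le => f [cf _ f0].
rewrite -[leRHS](mul0r L1) -L_cst; apply: L_le => // x Kx.
by rewrite f0// => /(_ Kx).
Qed.

Let oute_setIK V : open V -> oute (V `&` K) = mo V.
Proof.
move=> oV; apply: EFin_inj; rewrite -(oute_open oV) -![(oute _)%:E]/(mu _).
rewrite (borel_caratheodory mK V) [X in (_ + X)%E](_ : _ = 0%E) ?adde0//.
apply/eqP; rewrite eq_le mu_ge0 andbT -riesz_measure_setC.
by apply: mu_mono => x [].
Qed.

Local Notation rm := (riesz_measure : {measure set (borel T) -> \bar R}).

Let I f : R := \int[rm]_(x in K) f x.

Let rmK : (rm K < +oo)%E. Proof. by rewrite ltry. Qed.

Let int f : continuous f -> rm.-integrable K (EFin \o f).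
Proof. exact: compact_integrable. Qed.

Let ID f g : continuous f -> continuous g -> I (fun x => f x + g x) = I f + I g.
Proof. by move=> cf cg; rewrite /I RintegralD//; exact: int. Qed.

Let IZ a f : continuous f -> I (fun x => a * f x) = a * I f.
Proof. by move=> cf; rewrite /I RintegralZl//; exact: int. Qed.

Let I_cst a : I (fun=> a) = a * L1.
Proof.
rewrite /I Rintegral_cst//; congr (_ * _); rewrite /= /riesz_measure /mu.
have := oute_setIK openT; rewrite setTI => -> /=.
apply/eqP; rewrite eq_le mo_le1/=; apply: mo_ge; split=> [//|x|x []//].
by rewrite ler01 lexx.
Qed.

Let cclamp f : continuous f -> continuous (fun x => clamp (f x)).
Proof. by move=> cf; apply: continuous_fct_min => //; apply: continuous_fct_max. Qed.

(** Slice [N * f] into [F j], which vanishes off [V j] and equals 1 on [V j.+1]. Hence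
    [L (F j) <= mo (V j)] and [mo (V j.+1) <= I (F j)]; the shift of index costs at most [L1] in
    total, which disappears on division by [N]. *)
Let L_le_I f : continuous f -> (forall x, 0 <= f x <= 1) -> L f <= I f.
Proof.
move=> cf f01; apply/ler_addgt0Pr => e e0.
have [N N0 Ne] : exists2 N : nat, (0 < N)%N & L1 / e < N%:R.
  exists (Num.bound (L1 / e)).+1 => //; rewrite (lt_trans (archi_boundP _)) ?ltr_nat//.
  by rewrite divr_ge0// ltW.
have NR : 0 < N%:R :> R by rewrite ltr0n.
pose F j x := clamp (N%:R * f x - j%:R).
have cNf : continuous (fun x => N%:R * f x) by apply: continuous_fctM.
have cF j : continuous (F j) by apply: cclamp; apply: continuous_fctB.
have fF : (fun x => N%:R * f x) = (fun x => \sum_(j < N) F j x).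
  apply/funext => x; rewrite clamp_sum//; have /andP[? ?] := f01 x.
  by rewrite mulr_ge0//= ler_piMr.
have LF : N%:R * L f = \sum_(j < N) L (F j).
  by rewrite -LZ// fF; apply: functional_sum => //.
have IF : N%:R * I f = \sum_(j < N) I (F j).
  by rewrite -IZ// fF; apply: functional_sum => //.
pose V (j : nat) := [set x | j%:R < N%:R * f x].
have oV j : open (V j).
  by apply: (@open_comp _ _ (fun x => N%:R * f x) [set y | j%:R < y]) => [x _|];
    [exact: cNf|exact: open_gt].
have LV j : L (F j) <= mo (V j).
  apply: mo_ge; split=> [|x|x]; [exact: cF|exact: clamp_itv|].
  by move=> /negP; rewrite -leNgt => h; rewrite /F clamp0// subr_le0.
have IV j : mo (V j.+1) <= I (F j).
  rewrite -oute_setIK//.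
  have mV : measurable (V j.+1 : set (borel T)) by exact: open_measurable_borel.
  have -> : oute (V j.+1 `&` K) = \int[rm]_(x in K) \1_(V j.+1) x.
    by rewrite /Rintegral integral_indic.
  apply: le_Rintegral => //.
  - apply: (@integrableS _ _ _ _ setT) => //.
    exact: (@integrable_indic _ _ _ (riesz_measure : {finite_measure set (borel T) ->
      \bar R})).
  - exact: int.
  - move=> x Kx; rewrite indicE; have [|_] := boolP (x \in V j.+1) => /=.
      by rewrite inE => Vx; rewrite /F clamp1// lerBrDr addrC natr1 ltW.
    by have /andP[] := clamp_itv (N%:R * f x - j%:R).
have telescope : \sum_(j < N) mo (V j) <= \sum_(j < N) mo (V j.+1) + L1.
  have : \sum_(j < N) mo (V j) + mo (V N) = mo (V 0%N) + \sum_(j < N) mo (V j.+1).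
    by rewrite -(big_ord_recr _ (fun j : 'I_N.+1 => mo (V j))) big_ord_recl.
  have := mo_le1 (V 0%N); have := mo_ge0 (V N); lra.
rewrite -(ler_pM2l NR) mulrDr LF IF.
apply: (@le_trans _ _ (\sum_(j < N) mo (V j))); first by apply: ler_sum => j _; exact: LV.
rewrite (le_trans telescope)// lerD//.
  by apply: ler_sum => j _; exact: IV.
by rewrite ltW// -ltr_pdivrMr.
Qed.

(** The inequality for [g] and for [1 - g] gives equality, as both functionals agree on constants;
    on [K] any continuous [f] is an affine image of a function with values in the unit interval. *)
Let Rintegral_riesz_measure f : continuous f -> \int[rm]_(x in K) f x = L f.
Proof.
have I01 g : continuous g -> (forall x, 0 <= g x <= 1) -> I g = L g.
  move=> cg g01; apply/eqP; rewrite eq_le L_le_I// andbT.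
  have c1g : continuous (fun x => 1 - g x) by apply: continuous_fctB.
  have : L (fun x => 1 - g x) <= I (fun x => 1 - g x).
    by apply: L_le_I => // x; have := g01 x; lra.
  have cNg : continuous (fun x => -1 * g x) by apply: continuous_fctM.
  have E : (fun x => 1 - g x) = (fun x => 1 + -1 * g x).
    by apply/funext => x; rewrite mulN1r.
  by rewrite E LD// ID// LZ// IZ// L_cst I_cst; lra.
move=> cf; have [C C0 fC] := compact_fct_bounded cK cf.
pose g x := clamp ((C *+ 2)^-1 * (f x + C)).
have cg : continuous g.
  by apply: cclamp; apply: continuous_fctM => //; apply: continuous_fctD.
have C20 : 0 < C *+ 2 by rewrite mulrn_wgt0.
have fg x : K x -> f x = C *+ 2 * g x + - C.
  move=> Kx; have := fC x Kx; rewrite ler_norml => /andP[f1 f2].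
  rewrite /g clamp_id; first by rewrite mulrA mulfV ?gt_eqF// mul1r addrK.
  apply/andP; split; first by rewrite mulr_ge0 ?invr_ge0 ?(ltW C20)//; lra.
  by rewrite mulrC ler_pdivrMr// mul1r mulr2n lerD.
have cCg : continuous (fun x => C *+ 2 * g x) by apply: continuous_fctM.
have cr : continuous (fun x => C *+ 2 * g x + - C) by apply: continuous_fctD.
rewrite (L_eq cf cr fg) LD// LZ// L_cst -[in RHS]I01//; last by move=> x;
  exact: clamp_itv.
transitivity (I (fun x => C *+ 2 * g x + - C)).
  by apply: eq_Rintegral => x; rewrite inE => /fg.
by rewrite ID// IZ// I_cst.
Qed.

Theorem riesz_representation :
  exists mu : {finite_measure set (borel T) -> \bar R}, mu (~` K) = 0%E /\
    forall f, continuous f -> \int[mu]_(x in K) f x = L f.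
Proof.
by exists (riesz_measure : {finite_measure set (borel T) -> \bar R}).
Qed.

End riesz_representation.

Lemma eq0_norm_le_eps (R : realType) (x C : R) : (forall e, 0 < e -> `|x| <= e * C) ->
  x = 0.
Proof.
move=> H; apply/eqP; rewrite -normr_le0; apply/ler_addgt0Pr => e e0; rewrite add0r.
have C1 : 0 < `|C| + 1 by rewrite ltr_wpDl.
rewrite (le_trans (H _ (divr_gt0 e0 C1)))// mulrAC ler_pdivrMr// ler_pM2l//.
by rewrite (le_trans (ler_norm _))// lerDl.
Qed.

(** * Topology of row vectors and extension from compact sets *)

Section row_vector_topology.
Context {R : realType}.

Lemma continuous_rV (T : topologicalType) N (F : T -> 'rV[R]_N) :
  (forall i, continuous (fun z => F z ord0 i)) -> continuous F.
Proof.
move=> cF z A /nbhs_ballP[e /= e0 eA]; rewrite nbhs_simpl/=.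
have H : \forall z' \near z, forall i, ball (F z ord0 i) e (F z' ord0 i).
  by apply: filter_forall => i; apply: (cF i z); exact: nbhsx_ballx.
near=> z'; apply: eA; split=> // a i; rewrite (ord1 a).
by move: i; near: z'.
Unshelve. all: by end_near. Qed.

Lemma compact_sub_box (T : topologicalType) N (F : T -> 'rV[R]_N) (K : set T) :
  compact K -> continuous F ->
  exists2 c, 0 < c & forall z, K z -> box (const_mx (- c)) (const_mx c) (F z).
Proof.
move=> cK cF.
have /choice[C CP] : forall i, exists C, 0 < C /\ forall z, K z -> `|F z ord0 i| <= C.
  move=> i; have [|C C0 CK] := @compact_fct_bounded R T K (fun z => F z ord0 i) cK.
    move=> z; apply: (@continuous_comp _ _ _ F (fun y => y ord0 i)); first exact: cF.
    exact: coord_continuous.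
  by exists C.
have s0 (P : pred 'I_N) : 0 <= \sum_(i | P i) C i.
  by apply: sumr_ge0 => i _; rewrite ltW// (CP i).1.
exists (1 + \sum_i C i) => [|z Kz i]; first by rewrite ltr_pwDl.
rewrite !mxE -ler_norml (le_trans ((CP i).2 z Kz))//.
by rewrite (bigD1 i)//= addrCA lerDl addr_ge0.
Qed.

Lemma continuous_lsubmx n m : continuous (fun w : 'rV[R]_(n + m) => lsubmx w).
Proof.
apply: continuous_rV => i z.
rewrite (_ : (fun w => _) = (fun w : 'rV[R]_(n + m) => w ord0 (lshift m i))).
  exact: coord_continuous.
by apply/funext => w; rewrite mxE.
Qed.

Lemma continuous_rsubmx n m : continuous (fun w : 'rV[R]_(n + m) => rsubmx w).
Proof.
apply: continuous_rV => i z.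
rewrite (_ : (fun w => _) = (fun w : 'rV[R]_(n + m) => w ord0 (rshift n i))).
  exact: coord_continuous.
by apply/funext => w; rewrite mxE.
Qed.

Lemma continuous_row_mx n m :
  continuous (fun z : 'rV[R]_n * 'rV[R]_m => row_mx z.1 z.2).
Proof.
apply: continuous_rV => i z; case: (split_ordP i) => j ->.
  rewrite (_ : (fun z => _) = (fun z : 'rV[R]_n * 'rV[R]_m => z.1 ord0 j)).
    apply: (@continuous_comp _ _ _ fst (fun y : 'rV[R]_n => y ord0 j)).
      exact: cvg_fst.
    exact: coord_continuous.
  by apply/funext => y; rewrite row_mxEl.
rewrite (_ : (fun z => _) = (fun z : 'rV[R]_n * 'rV[R]_m => z.2 ord0 j)).
  apply: (@continuous_comp _ _ _ snd (fun y : 'rV[R]_m => y ord0 j)).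
    exact: cvg_snd.
  exact: coord_continuous.
by apply/funext => y; rewrite row_mxEr.
Qed.

(** The functions [w] of both linear programs live on [X] only, while approximation and
    representation are set up for functions continuous everywhere. *)
Lemma tietze_compact n (X : set 'rV[R]_n) (w : 'rV[R]_n -> R) :
  compact X -> {within X, continuous w} ->
  exists2 h : 'rV[R]_n -> R, continuous h & forall x, X x -> w x = h x.
Proof.
move=> cX cw; have [X0|/set0P X0] := eqVneq X set0.
  by exists (fun=> 0); [exact: continuous_fct_cst|rewrite X0].
have [x1 _ x1m] := compact_EVT_max X0 cX cw.
have [x2 _ x2m] := compact_EVT_min X0 cX cw.
have clX : closed X by apply: compact_closed => //; exact: norm_hausdorff.
have M0 : 0 < 1 + `|w x1| + `|w x2| by rewrite -addrA ltr_pwDl// addr_ge0.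
have [|h [hw ch _]] := continuous_bounded_extension pseudometric_normal clX M0 cw.
  move=> x Xx; have xX : x \in X by rewrite inE.
  have := x1m x xX; have := x2m x xX.
  have := ler_norm (w x1); have := ler_norm (- w x2); rewrite normrN => ? ? ? ?.
  have := normr_ge0 (w x1); have := normr_ge0 (w x2) => ? ?.
  by rewrite ler_norml; apply/andP; split; lra.
by exists h => // x Xx; apply: hw; rewrite inE.
Qed.

End row_vector_topology.

(** * Measures representing positive functionals on polynomials *)

Section moment_functional.
Context {R : realType} {N : nat} {T : normedModType R}.
Variables (phi : T -> 'rV[R]_N) (K : set T) (l : mpoly N R -> R).
Hypothesis cphi : continuous phi.
Hypothesis cK : compact K.
Hypothesis lD : forall p q, l (p + q) = l p + l q.
Hypothesis lZ : forall a p, l (a *: p) = a * l p.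
Hypothesis l_ge0 : forall p, (forall z, K z -> 0 <= peval p (phi z)) -> 0 <= l p.
Hypothesis dense : forall (h : T -> R) (e : R), continuous h -> 0 < e ->
  exists p, forall z, K z -> `|peval p (phi z) - h z| <= e.
Implicit Types (h f g : T -> R).

Let lN p : l (- p) = - l p. Proof. by rewrite -scaleN1r lZ mulN1r. Qed.

Let lC a : l (mpolyC N a) = a * l 1.
Proof. by rewrite -lZ -mul_mpolyC mulr1. Qed.

Let l_le p q : (forall z, K z -> peval p (phi z) <= peval q (phi z)) -> l p <= l q.
Proof.
move=> pq; rewrite -subr_ge0 -lN -lD; apply: l_ge0 => z Kz.
by rewrite pevalB subr_ge0 pq.
Qed.

Let l1_ge0 : 0 <= l 1.
Proof. by apply: l_ge0 => z _; rewrite peval1. Qed.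

Let above h : set R := [set l p | p in [set p | forall z, K z -> h z <= peval p (phi z)]].

(** The infimum over dominating polynomials extends [l] without choosing approximating sequences. *)
Let ext h : R := inf (above h).

Let above_near h p e : (forall z, K z -> `|peval p (phi z) - h z| <= e) ->
  above h (l p + e * l 1) /\ lbound (above h) (l p - e * l 1).
Proof.
move=> ph; split.
  exists (p + mpolyC N e); last by rewrite lD lC.
  by move=> z /ph; rewrite pevalD pevalC ler_norml => /andP[+ _]; lra.
move=> _ [q /= hq <-]; rewrite lerBlDr -lC -lD; apply: l_le => z Kz.
have := hq z Kz; have := ph z Kz; rewrite pevalD pevalC ler_norml => /andP[_ +]; lra.
Qed.

(** Linearity of [ext] follows by letting [e] tend to 0, and [e = 0] shows that [ext] agrees with
    [l] on polynomials. *)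
Let ext_near h p e : (forall z, K z -> `|peval p (phi z) - h z| <= e) ->
  `|ext h - l p| <= e * l 1.
Proof.
move=> /above_near[ab lb]; rewrite ler_norml; apply/andP; split.
  have : l p - e * l 1 <= ext h by apply: lb_le_inf => //; exists (l p + e * l 1).
  lra.
have : ext h <= l p + e * l 1 by apply: ge_inf => //; exists (l p - e * l 1).
lra.
Qed.

Let extD f g : continuous f -> continuous g -> ext (fun x => f x + g x) = ext f + ext g.
Proof.
move=> cf cg; apply/eqP; rewrite -subr_eq0; apply/eqP.
apply: (@eq0_norm_le_eps _ _ (4 * l 1)) => e e0.
have [p pf] := dense cf e0; have [q qg] := dense cg e0.
have := ext_near pf; have := ext_near qg.
have : `|ext (fun x => f x + g x) - l (p + q)| <= (e + e) * l 1.
  apply: ext_near => z Kz; rewrite pevalD opprD addrACA.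
  by rewrite (le_trans (ler_normD _ _))// lerD ?pf ?qg.
rewrite lD !ler_norml => /andP[a1 a2] /andP[b1 b2] /andP[c1 c2].
by apply/andP; split; lra.
Qed.

Let extZ a f : continuous f -> ext (fun x => a * f x) = a * ext f.
Proof.
move=> cf; apply/eqP; rewrite -subr_eq0; apply/eqP.
apply: (@eq0_norm_le_eps _ _ (2 * `|a| * l 1)) => e e0.
have [p pf] := dense cf e0.
have h1 := ext_near pf.
have h2 : `|ext (fun x => a * f x) - l (a *: p)| <= (`|a| * e) * l 1.
  by apply: ext_near => z Kz; rewrite pevalZ -mulrBr normrM ler_wpM2l// pf.
rewrite lZ in h2.
rewrite (_ : _ - _ = (ext (fun x => a * f x) - a * l p) - a * (ext f - l p));
  last by ring.
rewrite (le_trans (ler_normB _ _))// normrM.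
have : `|a| * `|ext f - l p| <= `|a| * (e * l 1) by rewrite ler_wpM2l.
lra.
Qed.

Let ext_ge0 f : continuous f -> (forall z, K z -> 0 <= f z) -> 0 <= ext f.
Proof.
move=> cf f0; have [p pf] := dense cf ltr01.
have [ab _] := above_near pf.
apply: lb_le_inf; first by eexists; exact: ab.
by move=> _ [q /= qf <-]; apply: l_ge0 => z Kz; rewrite (le_trans (f0 z Kz))// qf.
Qed.

(** [phi] is the identity for measures on [X]. For measures on [X * U] it is the concatenation of
    rows, since these measures live on pairs and the polynomials on rows of length [n + m]. *)
Lemma moment_functional_measure :
  exists mu : {finite_measure set (borel T) -> \bar R}, mu (~` K) = 0%E /\
    forall p, \int[mu]_(z in K) peval p (phi z) = l p.
Proof.
have [mu [muK muE]] := riesz_representation cK extD extZ ext_ge0.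
exists mu; split=> // p; rewrite muE.
  apply/eqP; rewrite -subr_eq0 -normr_le0 -[leRHS](mul0r (l 1)).
  by apply: ext_near => z Kz; rewrite subrr normr0.
move=> z; apply: (@continuous_comp _ _ _ phi (peval p)); first exact: cphi.
exact: continuous_peval.
Qed.

End moment_functional.

Section polynomial_density.
Context {R : realType}.

Lemma polynomial_dense_rV n (X : set 'rV[R]_n) (h : 'rV[R]_n -> R) (e : R) :
  compact X -> continuous h -> 0 < e ->
  exists p, forall x, X x -> `|peval p x - h x| <= e.
Proof.
move=> cX ch e0; have [c c0 Xc] := @compact_sub_box R _ n id X cX (fun x => @cvg_id _ _).
by have [p pP] := weierstrass c0 ch e0; exists p => x /Xc; exact: pP.
Qed.

Lemma polynomial_dense_pair n m (K : set ('rV[R]_n * 'rV[R]_m)) (h : 'rV[R]_n *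
  'rV[R]_m -> R)
    (e : R) : compact K -> continuous h -> 0 < e ->
  exists p, forall z, K z -> `|peval p (row_mx z.1 z.2) - h z| <= e.
Proof.
move=> cK ch e0; have [c c0 Kc] := compact_sub_box cK (@continuous_row_mx _ n m).
pose h' (w : 'rV[R]_(n + m)) := h (lsubmx w, rsubmx w).
have ch' : continuous h'.
  move=> w; apply: (@continuous_comp _ _ _ (fun w : 'rV[R]_(n + m) => (lsubmx w, rsubmx
    w)) h).
    exact: (cvg_pair (@continuous_lsubmx R n m w) (@continuous_rsubmx R n m w)).
  exact: ch.
have [p pP] := weierstrass c0 ch' e0; exists p => -[x u] /Kc/pP /=.
by rewrite /h' row_mxKl row_mxKr.
Qed.

End polynomial_density.

(** * Moments and certificates *)

Section degree.
Context {R : realType} {n : nat}.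
Implicit Types (p q g : mpoly n R) (r s k : nat).

Lemma deg_le_trans p r s : deg_le p r -> (r <= s)%N -> deg_le p s.
Proof. by rewrite /deg_le => pr rs; rewrite (leq_trans pr). Qed.

Lemma deg_leD p q r : deg_le p r -> deg_le q r -> deg_le (p + q) r.
Proof.
by rewrite /deg_le => pr qr; rewrite (leq_trans (msizeD_le _ _))// geq_max pr qr.
Qed.

Lemma deg_leZ (a : R) p r : deg_le p r -> deg_le (a *: p) r.
Proof. by rewrite /deg_le => pr; rewrite (leq_trans (msizeZ_le _ _)). Qed.

Lemma deg_leC (a : R) r : deg_le (mpolyC n a) r.
Proof. by rewrite /deg_le msizeC; case: (a != 0). Qed.

Lemma deg_le1 r : deg_le (1 : mpoly n R) r.
Proof. by rewrite -mpolyC1 deg_leC. Qed.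

Lemma deg_leM p q r s : deg_le p r -> deg_le q s -> deg_le (p * q) (r + s).
Proof.
rewrite /deg_le; have [->|p0] := eqVneq p 0; first by rewrite mul0r msize0.
have [->|q0] := eqVneq q 0; first by rewrite mulr0 msize0.
rewrite msizeM//; move: (mmeasure _ p) (mmeasure _ q) => a b; lia.
Qed.

Lemma deg_leX p r k : deg_le p r -> deg_le (p ^+ k) (r * k).
Proof.
move=> pr; elim: k => [|k IH]; first by rewrite expr0 deg_le1.
by rewrite exprS mulnS; exact: deg_leM.
Qed.

Lemma deg_le_sum I (s : seq I) (P : pred I) (F : I -> mpoly n R) r :
  (forall i, P i -> deg_le (F i) r) -> deg_le (\sum_(i <- s | P i) F i) r.
Proof.
move=> H; elim/big_ind: _ => [|p q|//]; last exact: deg_leD.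
by rewrite -mpolyC0 deg_leC.
Qed.

(** The degree of [g] is at most [2 * half_deg g]; [half_deg g <= k] keeps the subtraction from
    truncating. *)
Lemma deg_le_localizing g p k : (half_deg g <= k)%N -> deg_le p (k - half_deg g) ->
  deg_le (g * p ^+ 2) (2 * k).
Proof.
move=> gk pk; have gd : deg_le g (msize g).-1 by rewrite /deg_le leqSpred.
apply: (deg_le_trans (deg_leM gd (deg_leX 2 pk))).
move: gk; rewrite /half_deg; move: (mmeasure _ g).-1 => d dk.
have : (d <= 2 * uphalf d)%N.
  by rewrite uphalf_half mul2n doubleD -{1}(odd_double_half d) leq_add2r -addnn leq_addr.
by move: (uphalf d) dk => h; lia.
Qed.

End degree.

Lemma deg_le_comp_var (R : realType) n N (f : 'I_n -> 'I_N) (p : mpoly n R) r :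
  deg_le p r -> deg_le (comp_mpoly [tuple mpolyX R (mnm1 (f i)) | i < n] p) r.
Proof.
move=> pr; rewrite comp_mpolyEX big_seq; apply: deg_le_sum => a ap.
apply: deg_leZ; rewrite comp_mpolyX.
have X1 i : deg_le (mpolyX R (mnm1 (f i))) 1 by rewrite /deg_le msizeX mdeg1.
apply: (@deg_le_trans _ _ _ (mdeg a)); last first.
  by rewrite -ltnS (leq_trans (msize_mdeg_lt ap)).
rewrite mdegE; elim/big_ind2: _ => [|p1 r1 p2 r2|i _]; first exact: deg_le1.
  exact: deg_leM.
by rewrite tnth_mktuple; have := deg_leX (a i) (X1 i); rewrite mul1n.
Qed.

Section riesz_functional.
Context {R : realType} {N k : nat}.
Implicit Types (y : @moments R N k) (p q g : mpoly N R).

Lemma rieszD y p q : riesz y (p + q) = riesz y p + riesz y q.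
Proof.
by rewrite /riesz -big_split; apply: eq_bigr => a _; rewrite mcoeffD mulrDl.
Qed.

Lemma rieszZ y (c : R) p : riesz y (c *: p) = c * riesz y p.
Proof.
by rewrite /riesz mulr_sumr; apply: eq_bigr => a _; rewrite mcoeffZ mulrA.
Qed.

Lemma riesz_bigsum y I (s : seq I) (F : I -> mpoly N R) :
  riesz y (\sum_(i <- s) F i) = \sum_(i <- s) riesz y (F i).
Proof.
elim: s => [|i s IH]; last by rewrite !big_cons rieszD IH.
by rewrite !big_nil -[0](scale0r (0 : mpoly N R)) rieszZ mul0r.
Qed.

(** The entries are the values of [l] on monomials; [riesz] ignores coefficients beyond degree
    [2 * k], hence the restriction on [p]. *)
Lemma moments_of_linear (l : mpoly N R -> R) :
  (forall p q, l (p + q) = l p + l q) -> (forall c p, l (c *: p) = c * l p) ->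
  exists y : @moments R N k, forall p, deg_le p (2 * k) -> riesz y p = l p.
Proof.
move=> lD lZ; exists [ffun a => l (mpolyX R (bmnm a))] => p pk.
have l_sum I (s : seq I) (F : I -> mpoly N R) : l (\sum_(i <- s) F i) = \sum_(i <- s) l
  (F i).
  elim: s => [|i s IH]; last by rewrite !big_cons lD IH.
  by rewrite !big_nil -[0](scale0r (0 : mpoly N R)) lZ mul0r.
rewrite [in RHS](mpolywE pk) l_sum; apply: eq_bigr => a _.
by rewrite ffunE lZ.
Qed.

Lemma mpoly_basis r p : deg_le p r ->
  p = \sum_(i < #|{: bmultinom N r.+1}|) mcoeff (bmnm (enum_val i)) p *: basis_mono i.
Proof.
move=> pr; rewrite {1}(mpolywE pr) (reindex (fun i : 'I_#|{: bmultinom N r.+1}| =>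
  enum_val i)).
  exact: eq_bigr.
by exists enum_rank => a _; rewrite ?enum_valK ?enum_rankK.
Qed.

Lemma localizing_form g y r (c : 'rV[R]_#|{: bmultinom N r.+1}|) :
  (c *m localizing_mx g y r *m c^T) ord0 ord0 =
  riesz y (g * (\sum_i c ord0 i *: basis_mono i) ^+ 2).
Proof.
rewrite expr2 mulr_suml mulr_sumr riesz_bigsum mxE.
under eq_bigr => j _ do rewrite mxE mulr_suml.
rewrite exchange_big/=; apply: eq_bigr => i _.
rewrite mulr_sumr mulr_sumr riesz_bigsum; apply: eq_bigr => j _.
have -> : g * (c ord0 i *: basis_mono i * (c ord0 j *: basis_mono j)) =
    (c ord0 i * c ord0 j) *: (g * (basis_mono i * basis_mono j)).
  by rewrite -!scalerAl -!scalerAr scalerA.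
by rewrite rieszZ !mxE; ring.
Qed.

(** Replaces matrices by functionals on polynomials, in which the rest of the argument is carried
    out. *)
Lemma psd_localizingP g y r : psd (localizing_mx g y r) <->
  (forall p, deg_le p r -> 0 <= riesz y (g * p ^+ 2)).
Proof.
split=> [[_ H] p pr|H].
  rewrite (mpoly_basis pr).
  have := H (\row_i mcoeff (bmnm (enum_val i)) p); rewrite localizing_form.
  by under eq_bigr do rewrite mxE.
split; first by apply/matrixP => i j; rewrite !mxE [basis_mono j * _]mulrC.
move=> c; rewrite localizing_form; apply: H; apply: deg_le_sum => i _.
apply: deg_leZ; rewrite /deg_le msizeX; exact: bmdeg.
Qed.

Lemma psd_momentP y r : psd (moment_mx y r) <->
  (forall p, deg_le p r -> 0 <= riesz y (p ^+ 2)).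
Proof.
have -> : moment_mx y r = localizing_mx 1 y r by apply/matrixP => i j; rewrite !mxE mul1r.
by rewrite psd_localizingP; split=> H p /H; rewrite mul1r.
Qed.

End riesz_functional.

Section is_sos_closure.
Context {R : realType} {N : nat}.
Implicit Types (p q h : mpoly N R) (r s : nat).

Lemma is_sos_mono r s q : (r <= s)%N -> is_sos r q -> is_sos s q.
Proof.
move=> rs [t tr ->]; exists t => //; apply: sub_all tr => p pr.
exact: deg_le_trans pr rs.
Qed.

Lemma is_sosD r p q : is_sos r p -> is_sos r q -> is_sos r (p + q).
Proof. by move=> [s sr ->] [t tr ->]; exists (s ++ t);
  rewrite ?all_cat ?sr// big_cat. Qed.

Lemma is_sosX2M r d h q : deg_le h d -> is_sos r q -> is_sos (r + d) (h ^+ 2 * q).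
Proof.
move=> hd [s sr ->]; exists [seq h * p | p <- s].
  rewrite all_map; apply: sub_all sr => p pr /=.
  by rewrite addnC; exact: deg_leM.
by rewrite big_map mulr_sumr; apply: eq_bigr => p _; rewrite exprMn.
Qed.

Lemma is_sos0 r : is_sos r (0 : mpoly N R).
Proof. by exists [::]; rewrite // big_nil. Qed.

Lemma is_sos1 r : is_sos r (1 : mpoly N R).
Proof. by exists [:: 1]; rewrite ?big_seq1 ?expr1n//= deg_le1. Qed.

Lemma peval_is_sos_ge0 r q x : is_sos r q -> 0 <= peval q x.
Proof.
by move=> [s _ ->]; rewrite peval_bigsum sumr_ge0// => p _; rewrite pevalXn sqr_ge0.
Qed.

Definition is_linear (l : mpoly N R -> R) : Prop :=
  (forall p q, l (p + q) = l p + l q) /\ (forall (c : R) p, l (c *: p) = c * l p).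

Lemma is_linear_sum l I (s : seq I) (F : I -> mpoly N R) : is_linear l ->
  l (\sum_(i <- s) F i) = \sum_(i <- s) l (F i).
Proof.
move=> [lD lZ]; elim: s => [|i s IH]; last by rewrite !big_cons lD IH.
by rewrite !big_nil -[0](scale0r (0 : mpoly N R)) lZ mul0r.
Qed.

Lemma is_linearC l (c : R) : is_linear l -> l (mpolyC N c) = c * l 1.
Proof. by move=> [_ lZ]; rewrite -lZ -mul_mpolyC mulr1. Qed.

Lemma is_linearN l p : is_linear l -> l (- p) = - l p.
Proof. by move=> [_ lZ]; rewrite -scaleN1r lZ mulN1r. Qed.

Lemma is_linear_riesz k (y : @moments R N k) : is_linear (riesz y).
Proof. by split=> *; [exact: rieszD|exact: rieszZ]. Qed.

Lemma is_sos_functional_ge0 l r g q : is_linear l ->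
  (forall p, deg_le p r -> 0 <= l (g * p ^+ 2)) -> is_sos r q -> 0 <= l (q * g).
Proof.
move=> ll lp [s + ->]; rewrite mulr_suml is_linear_sum// => /allP sr.
by rewrite big_seq sumr_ge0// => p /sr; rewrite mulrC; exact: lp.
Qed.

End is_sos_closure.

Section certificates.
Context {R : realType} {n m nX nU : nat}.
Variables (gX : 'I_nX -> mpoly n R) (gU : 'I_nU -> mpoly m R).
Local Notation X := (semialg gX).
Local Notation U := (semialg gU).

Lemma half_deg_minX i : (half_deg (gX i) <= min_order gX gU)%N.
Proof. by rewrite leq_max (leq_bigmax i). Qed.

Lemma half_deg_minU i : (half_deg (gU i) <= min_order gX gU)%N.
Proof. by rewrite leq_max (leq_bigmax i) orbT. Qed.

Lemma sos_cert_x_mono k k' p : (k <= k')%N -> sos_cert_x gX k p -> sos_cert_x gX k' p.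
Proof.
move=> kk' [p0 [pX [s0 sX ->]]]; exists p0, pX; split=> //.
  exact: is_sos_mono s0.
by move=> i; apply: is_sos_mono (sX i); rewrite leq_sub2r.
Qed.

Lemma sos_cert_xu_mono k k' q : (k <= k')%N ->
  sos_cert_xu gX gU k q -> sos_cert_xu gX gU k' q.
Proof.
move=> kk' [q0 [qX [rU [s0 sX sU ->]]]]; exists q0, qX, rU; split=> //.
- exact: is_sos_mono s0.
- by move=> i; apply: is_sos_mono (sX i); rewrite leq_sub2r.
- by move=> i; apply: is_sos_mono (sU i); rewrite leq_sub2r.
Qed.

Lemma peval_cert_x_ge0 k p x : sos_cert_x gX k p -> X x -> 0 <= peval p x.
Proof.
move=> [p0 [pX [s0 sX ->]]] Xx; rewrite pevalD peval_bigsum addr_ge0//.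
  exact: peval_is_sos_ge0 s0.
apply: sumr_ge0 => i _; rewrite pevalM mulr_ge0//; exact: peval_is_sos_ge0 (sX i).
Qed.

Lemma peval_cert_xu_ge0 k q x u : sos_cert_xu gX gU k q -> X x -> U u ->
  0 <= peval q (row_mx x u).
Proof.
move=> [q0 [qX [rU [s0 sX sU ->]]]] Xx Uu; rewrite !pevalD !peval_bigsum.
apply: addr_ge0; first apply: addr_ge0; first exact: peval_is_sos_ge0 s0.
- apply: sumr_ge0 => i _; rewrite pevalM peval_lift_x mulr_ge0//.
  exact: peval_is_sos_ge0 (sX i).
- apply: sumr_ge0 => i _; rewrite pevalM peval_lift_u mulr_ge0//.
  exact: peval_is_sos_ge0 (sU i).
Qed.

Lemma sos_cert_x_module : quadratic_module (fun q => exists k, sos_cert_x gX k q).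
Proof.
split.
- exists 0%N, 1, (fun=> 0); split; [exact: is_sos1|by move=> i; exact: is_sos0|].
  by rewrite big1 ?addr0// => i _; rewrite mul0r.
- move=> p q [k kp] [l lq]; exists (maxn k l).
  have := sos_cert_x_mono (leq_maxl k l) kp; have := sos_cert_x_mono (leq_maxr k l) lq.
  move=> [q0 [qX [t0 tX ->]]] [p0 [pX [s0 sX ->]]].
  exists (p0 + q0), (fun i => pX i + qX i); split; first exact: is_sosD.
    by move=> i; exact: is_sosD.
  by under [in RHS]eq_bigr do rewrite mulrDl; rewrite big_split/= addrACA.
- move=> h q [k [q0 [qX [t0 tX ->]]]].
  (* Multiplying by [h ^+ 2] raises the order by [d]; the extra [b] absorbs the truncation of
     [k - half_deg (gX i)] at 0 for small [k]. *)
  pose d := msize h; pose b := \max_i half_deg (gX i).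
  have hd : deg_le h d by rewrite /deg_le leqnSn.
  exists (k + d + b)%N, (h ^+ 2 * q0), (fun i => h ^+ 2 * qX i); split.
  + by apply: is_sos_mono (is_sosX2M hd t0); rewrite leq_addr.
  + move=> i; apply: is_sos_mono (is_sosX2M hd (tX i)).
    by have : (half_deg (gX i) <= b)%N := leq_bigmax i; lia.
  + rewrite mulrDr mulr_sumr; congr (_ + _).
    by apply: eq_bigr => i _; rewrite mulrA.
Qed.

Lemma sos_cert_xu_module : quadratic_module (fun q => exists k, sos_cert_xu gX gU k q).
Proof.
split.
- exists 0%N, 1, (fun=> 0), (fun=> 0); split; [exact: is_sos1|by move=> i;
  exact: is_sos0|by move=> i; exact: is_sos0|].
  by rewrite !big1 ?addr0// => i _; rewrite mul0r.
- move=> p q [k kp] [l lq]; exists (maxn k l).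
  have := sos_cert_xu_mono (leq_maxl k l) kp; have := sos_cert_xu_mono (leq_maxr k l) lq.
  move=> [q0 [qX [qU [t0 tX tU ->]]]] [p0 [pX [pU [s0 sX sU ->]]]].
  exists (p0 + q0), (fun i => pX i + qX i), (fun i => pU i + qU i); split.
  + exact: is_sosD.
  + by move=> i; exact: is_sosD.
  + by move=> i; exact: is_sosD.
  + under [X in _ = _ + X + _]eq_bigr do rewrite mulrDl.
    under [X in _ = _ + _ + X]eq_bigr do rewrite mulrDl.
    by rewrite !big_split/=; ring.
- move=> h q [k [q0 [qX [qU [t0 tX tU ->]]]]].
  pose d := msize h; pose b := min_order gX gU.
  have hd : deg_le h d by rewrite /deg_le leqnSn.
  exists (k + d + b)%N, (h ^+ 2 * q0), (fun i => h ^+ 2 * qX i), (fun i => h ^+ 2 * qU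
    i); split.
  + by apply: is_sos_mono (is_sosX2M hd t0); rewrite leq_addr.
  + move=> i; apply: is_sos_mono (is_sosX2M hd (tX i)).
    by have := half_deg_minX i; rewrite -/b; lia.
  + move=> i; apply: is_sos_mono (is_sosX2M hd (tU i)).
    by have := half_deg_minU i; rewrite -/b; lia.
  + rewrite !mulrDr !mulr_sumr; congr (_ + _ + _).
      by apply: eq_bigr => i _; rewrite mulrA.
    by apply: eq_bigr => i _; rewrite mulrA.
Qed.

(** Any order [k] will do, because the multiplier 1 is allowed even when [k - half_deg (gX i)]
    truncates to 0. *)
Lemma sos_cert_x_gX i k : sos_cert_x gX k (gX i).
Proof.
exists 0, (fun j => if j == i then 1 else 0); split; first exact: is_sos0.
  by move=> j; case: eqP => _; [exact: is_sos1|exact: is_sos0].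
rewrite add0r (bigD1 i)//= eqxx mul1r big1 ?addr0// => j /negPf ->.
by rewrite mul0r.
Qed.

Lemma sos_cert_xu_gX i k : sos_cert_xu gX gU k (lift_x (gX i)).
Proof.
exists 0, (fun j => if j == i then 1 else 0), (fun=> 0); split; first exact: is_sos0.
- by move=> j; case: eqP => _; [exact: is_sos1|exact: is_sos0].
- by move=> j; exact: is_sos0.
- rewrite add0r (bigD1 i)//= eqxx mul1r !big1 ?addr0// => j.
    by rewrite mul0r.
  by move=> /negPf ->; rewrite mul0r.
Qed.

Lemma sos_cert_xu_gU i k : sos_cert_xu gX gU k (lift_u (gU i)).
Proof.
exists 0, (fun=> 0), (fun j => if j == i then 1 else 0); split; first exact: is_sos0.
- by move=> j; exact: is_sos0.
- by move=> j; case: eqP => _; [exact: is_sos1|exact: is_sos0].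
- rewrite add0r [X in X + _]big1 ?add0r => [|j _]; last by rewrite mul0r.
  rewrite (bigD1 i)//= eqxx mul1r !big1 ?addr0// => j.
  by move=> /negPf ->; rewrite mul0r.
Qed.

Lemma quadratic_module_C N (M : mpoly N R -> Prop) (a : R) :
  quadratic_module M -> 0 <= a -> M (mpolyC N a).
Proof.
move=> QM a0; rewrite -[mpolyC _ _]mulr1; apply: (quadratic_module_sos QM).
  exact: sosC.
by case: QM.
Qed.

Lemma putinar_x (r : R) p : (exists i, gX i = ball_poly n r) ->
  (forall x, X x -> 0 < peval p x) -> exists k, sos_cert_x gX k p.
Proof.
move=> [i gi] p0; have QM := sos_cert_x_module.
(* [r] may be zero or negative; enlarging the ball adds the nonnegative constant [c ^+ 2 - r ^+ 2]
   to its polynomial. *)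
pose c := `|r| + 1; have c0 : 0 < c by rewrite ltr_wpDl.
apply: (@putinar _ _ _ gX _ c _ QM c0).
- rewrite (_ : ball_poly n c = ball_poly n r + mpolyC n (c ^+ 2 - r ^+ 2)).
    case: (QM) => _ MD _; apply: MD; first by exists 0%N; rewrite -gi;
      exact: sos_cert_x_gX.
    apply: (quadratic_module_C QM); rewrite /c subr_ge0 -[r ^+ 2]real_normK ?num_real//.
    by rewrite ler_sqr ?nnegrE ?addr_ge0// lerDl.
  by rewrite /ball_poly raddfB/=; ring.
- by move=> j; exists 0%N; exact: sos_cert_x_gX.
- by move=> x _ Xx; exact: p0.
Qed.

(** The two balls combine into one: [c^2 - |x|^2 - |u|^2] is the sum of both ball polynomials and of
    [c^2 - r^2 - s^2], which is nonnegative for [c = |r| + |s| + 1]. *)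
Lemma putinar_xu (r s : R) q : (exists i, gX i = ball_poly n r) ->
  (exists i, gU i = ball_poly m s) ->
  (forall x u, X x -> U u -> 0 < peval q (row_mx x u)) ->
  exists k, sos_cert_xu gX gU k q.
Proof.
move=> [i gi] [j gj] q0; have QM := sos_cert_xu_module.
pose c := `|r| + `|s| + 1; have c0 : 0 < c by rewrite ltr_wpDl// addr_ge0.
pose g (l : 'I_nX + 'I_nU) := match l with inl l => lift_x (gX l) | inr l => lift_u (gU
  l) end.
apply: (@putinar _ _ _ g _ c _ QM c0).
- rewrite (_ : ball_poly (n + m) c = lift_x (gX i) + lift_u (gU j)
     + mpolyC (n + m) (c ^+ 2 - r ^+ 2 - s ^+ 2)).
    case: (QM) => _ MD _; apply: (MD); first apply: (MD).
    + by exists 0%N; exact: sos_cert_xu_gX.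
    + by exists 0%N; exact: sos_cert_xu_gU.
    + apply: (quadratic_module_C QM); rewrite /c.
      rewrite -[r ^+ 2]real_normK ?num_real// -[s ^+ 2]real_normK ?num_real//.
      by have := normr_ge0 r; have := normr_ge0 s; nra.
  rewrite gi gj /ball_poly /lift_x /lift_u !rmorphB/= !comp_mpolyC big_split_ord/=.
  have hx (k : 'I_n) : comp_mpoly [tuple mpolyX R (mnm1 (lshift m i0)) | i0 < n]
    (mpolyX R (mnm1 k) ^+ 2)
     = mpolyX R (mnm1 (lshift m k)) ^+ 2.
    rewrite rmorphXn/= comp_mpolyX (bigD1 k)//= big1 => [|l /negPf lk].
      by rewrite mnm1E eqxx expr1 mulr1 tnth_mktuple.
    by rewrite mnm1E eq_sym lk expr0.
  have hu (k : 'I_m) : comp_mpoly [tuple mpolyX R (mnm1 (rshift n i0)) | i0 < m]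
    (mpolyX R (mnm1 k) ^+ 2)
     = mpolyX R (mnm1 (rshift n k)) ^+ 2.
    rewrite rmorphXn/= comp_mpolyX (bigD1 k)//= big1 => [|l /negPf lk].
      by rewrite mnm1E eqxx expr1 mulr1 tnth_mktuple.
    by rewrite mnm1E eq_sym lk expr0.
  have -> : comp_mpoly [tuple mpolyX R (mnm1 (lshift m i0)) | i0 < n] (\sum_(k < n)
    mpolyX R (mnm1 k) ^+ 2)
      = \sum_(k < n) mpolyX R (mnm1 (lshift m k)) ^+ 2.
    by rewrite raddf_sum; apply: eq_bigr => k _; exact: hx.
  have -> : comp_mpoly [tuple mpolyX R (mnm1 (rshift n i0)) | i0 < m] (\sum_(k < m)
    mpolyX R (mnm1 k) ^+ 2)
      = \sum_(k < m) mpolyX R (mnm1 (rshift n k)) ^+ 2.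
    by rewrite raddf_sum; apply: eq_bigr => k _; exact: hu.
  by ring.
- by case=> l; exists 0%N; [exact: sos_cert_xu_gX|exact: sos_cert_xu_gU].
- move=> w _ wg; rewrite -[w]hsubmxK; apply: q0 => l.
  + by have := wg (inl l); rewrite /= -[w]hsubmxK peval_lift_x row_mxKl.
  + by have := wg (inr l); rewrite /= -[w]hsubmxK peval_lift_u row_mxKr.
Qed.

End certificates.

(** * A common interface for discrete and continuous time *)

Section regular_settings.
Context {R : realType} {n m : nat}.
Implicit Types (S : setting R n m) (f : n.-tuple (mpoly (n + m) R)).

(* What the two settings have in common: [kappa] is [1 - alpha] or [beta]. *)
Record regular_setting S (kappa : R) : Prop := RegularSetting {
  regular_kappa : 0 < kappa ;
  regular_peval : forall p x u,
    peval (Lpoly S p) (row_mx x u) = Lop S (peval p) x u ;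
  regular_poly : forall p, Vspace S (peval p) ;
  regular_addC : forall p c,
    Lpoly S (p + mpolyC n c) = Lpoly S p + mpolyC (n + m) (kappa * c) ;
  regular_one : Lpoly S 1 = mpolyC (n + m) kappa ;
  regular_continuous : forall v, Vspace S v -> continuous v ;
  regular_continuousL : forall v, Vspace S v ->
    continuous (fun z : 'rV[R]_n * 'rV[R]_m => Lop S v z.1 z.2) ;
  regular_approx : forall (X : set 'rV[R]_n) (U : set 'rV[R]_m) v e,
    compact X -> compact U -> Vspace S v -> 0 < e ->
    exists p, forall x, X x -> `|peval p x - v x| <= e /\
      forall u, U u -> `|Lop S (peval p) x u - Lop S v x u| <= e }.

Lemma lift_xC (c : R) : lift_x (mpolyC n c) = mpolyC (n + m) c.
Proof. by rewrite /lift_x comp_mpolyC. Qed.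

Lemma lift_x1 : lift_x (1 : mpoly n R) = 1 :> mpoly (n + m) R.
Proof. by rewrite /lift_x comp_mpoly1. Qed.

Lemma lift_xD p q : lift_x (p + q) = lift_x p + lift_x q :> mpoly (n + m) R.
Proof. by rewrite /lift_x comp_mpolyD. Qed.

Lemma continuous_peval_pair (q : mpoly (n + m) R) :
  continuous (fun z : 'rV[R]_n * 'rV[R]_m => peval q (row_mx z.1 z.2)).
Proof.
move=> z; apply: (@continuous_comp _ _ _ (fun z : 'rV[R]_n * 'rV[R]_m => row_mx z.1
  z.2) (peval q)).
  exact: continuous_row_mx.
exact: continuous_peval.
Qed.

Lemma continuous_vfield f :
  continuous (fun z : 'rV[R]_n * 'rV[R]_m => vfield f z.1 z.2).
Proof.
apply: continuous_rV => i.
rewrite (_ : (fun z => _) = (fun z : 'rV[R]_n * 'rV[R]_m => peval (tnth f i) (row_mx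
  z.1 z.2))).
  exact: continuous_peval_pair.
by apply/funext => z; rewrite mxE.
Qed.

Lemma continuous_fst_comp (v : 'rV[R]_n -> R) : continuous v ->
  continuous (fun z : 'rV[R]_n * 'rV[R]_m => v z.1).
Proof.
move=> cv z; apply: (@continuous_comp _ _ _ fst v); first exact: cvg_fst.
exact: cv.
Qed.

Lemma discrete_regular (alpha : R) f : 0 < alpha < 1 ->
  regular_setting (discrete_setting alpha f) (1 - alpha).
Proof.
move=> /andP[a0 a1]; split.
- by rewrite subr_gt0.
- by move=> p x u; exact: Lpoly_discrete.
- by move=> p; exact: continuous_peval.
- move=> p c /=; rewrite lift_xD comp_mpolyD comp_mpolyC lift_xC scalerDr.
  by rewrite mulrBl mul1r raddfB/= [mpolyC _ (alpha * c)]rmorphM/= mul_mpolyC; ring.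
- by rewrite /= lift_x1 comp_mpoly1 raddfB/= mpolyC1 -mul_mpolyC mulr1.
- by [].
- move=> v cv /=; apply: continuous_fctB; first exact: continuous_fst_comp.
  apply: continuous_fctM; first exact: continuous_fct_cst.
  move=> z; apply: (@continuous_comp _ _ _ (fun z : 'rV[R]_n * 'rV[R]_m => vfield f z.1
    z.2) v).
    exact: continuous_vfield.
  exact: cv.
- move=> X U v e cX cU cv e0 /=.
  (* [L v] evaluates [v] at [f(x, u)], which may leave [X], so [v] is approximated on [X] together
     with this image. *)
  pose Y := [set vfield f z.1 z.2 | z in X `*` U].
  have cY : compact Y.
    apply: (@continuous_compact _ _ (fun z : 'rV[R]_n * 'rV[R]_m => vfield f z.1 z.2)).
      exact/continuous_subspaceT/continuous_vfield.
    exact: compact_setX.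
  have e20 : 0 < e / 2 by rewrite divr_gt0.
  have [p pv] := polynomial_dense_rV (compactU cX cY) cv e20.
  exists p => x Xx; have px : `|peval p x - v x| <= e / 2 by apply: pv; left.
  split; first by rewrite (le_trans px)// ler_pdivrMr// ler_pMr// ler1n.
  move=> u Uu; have py : `|peval p (vfield f x u) - v (vfield f x u)| <= e / 2.
    by apply: pv; right; exists (x, u).
  rewrite (_ : _ - _ = (peval p x - v x) -
    alpha * (peval p (vfield f x u) - v (vfield f x u))); last by ring.
  rewrite (le_trans (ler_normB _ _))// [leRHS]splitr lerD// normrM gtr0_norm//.
  by rewrite (le_trans _ py)// ler_piMl// ltW.
Qed.

Lemma continuous_regular (beta : R) f : 0 < beta ->
  regular_setting (continuous_setting beta f) beta.
Proof.
move=> b0.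
have gradE (p : mpoly n R) x i : grad (peval p) x ord0 i = peval (mderiv i p) x.
  by rewrite mxE; have /@derive_val -> := (diff_peval p x).2 i.
split => //.
- by move=> p x u; exact: Lpoly_continuous.
- move=> p; split=> [x|]; first exact: (diff_peval p x).1.
  apply: continuous_rV => i.
  rewrite (_ : (fun z => _) = peval (mderiv i p)); first exact: continuous_peval.
  by apply/funext => x; exact: gradE.
- move=> p c /=; rewrite lift_xD lift_xC scalerDr rmorphM/= mul_mpolyC.
  rewrite addrAC; congr (_ - _ + _); apply: eq_bigr => i _.
  by rewrite mderivD mderivC addr0.
- rewrite /= lift_x1 big1 ?subr0; first by rewrite -mul_mpolyC mulr1.
  by move=> i _; rewrite -mpolyC1 mderivC /lift_x comp_mpoly0 mul0r.
- by move=> v [dv _] x; apply: differentiable_continuous; exact: dv.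
- move=> v [dv cg] /=.
  have cv : continuous v by move=> x; apply: differentiable_continuous; exact: dv.
  apply: continuous_fctB.
    by apply: continuous_fctM; [exact: continuous_fct_cst|exact: continuous_fst_comp].
  apply: continuous_fct_sum => i; apply: continuous_fctM.
    apply: (@continuous_fst_comp (fun x => grad v x ord0 i)) => x.
    apply: (@continuous_comp _ _ _ (grad v) (fun y => y ord0 i)); first exact: cg.
    exact: coord_continuous.
  move=> z; apply: (@continuous_comp _ _ _ (fun z : 'rV[R]_n * 'rV[R]_m => vfield f z.1
    z.2) (fun y => y ord0 i)).
    exact: continuous_vfield.
  exact: coord_continuous.
- move=> X U v e cX cU [dv cg] e0 /=.
  have cv : continuous v by move=> x; apply: differentiable_continuous; exact: dv.
  have [c c0 Xc] := @compact_sub_box R _ n id X cX (fun x => @cvg_id _ _).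
  have [C C0 fC] := compact_sub_box (compact_setX cX cU) (@continuous_vfield f).
  (* An error [e / K] in [v] and its partial derivatives gives at most [(beta + n C) e / K <= e] in
     [L v]; the summand 1 makes [K >= 1], so that the error in [v] is also at most [e]. *)
  pose K := beta + n%:R * C + 1.
  have K1 : 1 <= K by rewrite lerDr addr_ge0 ?mulr_ge0// ltW.
  have K0 : 0 < K by rewrite (lt_le_trans ltr01).
  have eK0 : 0 < e / K by rewrite divr_gt0.
  have [||p pP] := @weierstrass_C1 R n c c0 v (fun i x => grad v x ord0 i) (e / K) cv _
    _ eK0.
  + move=> i x; apply: (@continuous_comp _ _ _ (grad v) (fun y => y ord0 i));
    first exact: cg.
    exact: coord_continuous.
  + move=> i x; rewrite mxE; apply: DeriveDef => //; exact: diff_derivable.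
  exists p => x Xx; have [px dpx] := pP x (Xc x Xx).
  split; first by rewrite (le_trans px)// ler_pdivrMr// ler_peMr// ltW.
  move=> u Uu.
  rewrite (_ : _ - _ = beta * (peval p x - v x) -
    \sum_(i < n) (peval (mderiv i p) x - grad v x ord0 i) * vfield f x u ord0 i);
      last first.
    under [X in _ = _ - X]eq_bigr do rewrite mulrBl.
    under [X in _ - X - _ = _]eq_bigr do rewrite gradE.
    by rewrite sumrB; ring.
  rewrite (le_trans (ler_normB _ _))//.
  apply: (@le_trans _ _ (beta * (e / K) + n%:R * C * (e / K))); last first.
    rewrite -mulrDl mulrA ler_pdivrMr// mulrC ler_pM2l// /K; lra.
  apply: lerD; first by rewrite normrM gtr0_norm// ler_pM2l.
  rewrite (le_trans (ler_norm_sum _ _ _))//.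
  apply: (@le_trans _ _ (\sum_(i < n) C * (e / K))).
    apply: ler_sum => i _; rewrite normrM mulrC ler_pM//.
    have := fC (x, u) (conj Xx Uu) i; rewrite /= !mxE => h.
    by rewrite ler_norml.
  by rewrite sumr_const card_ord -[leLHS]mulr_natl mulrA.
Qed.

End regular_settings.

(** * Convergence of the hierarchy *)

Lemma ereal_lt_real (R : realType) (x y : \bar R) : (x < y)%E ->
  exists c : R, (x < c%:E)%E /\ (c%:E < y)%E.
Proof.
case: x => [x| |]; case: y => [y| |] //.
- by rewrite lte_fin => xy; exists ((x + y) / 2); rewrite !lte_fin; split; lra.
- by move=> _; exists (x + 1); rewrite lte_fin ltry; split => //; lra.
- by move=> _; exists (y - 1); rewrite lte_fin ltNyr; split => //; lra.
- by move=> _; exists 0; rewrite ltNyr ltry.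
Qed.

Section compact_Rintegral.
Context {R : realType} {T : normedModType R}.
Variables (mu : {measure set (borel T) -> \bar R}) (K : set T).
Hypotheses (cK : compact K) (muK : (mu K < +oo)%E).
Implicit Types f g : T -> R.

Lemma compact_integralE f : continuous f ->
  (\int[mu]_(x in K) (f x)%:E)%E = (\int[mu]_(x in K) f x)%:E.
Proof.
move=> cf; rewrite /Rintegral fineK//; apply: integrable_fin_num.
  exact: compact_measurable_borel.
exact: compact_integrable.
Qed.

Lemma compact_RintegralD f g : continuous f -> continuous g ->
  \int[mu]_(x in K) (f x + g x) = \int[mu]_(x in K) f x + \int[mu]_(x in K) g x.
Proof.
move=> cf cg; rewrite RintegralD//; first exact: compact_measurable_borel.
  exact: compact_integrable.
exact: compact_integrable.
Qed.

Lemma compact_RintegralZ (a : R) f : continuous f ->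
  \int[mu]_(x in K) (a * f x) = a * \int[mu]_(x in K) f x.
Proof.
move=> cf; rewrite RintegralZl//; first exact: compact_measurable_borel.
exact: compact_integrable.
Qed.

Lemma compact_Rintegral_dist f g (e : R) : continuous f -> continuous g ->
  (forall x, K x -> `|f x - g x| <= e) ->
  `|\int[mu]_(x in K) f x - \int[mu]_(x in K) g x| <= e * fine (mu K).
Proof.
move=> cf cg fg; have mK := compact_measurable_borel cK.
have ce (a : R) : continuous (fun _ : T => a) by exact: continuous_fct_cst.
have le h1 h2 : continuous h1 -> continuous h2 -> (forall x, K x -> h1 x <= h2 x) ->
    \int[mu]_(x in K) h1 x <= \int[mu]_(x in K) h2 x.
  by move=> c1 c2 h12; apply: le_Rintegral => //; exact: compact_integrable.
have h1 : \int[mu]_(x in K) f x <= \int[mu]_(x in K) (g x + e).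
  apply: le => //; first exact: continuous_fctD.
  by move=> x /fg; rewrite ler_norml => /andP[_]; lra.
have h2 : \int[mu]_(x in K) g x <= \int[mu]_(x in K) (f x + e).
  apply: le => //; first exact: continuous_fctD.
  by move=> x /fg; rewrite ler_norml => /andP[+ _]; lra.
move: h1 h2; rewrite !compact_RintegralD// !Rintegral_cst// => h1 h2.
by rewrite ler_norml; apply/andP; split; lra.
Qed.

End compact_Rintegral.

Lemma lebesgue_rV_compact (R : realType) n (X : set 'rV[R]_n) : compact X ->
  (lebesgue_rV R n X < +oo)%E.
Proof.
move=> cX; have [c c0 Xc] := @compact_sub_box R _ n id X cX (fun x => @cvg_id _ _).
apply: (@le_lt_trans _ _ (lebesgue_rV R n (box (const_mx (- c)) (const_mx c)))).
  apply: le_measure; rewrite ?inE//;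
    [exact: compact_measurable_borel|exact: measurable_box].
rewrite lebesgue_rV_box ?ltry// => i; rewrite !mxE; lra.
Qed.

(** * Limits along an ultrafilter *)

Section ultralimit.
Context {R : realType} (F : set_system nat).
Hypotheses (UF : UltraFilter F) (Foo : \oo `<=` F).
Let PF : ProperFilter F. Proof. exact: ultra_proper. Qed.

(** Compactness of [[- C, C]] gives a cluster point, and a cluster point of an ultrafilter is a
    limit. *)
Lemma ultra_bounded_cvg (a : nat -> R) (C : R) :
  (\forall k \near \oo, `|a k| <= C) -> exists l : R, a @ F --> l.
Proof.
move=> aC; pose G := a @ F.
have PG : ProperFilter G by exact: fmap_proper_filter.
have [l [_ Gl]] : `[- C, C]%classic `&` cluster G !=set0.
  apply: segment_compact => //; apply: Foo; apply: filterS aC => k /=.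
  by rewrite in_itv/= -ler_norml.
exists l => B nB; have [//|FnB] := in_ultra_setVsetC (a @^-1` B) UF.
have GnB : G (~` B) by [].
by have [x [nBx Bx]] := Gl _ _ GnB nB; case: (nBx Bx).
Qed.

Lemma ultra_functional N (l : nat -> mpoly N R -> R) :
  (forall p, exists C, \forall k \near \oo, `|l k p| <= C) ->
  exists L, forall p, (fun k => l k p) @ F --> (L p : R).
Proof.
move=> lC; have /choice[L LP] : forall p, exists y : R, (fun k => l k p) @ F --> y.
  by move=> p; have [C] := lC p; exact: ultra_bounded_cvg.
by exists L.
Qed.

Lemma ultra_cvg_unique (a b : nat -> R) (x y : R) : (\forall k \near \oo, a k = b k) ->
  a @ F --> x -> b @ F --> y -> x = y.
Proof.
move=> ab ax bY; apply: (@cvg_unique _ (@norm_hausdorff _ R) (a @ F)) => //=.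
by apply: cvg_trans bY; apply: near_eq_cvg; apply: Foo; apply: filterS ab => k.
Qed.

Lemma ultra_cvg_ge (a : nat -> R) (x c : R) : (\forall k \near \oo, c <= a k) ->
  a @ F --> x -> c <= x.
Proof.
move=> ca ax; rewrite -(cvg_lim (@norm_hausdorff _ R) ax); apply: limr_ge.
  by apply: cvgP ax.
by apply: Foo.
Qed.

Lemma ultra_functional_linear N (l : nat -> mpoly N R -> R) (L : mpoly N R -> R) :
  (forall k, is_linear (l k)) -> (forall p, (fun k => l k p) @ F --> L p) ->
  is_linear L.
Proof.
move=> ll lL; split=> [p q|c p].
  apply: (@ultra_cvg_unique (fun k => l k (p + q)) (fun k => l k p + l k q)) => //.
    by near=> k; exact: (ll k).1.
  exact: cvgD.
apply: (@ultra_cvg_unique (fun k => l k (c *: p)) (fun k => c * l k p)) => //.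
  by near=> k; exact: (ll k).2.
by apply: cvgM => //; exact: cvg_cst.
Unshelve. all: by end_near. Qed.

End ultralimit.

Section hierarchy.
Context {R : realType} {n m nX nU : nat}.
Variables (S : setting R n m).
Variables (gX : 'I_nX -> mpoly n R) (gU : 'I_nU -> mpoly m R) (RX RU kappa : R).
Hypotheses (cX : compact (semialg gX)) (cU : compact (semialg gU)).
Hypotheses (ball_X : exists i, gX i = ball_poly n RX)
           (ball_U : exists i, gU i = ball_poly m RU).
Hypothesis RS : regular_setting S kappa.

Local Notation X := (semialg gX).
Local Notation U := (semialg gU).
Local Notation lambda := (lebesgue_rV R n).
Local Notation k0 := (min_order gX gU).

Let kappa0 := regular_kappa RS.
Let lX : (lambda X < +oo)%E. Proof. exact: lebesgue_rV_compact. Qed.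
Let mX : measurable (X : set (borel 'rV[R]_n)). Proof. exact: compact_measurable_borel.
  Qed.
Let cXU : compact (X `*` U). Proof. exact: compact_setX. Qed.
Let Lam (w : 'rV[R]_n -> R) : R := \int[lambda]_(x in X) w x.

Let LamE w : continuous w -> (\int[lambda]_(x in X) (w x)%:E)%E = (Lam w)%:E.
Proof. by move=> cw; rewrite (compact_integralE cX lX cw). Qed.

(** * The sums-of-squares programs *)

Lemma sdp_dual_feasible_dual k v w : sdp_dual_feasible S gX gU k v w ->
  dual_feasible S gX gU (peval v) (peval w).
Proof.
move=> [_ cL cw1 cw]; split.
- exact: regular_poly RS v.
- exact/continuous_subspaceT/continuous_peval.
- by move=> x u Xx Uu; rewrite -(regular_peval RS); exact: peval_cert_xu_ge0 cL Xx Uu.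
- by move=> x Xx; have := peval_cert_x_ge0 cw1 Xx; rewrite !pevalB peval1; lra.
- by move=> x Xx; exact: peval_cert_x_ge0 cw Xx.
Qed.

Lemma dual_value_le_sdp k : (dual_value S gX gU <= sdp_dual_value S gX gU k)%E.
Proof.
apply: le_ereal_inf_tmp => _ [v [w [/sdp_dual_feasible_dual vw ->]]].
by apply: ereal_inf_lbound; exists (peval v), (peval w).
Qed.

Lemma sdp_dual_feasible_mono k k' v w : (k <= k')%N ->
  sdp_dual_feasible S gX gU k v w -> sdp_dual_feasible S gX gU k' v w.
Proof.
move=> kk' [/andP[dv dw] cL cw1 cw].
have kk2 : (2 * k <= 2 * k')%N by rewrite leq_mul2l kk'.
split; first by rewrite (deg_le_trans dv kk2) (deg_le_trans dw kk2).
- exact: sos_cert_xu_mono cL.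
- exact: sos_cert_x_mono cw1.
- exact: sos_cert_x_mono cw.
Qed.

Lemma sdp_dual_value_mono : {homo sdp_dual_value S gX gU : k k' / (k <= k')%N >-> (k'
  <= k)%E}.
Proof.
move=> k k' kk'; apply: le_ereal_inf_tmp => _ [v [w [vw ->]]].
by apply: ereal_inf_lbound; exists v, w; split => //; exact: sdp_dual_feasible_mono vw.
Qed.

Lemma sdp_dual_near v w (e : R) : dual_feasible S gX gU v w -> 0 < e ->
  exists k, (sdp_dual_value S gX gU k <= \int[lambda]_(x in X) (w x)%:E + e%:E)%E.
Proof.
move=> [Vv cw Lv vw w0] e0.
have [h ch wh] := tietze_compact cX cw.
(* The final loss is at most [(5 d + a) * lambda X] with [a = 2 d / kappa]; the summand 1 keeps [M]
   positive when [X] is a null set. *)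
pose M := (5 + 2 / kappa) * fine (lambda X) + 1.
have lX0 : 0 <= fine (lambda X) by exact: fine_ge0.
have k20 : 0 < 2 / kappa by rewrite divr_gt0.
have M0 : 0 < M by rewrite ltr_wpDl// mulr_ge0//; lra.
pose d := e / M; have d0 : 0 < d by rewrite divr_gt0.
have [p pv] := regular_approx RS cX cU Vv d0.
have [q qh] := polynomial_dense_rV cX ch d0.
(* Shifting [p] by [a] raises [L p] by [2 d], hence [L v' >= L v + d > 0]. In [w' - v' - 1] the two
   [a] cancel, and [4 d] outweighs the two errors of size [d]. *)
pose a := 2 * d / kappa.
have aE : a = 2 / kappa * d by rewrite /a mulrAC.
pose v' := p + mpolyC n a; pose w' := q + mpolyC n (4 * d + a).
have [k1 c1] : exists k, sos_cert_xu gX gU k (Lpoly S v').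
  apply: (putinar_xu ball_X ball_U) => x u Xx Uu.
  rewrite (regular_addC RS) pevalD pevalC (regular_peval RS).
  have [_ /(_ u Uu)] := pv x Xx; rewrite ler_norml => /andP[+ _].
  by rewrite /a mulrC divfK ?gt_eqF//; have := Lv x u Xx Uu; lra.
have qb x : X x -> w x - d <= peval q x <= w x + d.
  by move=> Xx; rewrite (wh x Xx); have := qh x Xx; rewrite ler_norml; lra.
have [k2 c2] : exists k, sos_cert_x gX k (w' - v' - 1).
  apply: (putinar_x ball_X) => x Xx; rewrite !pevalB peval1 !pevalD !pevalC.
  have [+ _] := pv x Xx; rewrite ler_norml => /andP[_ ?].
  by have /andP[? _] := qb x Xx; have := vw x Xx; lra.
have a0 : 0 < a by rewrite aE mulr_gt0.
have [k3 c3] : exists k, sos_cert_x gX k w'.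
  apply: (putinar_x ball_X) => x Xx; rewrite pevalD pevalC.
  by have /andP[? _] := qb x Xx; have := w0 x Xx; lra.
pose k := (k1 + k2 + k3 + msize v' + msize w')%N.
have feas : sdp_dual_feasible S gX gU k v' w'.
  split.
  - by rewrite /deg_le /k; apply/andP; split;
    move: (mmeasure _ v') (mmeasure _ w') => b c; lia.
  - by apply: sos_cert_xu_mono c1; rewrite /k -!addnA leq_addr.
  - by apply: sos_cert_x_mono c2; rewrite /k; lia.
  - by apply: sos_cert_x_mono c3; rewrite /k; lia.
exists k; apply: (@le_trans _ _ (\int[lambda]_(x in X) (peval w' x)%:E)%E).
  by apply: ereal_inf_lbound; exists v', w'.
have cw' : continuous (peval w') by exact: continuous_peval.
rewrite (_ : (\int[lambda]_(x in X) (w x)%:E)%E = (\int[lambda]_(x in X) (h x)%:E)%E);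
  last first.
  by apply: eq_integral => x; rewrite inE => Xx; rewrite wh.
rewrite !LamE// -EFinD lee_fin.
have := compact_Rintegral_dist cX lX cw' ch (e := 5 * d + a).
rewrite -/(Lam _) -/(Lam _) => /(_ _)/wrap[x Xx|].
  rewrite pevalD pevalC; have := qh x Xx; rewrite !ler_norml => /andP[? ?].
  by apply/andP; split; lra.
rewrite ler_norml => /andP[_ h1].
have : (5 * d + a) * fine (lambda X) <= e.
  rewrite aE -mulrDl mulrAC /d mulrA ler_pdivrMr//.
  by rewrite mulrC ler_pM2l// /M lerDl.
lra.
Qed.

Lemma sdp_dual_value_cvg :
  sdp_dual_value S gX gU k @[k --> \oo] --> dual_value S gX gU.
Proof.
suff -> : dual_value S gX gU = ereal_inf (range (sdp_dual_value S gX gU)).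
  exact/ereal_nonincreasing_cvgn/sdp_dual_value_mono.
apply/eqP; rewrite eq_le; apply/andP; split.
  by apply: le_ereal_inf_tmp => _ [k _ <-]; exact: dual_value_le_sdp.
apply: le_ereal_inf_tmp => _ [v [w [vw ->]]]; apply/lee_addgt0Pr => e e0.
have [k kP] := sdp_dual_near vw e0; apply: le_trans kP.
by apply: ereal_inf_lbound; exists k.
Qed.

(** * The moment programs *)

Definition pos_x k (l : mpoly n R -> R) : Prop :=
  (forall p, deg_le p k -> 0 <= l (p ^+ 2)) /\
  (forall i p, deg_le p (k - half_deg (gX i)) -> 0 <= l (gX i * p ^+ 2)).

Definition pos_xu k (l : mpoly (n + m) R -> R) : Prop :=
  [/\ forall p, deg_le p k -> 0 <= l (p ^+ 2),
    forall i p, deg_le p (k - half_deg (gX i)) -> 0 <= l (lift_x (gX i) * p ^+ 2) &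
    forall i p, deg_le p (k - half_deg (gU i)) -> 0 <= l (lift_u (gU i) * p ^+ 2)].

(** The constraints are stated for functionals on all polynomials, whose type does not depend on
    [k]: moment vectors of any order and integrals against measures are treated alike. *)
Definition moment_feasible k (ly : mpoly (n + m) R -> R) (l0 lh : mpoly n R -> R) :
  Prop :=
  [/\ forall v, deg_le v (2 * k) -> deg_le (Lpoly S v) (2 * k) -> ly (Lpoly S v) = l0 v,
    forall w, deg_le w (2 * k) -> l0 w + lh w = Lam (peval w),
    pos_xu k ly, pos_x k l0 & pos_x k lh].

Let LamP w : (\int[lambda]_(x in X) (peval w x)%:E)%E = (Lam (peval w))%:E.
Proof. by apply: LamE; exact: continuous_peval. Qed.

Lemma sdp_primal_feasibleP k (y : moments (n + m) k) (y0 yh : moments n k) :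
  sdp_primal_feasible S gX gU y y0 yh <->
  moment_feasible k (riesz y) (riesz y0) (riesz yh).
Proof.
split.
- move=> [h1 h2 [/psd_momentP m1 /psd_momentP m2 /psd_momentP m3] h4 h5]; split=> //.
  + by move=> w dw; apply: EFin_inj; rewrite h2// LamP.
  + split=> // i; first by have [/psd_localizingP] := h4 i.
    by have /psd_localizingP := h5 i.
  + by split=> // i; have [_ /psd_localizingP] := h4 i.
  + by split=> // i; have [_ _ /psd_localizingP] := h4 i.
- move=> [h1 h2 [m1 mX1 mU1] [m2 mX2] [m3 mX3]]; split=> //.
  + by move=> w dw; rewrite LamP h2.
  + by split; apply/psd_momentP.
  + by move=> i r; split; apply/psd_localizingP; [exact: mX1|exact: mX2|exact: mX3].
  + by move=> i; apply/psd_localizingP; exact: mU1.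
Qed.

(** For [k >= k0] the constraints of order [k] see the functionals only in degrees up to [2 * k], so
    a functional may be replaced by its truncated moment vector. *)
Lemma moment_feasible_ext k ly ly' l0 l0' lh lh' : (k0 <= k)%N ->
  (forall p, deg_le p (2 * k) -> ly' p = ly p) ->
  (forall p, deg_le p (2 * k) -> l0' p = l0 p) ->
  (forall p, deg_le p (2 * k) -> lh' p = lh p) ->
  moment_feasible k ly l0 lh -> moment_feasible k ly' l0' lh'.
Proof.
move=> kk ey e0 eh [h1 h2 [m1 mX1 mU1] [m2 mX2] [m3 mX3]].
have hX i : (half_deg (gX i) <= k)%N by rewrite (leq_trans (half_deg_minX gX gU i)).
have hU i : (half_deg (gU i) <= k)%N by rewrite (leq_trans (half_deg_minU gX gU i)).
have d2 N (p : mpoly N R) : deg_le p k -> deg_le (p ^+ 2) (2 * k).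
  by rewrite mulnC; exact: deg_leX.
have dloc N N' (g : mpoly N R) (g' p : mpoly N' R) : (half_deg g <= k)%N ->
    deg_le g' (msize g).-1 -> deg_le p (k - half_deg g) -> deg_le (g' * p ^+ 2) (2 * k).
  move=> gk dg dp; apply: deg_le_localizing.
    by apply: leq_trans gk; rewrite /half_deg uphalf_leq//; move: dg; rewrite /deg_le;
      move: (mmeasure _ g) (mmeasure _ g') => a b; lia.
  apply: deg_le_trans dp _; apply: leq_sub2l; rewrite /half_deg uphalf_leq//.
  by move: dg; rewrite /deg_le; move: (mmeasure _ g) (mmeasure _ g') => a b; lia.
have dpred N (g : mpoly N R) : deg_le g (msize g).-1 by rewrite /deg_le leqSpred.
split.
- by move=> v dv dL; rewrite ey// e0// h1.
- by move=> w dw; rewrite e0// eh// h2.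
- split=> [p dp|i p dp|i p dp].
  + by rewrite ey ?m1//; exact: d2.
  + by rewrite ey ?mX1//; apply: dloc (hX i) _ dp; exact: deg_le_comp_var.
  + by rewrite ey ?mU1//; apply: dloc (hU i) _ dp; exact: deg_le_comp_var.
- split=> [p dp|i p dp]; first by rewrite e0 ?m2//; exact: d2.
  by rewrite e0 ?mX2//; apply: dloc (hX i) _ dp; exact: dpred.
- split=> [p dp|i p dp]; first by rewrite eh ?m3//; exact: d2.
  by rewrite eh ?mX3//; apply: dloc (hX i) _ dp; exact: dpred.
Qed.

Lemma moment_feasible_mono k k' ly l0 lh : (k <= k')%N ->
  moment_feasible k' ly l0 lh -> moment_feasible k ly l0 lh.
Proof.
move=> kk' [h1 h2 [m1 mX1 mU1] [m2 mX2] [m3 mX3]].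
have kk2 : (2 * k <= 2 * k')%N by rewrite leq_mul2l kk'.
have T N (p : mpoly N R) : deg_le p k -> deg_le p k' by move=> /deg_le_trans; exact.
have Tg N (p : mpoly N R) h : deg_le p (k - h) -> deg_le p (k' - h).
  by move=> /deg_le_trans; apply; exact: leq_sub2r.
split.
- by move=> v dv dL; apply: h1; [exact: deg_le_trans dv kk2|exact: deg_le_trans dL kk2].
- by move=> w dw; apply: h2; exact: deg_le_trans dw kk2.
- by split=> [p /T/m1|i p /Tg/mX1|i p /Tg/mU1].
- by split=> [p /T/m2|i p /Tg/mX2].
- by split=> [p /T/m3|i p /Tg/mX3].
Qed.

Lemma sdp_primal_value_ge k ly l0 lh : (k0 <= k)%N ->
  is_linear ly -> is_linear l0 -> is_linear lh -> moment_feasible k ly l0 lh ->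
  ((l0 1)%:E <= sdp_primal_value S gX gU k)%E.
Proof.
move=> kk [yD yZ] [D0 Z0] [hD hZ] mf.
have [y yE] := moments_of_linear (k := k) yD yZ.
have [y0 y0E] := moments_of_linear (k := k) D0 Z0.
have [yh yhE] := moments_of_linear (k := k) hD hZ.
apply: ereal_sup_ubound; exists y, y0, yh; split.
  by apply/sdp_primal_feasibleP; exact: moment_feasible_ext mf.
by rewrite y0E// deg_le1.
Qed.

Lemma sdp_primal_value_mono k k' : (k0 <= k)%N -> (k <= k')%N ->
  (sdp_primal_value S gX gU k' <= sdp_primal_value S gX gU k)%E.
Proof.
move=> kk kk'; apply: ge_ereal_sup => _ [y [y0 [yh [/sdp_primal_feasibleP feas ->]]]].
apply: sdp_primal_value_ge (moment_feasible_mono kk' feas) => //; exact: is_linear_riesz.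
Qed.

Let finX (mu : {finite_measure set (borel 'rV[R]_n) -> \bar R}) : (mu X < +oo)%E.
Proof. by rewrite ltey_eq fin_num_measure. Qed.

Let mXU : measurable (X `*` U : set (borel ('rV[R]_n * 'rV[R]_m)%type)).
Proof. exact: compact_measurable_borel. Qed.

Let finXU (mu : {finite_measure set (borel ('rV[R]_n * 'rV[R]_m)%type) -> \bar R}) :
  (mu (X `*` U) < +oo)%E.
Proof. by rewrite ltey_eq fin_num_measure. Qed.

Let Iy (mu : {finite_measure set (borel ('rV[R]_n * 'rV[R]_m)%type) -> \bar R})
  (q : mpoly (n + m) R) : R := \int[mu]_(z in X `*` U) peval q (row_mx z.1 z.2).

Let Ix (mu : {finite_measure set (borel 'rV[R]_n) -> \bar R}) (p : mpoly n R) : R :=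
  \int[mu]_(x in X) peval p x.

Let Iy_linear mu : is_linear (Iy mu).
Proof.
split=> [p q|c p]; rewrite /Iy.
  rewrite -(compact_RintegralD cXU (finXU mu) (@continuous_peval_pair _ _ _ p)
    (@continuous_peval_pair _ _ _ q)).
  by apply: eq_Rintegral => z _; rewrite pevalD.
rewrite -(compact_RintegralZ cXU (finXU mu) c (@continuous_peval_pair _ _ _ p)).
by apply: eq_Rintegral => z _; rewrite pevalZ.
Qed.

Let Ix_linear mu : is_linear (Ix mu).
Proof.
split=> [p q|c p]; rewrite /Ix.
  rewrite -(compact_RintegralD cX (finX mu) (@continuous_peval _ _ p)
    (@continuous_peval _ _ q)).
  by apply: eq_Rintegral => z _; rewrite pevalD.
rewrite -(compact_RintegralZ cX (finX mu) c (@continuous_peval _ _ p)).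
by apply: eq_Rintegral => z _; rewrite pevalZ.
Qed.

Let Ix1 (mu : {finite_measure set (borel 'rV[R]_n) -> \bar R}) : mu X = (Ix mu 1)%:E.
Proof.
rewrite /Ix (_ : Rintegral _ _ _ = \int[mu]_(x in X) 1); last first.
  by apply: eq_Rintegral => x _; rewrite peval1.
by rewrite Rintegral_cst// mul1r fineK// fin_num_measure.
Qed.

Lemma primal_feasible_moment k mu mu0 muh : primal_feasible S gX gU mu mu0 muh ->
  moment_feasible k (Iy mu) (Ix mu0) (Ix muh).
Proof.
move=> [_ _ _ h1 h2]; split.
- move=> v _ _; apply: EFin_inj.
  have cv := @continuous_peval R n v.
  have := h1 _ (regular_poly RS v); rewrite (compact_integralE cX (finX mu0) cv) => <-.
  rewrite /Iy -(compact_integralE cXU (finXU mu) (@continuous_peval_pair _ _ _ _)).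
  by apply: eq_integral => z _; rewrite (regular_peval RS).
- move=> w _; apply: EFin_inj; have cw := @continuous_peval R n w.
  have := h2 (peval w) (continuous_subspaceT cw).
  by rewrite (compact_integralE cX (finX mu0) cw) (compact_integralE cX (finX muh) cw)
    LamP -EFinD.
- split=> [p _|i p _|i p _]; apply: Rintegral_ge0 => -[x u] [/= Xx Uu].
  + by rewrite pevalXn sqr_ge0.
  + by rewrite pevalM peval_lift_x pevalXn mulr_ge0 ?sqr_ge0//; exact: Xx.
  + by rewrite pevalM peval_lift_u pevalXn mulr_ge0 ?sqr_ge0//; exact: Uu.
- split=> [p _|i p _]; apply: Rintegral_ge0 => x Xx.
  + by rewrite pevalXn sqr_ge0.
  + by rewrite pevalM pevalXn mulr_ge0 ?sqr_ge0//; exact: Xx.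
- split=> [p _|i p _]; apply: Rintegral_ge0 => x Xx.
  + by rewrite pevalXn sqr_ge0.
  + by rewrite pevalM pevalXn mulr_ge0 ?sqr_ge0//; exact: Xx.
Qed.

Lemma primal_value_le_sdp k : (k0 <= k)%N ->
  (primal_value S gX gU <= sdp_primal_value S gX gU k)%E.
Proof.
move=> kk; apply: ge_ereal_sup => _ [mu [mu0 [muh [feas ->]]]]; rewrite Ix1.
exact: sdp_primal_value_ge (primal_feasible_moment k feas).
Qed.

Lemma pos_x_cert k l p : is_linear l -> pos_x k l -> sos_cert_x gX k p -> 0 <= l p.
Proof.
move=> ll [l1 lg] [p0 [pX [s0 sX ->]]]; rewrite ll.1 is_linear_sum// addr_ge0//.
  rewrite -[p0]mulr1; apply: is_sos_functional_ge0 s0 => // q dq.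
  by rewrite mul1r; exact: l1.
apply: sumr_ge0 => i _; apply: is_sos_functional_ge0 (sX i) => // q dq; exact: lg.
Qed.

Lemma pos_xu_cert k l q : is_linear l -> pos_xu k l -> sos_cert_xu gX gU k q -> 0 <= l q.
Proof.
move=> ll [l1 lX' lU'] [q0 [qX [rU [s0 sX sU ->]]]].
rewrite !ll.1 !is_linear_sum//; apply: addr_ge0; first apply: addr_ge0.
- rewrite -[q0]mulr1; apply: is_sos_functional_ge0 s0 => // p dp.
  by rewrite mul1r; exact: l1.
- apply: sumr_ge0 => i _; apply: is_sos_functional_ge0 (sX i) => // p dp; exact: lX'.
- apply: sumr_ge0 => i _; apply: is_sos_functional_ge0 (sU i) => // p dp; exact: lU'.
Qed.

(** * Limits of feasible functionals of growing order *)

Section limit_functionals.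
Variables (ly : nat -> mpoly (n + m) R -> R) (l0 lh : nat -> mpoly n R -> R).
Hypotheses (ylin : forall k, is_linear (ly k)) (lin0 : forall k, is_linear (l0 k))
  (linh : forall k, is_linear (lh k)).
Hypothesis feas : forall k, moment_feasible (k0 + k) (ly k) (l0 k) (lh k).

Let mass0 k : 0 <= l0 k 1 <= Lam (peval 1).
Proof.
have [_ h2 _ [m2 _] [m3 _]] := feas k.
rewrite -(h2 1 (deg_le1 _)) -(expr1n _ 2) m2 ?deg_le1//= lerDl.
by apply: m3; exact: deg_le1.
Qed.

Let massh k : 0 <= lh k 1 <= Lam (peval 1).
Proof.
have [_ h2 _ [m2 _] [m3 _]] := feas k.
rewrite -(h2 1 (deg_le1 _)) -(expr1n _ 2) m3 ?deg_le1//= lerDr.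
by apply: m2; exact: deg_le1.
Qed.

Let massy k : 0 <= ly k 1 <= Lam (peval 1) / kappa.
Proof.
have [h1 _ [m1 _ _] _ _] := feas k.
rewrite -{1}(expr1n _ 2) m1 ?deg_le1//= ler_pdivlMr// mulrC.
have := h1 1 (deg_le1 _); rewrite (regular_one RS) => /(_ (deg_leC _ _)).
by rewrite is_linearC// => ->; have /andP[] := mass0 k.
Qed.

Let near_order k1 : \forall k \near \oo, (k1 <= k0 + k)%N.
Proof. by exists k1 => // k /= k1k; rewrite (leq_trans k1k)// leq_addl. Qed.

(** With [|p| <= C] on [K], both [C + 1 + p] and [C + 1 - p] are strictly positive there, so
    eventually [|l k p| <= (C + 1) * l k 1]. *)
Let bound_functional N (l : nat -> mpoly N R -> R) (K : set 'rV[R]_N) (B : R) :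
  (forall k, is_linear (l k)) -> compact K -> (forall k, 0 <= l k 1 <= B) ->
  (forall p, (forall x, K x -> 0 < peval p x) -> \forall k \near \oo, 0 <= l k p) ->
  forall p, exists C, \forall k \near \oo, `|l k p| <= C.
Proof.
move=> ll cK lB pos p.
have [C C0 pC] := compact_fct_bounded cK (@continuous_peval _ _ p).
exists ((C + 1) * B).
have h1 : \forall k \near \oo, 0 <= l k (mpolyC N (C + 1) + p).
  apply: pos => x /pC; rewrite pevalD pevalC ler_norml => /andP[+ _]; lra.
have h2 : \forall k \near \oo, 0 <= l k (mpolyC N (C + 1) + - p).
  apply: pos => x /pC; rewrite pevalD pevalC pevalN ler_norml => /andP[_]; lra.
near=> k; have : 0 <= l k (mpolyC N (C + 1) + p) by near: k.
have : 0 <= l k (mpolyC N (C + 1) + - p) by near: k.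
rewrite !(ll k).1 is_linearC// is_linearN// => a1 a2.
have /andP[b0 b1] := lB k.
have : (C + 1) * l k 1 <= (C + 1) * B by rewrite ler_pM2l// addr_gt0.
by rewrite ler_norml; move=> ?; apply/andP; split; lra.
Unshelve. all: by end_near. Qed.

Let pos0 p : (forall x, X x -> 0 < peval p x) -> \forall k \near \oo, 0 <= l0 k p.
Proof.
move=> /(putinar_x ball_X)[k1 c1]; near=> k.
have [_ _ _ h _] := feas k; apply: (pos_x_cert (lin0 k) h).
by apply: sos_cert_x_mono c1; near: k; exact: near_order.
Unshelve. all: by end_near. Qed.

Let posh p : (forall x, X x -> 0 < peval p x) -> \forall k \near \oo, 0 <= lh k p.
Proof.
move=> /(putinar_x ball_X)[k1 c1]; near=> k.
have [_ _ _ _ h] := feas k; apply: (pos_x_cert (linh k) h).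
by apply: sos_cert_x_mono c1; near: k; exact: near_order.
Unshelve. all: by end_near. Qed.

Let row_image := [set row_mx z.1 z.2 | z in X `*` U].

Let posy q : (forall w, row_image w -> 0 < peval q w) -> \forall k \near \oo, 0 <= ly k q.
Proof.
move=> q0; have [x u Xx Uu|k1 c1] := putinar_xu ball_X ball_U (q := q).
  by apply: q0; exists (x, u).
near=> k; have [_ _ h _ _] := feas k; apply: (pos_xu_cert (ylin k) h).
by apply: sos_cert_xu_mono c1; near: k; exact: near_order.
Unshelve. all: by end_near. Qed.

Let compact_row_image : compact row_image.
Proof.
apply: (@continuous_compact _ _ (fun z : 'rV[R]_n * 'rV[R]_m => row_mx z.1 z.2)) => //.
exact/continuous_subspaceT/continuous_row_mx.
Qed.

Lemma limit_primal_feasible (c : R) : (forall k, c <= l0 k 1) ->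
  exists mu mu0 muh, primal_feasible S gX gU mu mu0 muh /\ (c%:E <= mu0 X)%E.
Proof.
move=> cl0.
have [F [UF Foo]] := ultraFilterLemma (@eventually_filter).
have [Ly LyP] := ultra_functional UF Foo
  (bound_functional ylin compact_row_image massy posy).
have [L0 L0P] := ultra_functional UF Foo (bound_functional lin0 cX mass0 pos0).
have [Lh LhP] := ultra_functional UF Foo (bound_functional linh cX massh posh).
have lLy := ultra_functional_linear UF Foo ylin LyP.
have lL0 := ultra_functional_linear UF Foo lin0 L0P.
have lLh := ultra_functional_linear UF Foo linh LhP.
(* Certificates exist only for strictly positive polynomials; a nonnegative one is first raised by a
   small constant, at a cost of at most [e] under [L]. *)
have nonneg N (l : nat -> mpoly N R -> R) (L : mpoly N R -> R) (K : set 'rV[R]_N) p :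
    (forall p, (fun k => l k p) @ F --> L p) -> is_linear L ->
    (forall p, (forall x, K x -> 0 < peval p x) -> \forall k \near \oo, 0 <= l k p) ->
    (forall x, K x -> 0 <= peval p x) -> 0 <= L p.
  move=> lP lL pos p0; apply/ler_addgt0Pr => e e0.
  have L1 : 0 <= L 1.
    by apply: (ultra_cvg_ge UF Foo _ (lP 1)); apply: pos => x _; rewrite peval1.
  have L10 : 0 < L 1 + 1 by rewrite ltr_wpDl.
  have d0 : 0 < e / (L 1 + 1) by rewrite divr_gt0.
  have : 0 <= L (p + mpolyC N (e / (L 1 + 1))).
    apply: (ultra_cvg_ge UF Foo _ (lP _)); apply: pos => x Kx.
    by rewrite pevalD pevalC ltr_wpDl// p0.
  rewrite lL.1 is_linearC// => h; rewrite (le_trans h)// lerD2l.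
  by rewrite mulrAC ler_pdivrMr// ler_pM2l// lerDl.
have [mu [muK muE]] := @moment_functional_measure R _ _ _ (X `*` U) Ly
  (@continuous_row_mx R n m) cXU lLy.1 lLy.2
  (fun p p0 => nonneg _ _ _ row_image p LyP lLy posy
     (fun w '(ex_intro2 z Kz zw) => eq_ind _ (fun w => 0 <= peval p w) (p0 z Kz) _ zw))
  (fun h e ch e0 => polynomial_dense_pair cXU ch e0).
have [mu0 [mu0K mu0E]] := @moment_functional_measure R _ _ id X L0
  (fun x => @cvg_id _ _) cX lL0.1 lL0.2 (fun p => nonneg _ _ _ X p L0P lL0 pos0)
  (fun h e ch e0 => polynomial_dense_rV cX ch e0).
have [muh [muhK muhE]] := @moment_functional_measure R _ _ id X Lh
  (fun x => @cvg_id _ _) cX lLh.1 lLh.2 (fun p => nonneg _ _ _ X p LhP lLh posh)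
  (fun h e ch e0 => polynomial_dense_rV cX ch e0).
(* For a fixed [v] the degree restrictions of the constraint hold from some order on, so the limit
   satisfies it without restriction. *)
have LL v : Ly (Lpoly S v) = L0 v.
  apply: (ultra_cvg_unique UF Foo _ (LyP _) (L0P _)); near=> k.
  have [h1 _ _ _ _] := feas k.
  have big : (msize v + msize (Lpoly S v) <= k0 + k)%N by near: k; exact: near_order.
  by apply: h1; rewrite /deg_le; move: big;
    move: (mmeasure _ v) (mmeasure _ (Lpoly S v)) => a b; lia.
have LS w : L0 w + Lh w = Lam (peval w).
  apply: (ultra_cvg_unique UF Foo (a := fun k => l0 k w + lh k w) (b := fun=> Lam
    (peval w))).
  - near=> k; have [_ h2 _ _ _] := feas k; apply: h2.
    have big : (msize w <= k0 + k)%N by near: k; exact: near_order.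
    by rewrite /deg_le; move: big; move: (mmeasure _ w) => a; lia.
  - by apply: cvgD; [exact: L0P|exact: LhP].
  - exact: cvg_cst.
exists mu, mu0, muh; split; last first.
  rewrite Ix1 /Ix mu0E lee_fin.
  by apply: (ultra_cvg_ge UF Foo _ (L0P 1)); near=> k; exact: cl0.
split=> //.
- move=> v Vv; have cv := regular_continuous RS Vv.
  have cL := regular_continuousL RS Vv.
  rewrite (compact_integralE cXU (finXU mu) cL) (compact_integralE cX (finX mu0) cv).
  congr EFin; apply/eqP; rewrite -subr_eq0; apply/eqP.
  (* The constraint holds for polynomials; a polynomial uniformly close to [v] whose image under [L]
     is close to [L v] transfers it, with an error proportional to the masses. *)
  apply: (@eq0_norm_le_eps _ _ (fine (mu (X `*` U)) + fine (mu0 X))) => e e0.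
  have [p pP] := regular_approx RS cX cU Vv e0.
  have h1 : `|Ly (Lpoly S p) - \int[mu]_(z in X `*` U) Lop S v z.1 z.2| <= e * fine (mu
    (X `*` U)).
    rewrite -muE; apply: (compact_Rintegral_dist cXU (finXU mu) (@continuous_peval_pair
      _ _ _ _) cL).
    move=> [x u] [/= Xx Uu]; rewrite (regular_peval RS).
    by have [_] := pP x Xx; apply.
  have h2 : `|L0 p - \int[mu0]_(x in X) v x| <= e * fine (mu0 X).
    rewrite -mu0E; apply: (compact_Rintegral_dist cX (finX mu0) (@continuous_peval _ _
      _) cv).
    by move=> x /pP[].
  move: h1 h2; rewrite LL !ler_norml mulrDr => /andP[? ?] /andP[? ?].
  by apply/andP; split; lra.
- move=> w cw; have [h ch wh] := tietze_compact cX cw.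
  have wE (nu : {measure set (borel 'rV[R]_n) -> \bar R}) :
      (\int[nu]_(x in X) (w x)%:E = \int[nu]_(x in X) (h x)%:E)%E.
    by apply: eq_integral => x; rewrite inE => Xx; rewrite wh.
  rewrite !wE LamE// (compact_integralE cX (finX mu0) ch) (compact_integralE cX (finX
    muh) ch).
  rewrite -EFinD; congr EFin; apply/eqP; rewrite -subr_eq0; apply/eqP.
  apply: (@eq0_norm_le_eps _ _ (fine (mu0 X) + fine (muh X) + fine (lambda X))) => e e0.
  have [p pP] := polynomial_dense_rV cX ch e0.
  have cp := @continuous_peval _ _ p.
  have h1 := compact_Rintegral_dist cX (finX mu0) cp ch pP.
  have h2 := compact_Rintegral_dist cX (finX muh) cp ch pP.
  have h3 := compact_Rintegral_dist cX lX cp ch pP.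
  rewrite -/(Lam _) -/(Lam _) -LS -mu0E -muhE in h3.
  move: h1 h2 h3; rewrite !ler_norml !mulrDr => /andP[? ?] /andP[? ?] /andP[? ?].
  by apply/andP; split; lra.
Unshelve. all: by end_near. Qed.

End limit_functionals.

Lemma sdp_primal_value_cvg :
  sdp_primal_value S gX gU k @[k --> \oo] --> primal_value S gX gU.
Proof.
(* Monotonicity and the lower bound are available from order [k0] on. *)
rewrite -(cvg_shiftn k0).
pose u k := sdp_primal_value S gX gU (k + k0)%N.
suff -> : primal_value S gX gU = ereal_inf (range u).
  apply: ereal_nonincreasing_cvgn => k k' kk'.
  by apply: sdp_primal_value_mono; rewrite ?leq_addl// leq_add2r.
apply/eqP; rewrite eq_le; apply/andP; split.
  by apply: le_ereal_inf_tmp => _ [k _ <-]; apply: primal_value_le_sdp; exact: leq_addl.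
(* A real [c] fits strictly between the two values even if they are infinite; it becomes a uniform
   lower bound for the masses of [y0]. *)
rewrite leNgt; apply/negP => /ereal_lt_real[c [pc cu]].
have H k : exists t : moments (n + m) (k0 + k) * moments n (k0 + k) * moments n (k0 + k),
    moment_feasible (k0 + k) (riesz t.1.1) (riesz t.1.2) (riesz t.2) /\ c <= riesz
      t.1.2 1.
  have : (c%:E < sdp_primal_value S gX gU (k0 + k))%E.
    rewrite (lt_le_trans cu)//; apply: ereal_inf_lbound; exists k => //.
    by rewrite /u addnC.
  move=> /ereal_sup_gt[_ [y [y0 [yh [/sdp_primal_feasibleP feas ->]]]]].
  by rewrite lte_fin => /ltW cy; exists (y, y0, yh).
(* The type of the moment vectors depends on [k], so the choice is made pointwise by [cid]. *)
pose t k := sval (cid (H k)).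
have tP k : moment_feasible (k0 + k) (riesz (t k).1.1) (riesz (t k).1.2) (riesz (t k).2)
    /\ c <= riesz (t k).1.2 1 by exact: svalP (cid (H k)).
have [|||||mu [mu0 [muh [feas cmu]]]] := @limit_primal_feasible
  (fun k => riesz (t k).1.1) (fun k => riesz (t k).1.2) (fun k => riesz (t k).2) _ _ _
    _ c.
- by move=> k; exact: is_linear_riesz.
- by move=> k; exact: is_linear_riesz.
- by move=> k; exact: is_linear_riesz.
- by move=> k; have [] := tP k.
- by move=> k; have [] := tP k.
have : (mu0 X <= primal_value S gX gU)%E.
  by apply: ereal_sup_ubound; exists mu, mu0, muh.
by rewrite leNgt (lt_le_trans pc cmu).
Qed.

End hierarchy.

Theorem theorem5 (R : realType) (n m nX nU : nat)
    (f : n.-tuple (mpoly (n + m) R))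
    (gX : 'I_nX -> mpoly n R) (gU : 'I_nU -> mpoly m R) (RX RU : R)
    (compact_X : compact (semialg gX)) (compact_U : compact (semialg gU))
    (ball_X : exists i, gX i = ball_poly n RX)
    (ball_U : exists i, gU i = ball_poly m RU)
    (S : setting R n m)
    (S_setting :
      (exists2 alpha, 0 < alpha < 1 & S = discrete_setting alpha f) \/
      (exists2 beta, 0 < beta & S = continuous_setting beta f)) :
  [/\ forall k, (min_order gX gU <= k)%N ->
        (dual_value S gX gU <= sdp_dual_value S gX gU k.+1 /\
         sdp_dual_value S gX gU k.+1 <= sdp_dual_value S gX gU k)%E,
      sdp_dual_value S gX gU k @[k --> \oo] --> dual_value S gX gU,
      forall k, (min_order gX gU <= k)%N ->
        (primal_value S gX gU <= sdp_primal_value S gX gU k.+1 /\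
         sdp_primal_value S gX gU k.+1 <= sdp_primal_value S gX gU k)%E &
      sdp_primal_value S gX gU k @[k --> \oo] --> primal_value S gX gU].
Proof.
have [kappa RS] : exists kappa, regular_setting S kappa.
  case: S_setting => [[alpha a01 ->]|[beta b0 ->]].
    by exists (1 - alpha); exact: discrete_regular.
  by exists beta; exact: continuous_regular.
split.
- move=> k _; split; first exact: dual_value_le_sdp RS _.
  by apply: sdp_dual_value_mono; exact: leqnSn.
- exact: sdp_dual_value_cvg compact_X compact_U ball_X ball_U RS.
- move=> k kk; split.
    by apply: (primal_value_le_sdp compact_X compact_U RS); exact: leqW.
  exact: (sdp_primal_value_mono compact_X RS kk (leqnSn k)).
- exact: sdp_primal_value_cvg compact_X compact_U ball_X ball_U RS.
Qed.
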